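(* Let $T>0$, $H\in(\frac12,1)$, $\alpha\in(1-H,1)$, $\sigma\in\mathbb R\setminus\{0\}$, $x_0\in\mathbb R$, and let $f\in C_b^\infty$. Let $N\ge1$ be an integer, $h=T/N$, $t_n=nh$ for $n=0,1,\dots,N$, and define the Euler--Maruyama approximations recursively by $$x_n=x_0+\frac1{\Gamma(\alpha)}\sum_{j=1}^nf(x_{j-1})\int_{t_{j-1}}^{t_j}(t_n-s)^{\alpha-1}\,\mathrm ds+\frac{\sigma}{\Gamma(\alpha)}\int_0^{t_n}(t_n-s)^{\alpha-1}\,\mathrm dW_H(s),\qquad n=1,\dots,N.$$ Then for every $n\in\{1,2,\dots,N\}$ the random variable $x_n$ admits an infinitely differentiable density function (with respect to the Lebesgue measure on $\mathbb R$).
   Context: $W_H$ is a fractional Brownian motion with Hurst index $H$ (centered Gaussian process with covariance $H(2H-1)\int_0^t\int_0^s|u-v|^{2H-2}\mathrm du\,\mathrm dv$) on a complete filtered probability space $(\Omega,\mathscr F,\{\mathscr F_t\}_{t\in[0,T]},\mathbb P)$ satisfying the usual conditions. The stochastic integral of a deterministic function against $W_H$ is the Wiener integral: the isometric extension of $\mathbf 1_{[0,t]}\mapsto W_H(t)$ to the Hilbert space $\mathcal H$ obtained by closing the step functions on $[0,T]$ under the scalar product $\langle\varphi,\phi\rangle_{\mathcal H}=H(2H-1)\int_0^T\int_0^T\varphi(u)\phi(v)|u-v|^{2H-2}\mathrm du\,\mathrm dv$. $\Gamma$ is the Gamma function. $C_b^\infty$ is the space of (not necessarily bounded) smooth functions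 $f:\mathbb R\to\mathbb R$ all of whose derivatives of order $\ge1$ are bounded. *)

(* Defs.v *)
From HB Require Import structures.
From mathcomp Require Import all_boot all_order all_algebra.
From mathcomp Require Import all_classical all_reals all_analysis.
Import Order.TTheory GRing.Theory Num.Theory.
Import numFieldNormedType.Exports.

Set Implicit Arguments.
Unset Strict Implicit.
Unset Printing Implicit Defensive.

Local Open Scope classical_set_scope.
Local Open Scope ring_scope.

Definition Gamma (R : realType) (a : R) : R :=
  \int[lebesgue_measure]_(x in `]0, +oo[) (x `^ (a - 1) * expR (- x)).

Definition smooth (R : realType) (f : R -> R) : Prop :=
  forall (k : nat) (x : R), derivable (derive1n k f) x 1.

(* The function itself may be unbounded, only its derivatives are bounded. *)
Definition Cb_smooth (R : realType) (f : R -> R) : Prop :=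
  smooth f /\
  forall k : nat, (1 <= k)%N -> exists M : R, forall x, `|derive1n k f x| <= M.

(* Filtration indexed by [0, T]; [F t] is a sigma-algebra on Omega coarser than
   the ambient one. Values of [F] outside [0, T] are irrelevant. *)
Record usual_filtration d (Omega : measurableType d) (R : realType)
    (P : probability Omega R) (T : R) (F : R -> set (set Omega)) : Prop := {
  filtration_sigma : forall t : R, 0 <= t <= T -> sigma_algebra setT (F t) ;
  filtration_sub : forall t : R, 0 <= t <= T -> F t `<=` measurable ;
  filtration_mono : forall s t : R, 0 <= s -> s <= t -> t <= T -> F s `<=` F t ;
  filtration_null : forall A, P.-negligible A -> F 0 A ;
  filtration_rcont : forall t : R, 0 <= t -> t < T ->
    F t = \bigcap_(s in [set s | t < s <= T]) F s }.

(* [normal_prob m 0] is a junk value in the library, whence the case split: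
   the Gaussian law with zero variance is a Dirac mass. *)
Definition gaussian_rv d (Omega : measurableType d) (R : realType)
    (P : probability Omega R) (X : Omega -> R) : Prop :=
  exists m s : R, forall A : set R, measurable A ->
    pushforward P X A = if s == 0 then \d_m A else normal_prob m s A.

(* The list [:: (c_1, t_1); ...; (c_k, t_k)] encodes the step function
   c_1 1_[0,t_1] + ... + c_k 1_[0,t_k]. *)
Definition step_code (R : realType) : Type := seq (R * R).

Definition step_on (R : realType) (T : R) (s : step_code R) : Prop :=
  forall p, p \in s -> 0 <= p.2 <= T.

Definition step_fun (R : realType) (s : step_code R) : R -> R :=
  fun u => \sum_(p <- s) p.1 * \1_(`[0, p.2]) u.

Definition step_integral d (Omega : measurableType d) (R : realType)
    (P : probability Omega R) (W : R -> {RV P >-> R}) (s : step_code R) :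
    Omega -> R :=
  fun w => \sum_(p <- s) p.1 * W p.2 w.

Definition gaussian_process d (Omega : measurableType d) (R : realType)
    (P : probability Omega R) (T : R) (W : R -> {RV P >-> R}) : Prop :=
  forall s : step_code R, step_on T s -> gaussian_rv P (step_integral W s).

Record fractional_brownian_motion d (Omega : measurableType d) (R : realType)
    (P : probability Omega R) (T H : R) (W : R -> {RV P >-> R}) : Prop := {
  fbm_gaussian : gaussian_process T W ;
  fbm_centered : forall t : R, 0 <= t <= T -> ('E_P[W t] = 0)%E ;
  fbm_covariance : forall t s : R, 0 <= t <= T -> 0 <= s <= T ->
    covariance P (W t) (W s) =
    (H * (2 * H - 1) *
     \int[lebesgue_measure]_(v in `[0, t])
       \int[lebesgue_measure]_(u in `[0, s]) (`|u - v| `^ (2 * H - 2)))%:E }.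

Definition inner_H (R : realType) (T H : R) (phi psi : R -> R) : R :=
  H * (2 * H - 1) *
  \int[lebesgue_measure]_(v in `[0, T])
    \int[lebesgue_measure]_(u in `[0, T])
      (phi u * psi v * `|u - v| `^ (2 * H - 2)).

(* Measurable functions on [0, T] for which the double integral defining
   <phi, phi>_H converges absolutely. The closure of the step functions also
   contains elements that are not functions; the functions satisfying this
   predicate are elements of it, with scalar product [inner_H]. *)
Definition function_in_H (R : realType) (T H : R) (phi : R -> R) : Prop :=
  measurable_fun `[0, T] phi /\
  (lebesgue_measure \x lebesgue_measure)%E.-integrable
    (`[0, T] `*` `[0, T])
    (fun z : R * R =>
       (phi z.1 * phi z.2 * `|z.1 - z.2| `^ (2 * H - 2))%:E).

(* [X] is (a version of) the Wiener integral of [phi] against [W]: the L^2 limit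
   of the integrals of step functions converging to [phi] in the Hilbert space.
   By the isometry, the limit does not depend on the sequence. *)
Definition is_wiener_integral d (Omega : measurableType d) (R : realType)
    (P : probability Omega R) (T H : R) (W : R -> {RV P >-> R})
    (phi : R -> R) (X : {RV P >-> R}) : Prop :=
  function_in_H T H phi /\
  exists s : nat -> step_code R,
    [/\ forall k, step_on T (s k),
        (fun k => let delta := fun u => phi u - step_fun (s k) u in
                  inner_H T H delta delta) @ \oo --> (0 : R) &
        (fun k => 'E_P[fun w => ((X w - step_integral W (s k) w) ^+ 2)%R]%E)
          @ \oo --> 0%E].

(* The indicator is needed: [a `^ b] is not 0 in the library for a < 0. *)
Definition fractional_kernel (R : realType) (alpha t : R) : R -> R :=
  fun s => \1_(`[0, t]) s * (t - s) `^ (alpha - 1).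

Definition has_density d (Omega : measurableType d) (R : realType)
    (P : probability Omega R) (X : {RV P >-> R}) (p : R -> R) : Prop :=
  [/\ measurable_fun setT p,
      forall y, 0 <= p y &
      forall A : set R, measurable A ->
        distribution P X A = (\int[lebesgue_measure]_(y in A) (p y)%:E)%E].

(* Main.v *)
(* Conditioning on the past, x_n is a shifted nondegenerate normal variable.  Write U_k for the
   k-th Wiener integral and project U_n in L^2 on U_1, ..., U_{n-1}: the residual G is Gaussian
   and uncorrelated with, hence independent of, the past, while x_n = Z + c G with Z a function
   of the past.  If the variance s^2 of c G is positive, x_n has the density
   y |-> E[normal_pdf Z s y], which is smooth because all derivatives of the normal density are
   bounded.

   For the positivity of s, the kernel |u - v|^(2H-2) is, up to a constant, the integral over all
   windows [r, r + l] of l^(2H-4) 1_[r, r + l](u) 1_[r, r + l](v).  So the variance of a Wiener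
   integral is an integral of squared window averages of its integrand.  On ]t_{n-1}, t_n] the
   integrand of G is the positive kernel of U_n alone, because the kernels of the earlier U_k
   vanish there, so windows starting in that interval contribute a positive amount. *)

Require Import Defs.
From HB Require Import structures.
From mathcomp Require Import all_boot all_order all_algebra.
From mathcomp Require Import all_classical all_reals all_analysis.
From mathcomp Require Import measurable_realfun.
From mathcomp Require Import ring lra.
Import Order.TTheory GRing.Theory Num.Theory.
Import numFieldNormedType.Exports.

Set Implicit Arguments.
Unset Strict Implicit.
Unset Printing Implicit Defensive.

Local Open Scope classical_set_scope.
Local Open Scope ring_scope.

(** * Densities, the normal law and its characteristic function *)

(** Gaussianity of the process gives only one-dimensional laws of linear combinations, so
    independence is reached through characteristic functions. Combinations of Wiener integrals have
    explicit cosine transforms, hence lack of correlation factors the joint transform. A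
    one-dimensional uniqueness theorem, for laws weighted by a bounded function, then handles the
    past one coordinate at a time. Cosines with a free phase stand for complex exponentials.

    The other obstacle is the singular kernel, whose scalar product is not visibly positive. Window
    averages make it an ordinary L^2 product: the same L^2 geometry serves random variables and
    integrands, and the isometry passes to limits. Absolute convergence is kept as square
    integrability of the window averages of the absolute value. The exponent 2H-4 comes from
    scaling: windows of length l covering two points at distance x have left ends in a set of length
    l - x, and the integral of l^(2H-4) (l - x) over l > x is a multiple of x^(2H-2). *)

Section density.
Import HBNNSimple.
Context d (T : measurableType d) (R : realType).
Variables (mu nu : {measure set T -> \bar R}) (p : T -> R).
Hypothesis mp : measurable_fun setT p.
Hypothesis p_ge0 : forall x, 0 <= p x.
Hypothesis nuE : forall A, measurable A -> nu A = (\int[mu]_(x in A) (p x)%:E)%E.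
Local Open Scope ereal_scope.

(** The hypothesis [nuE] is the case of an indicator; linearity gives simple functions and monotone
    convergence the rest. *)
Lemma ge0_integral_density (f : T -> \bar R) :
  (forall x, 0 <= f x) -> measurable_fun setT f ->
  \int[nu]_x f x = \int[mu]_x (f x * (p x)%:E).
Proof.
move=> f0 mf.
have mpE : measurable_fun setT (EFin \o p) by exact/measurable_EFinP.
pose h := nnsfun_approx measurableT mf.
have fE x : f x = limn (fun n => (h n x)%:E).
  by apply/esym/cvg_lim => //; exact: cvg_nnsfun_approx.
transitivity (limn (fun n => \int[nu]_x (h n x)%:E)).
  under eq_integral do rewrite fE.
  apply: monotone_convergence => //.
  - by move=> n; exact/measurable_EFinP.
  - by move=> n x _; rewrite lee_fin.
  - by move=> x _ a b ab; rewrite lee_fin; exact/lefP/nd_nnsfun_approx.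
transitivity (limn (fun n => \int[mu]_x ((h n x)%:E * (p x)%:E))); last first.
  rewrite -monotone_convergence //.
  - apply: eq_integral => x _; apply/cvg_lim => //; apply: cvgeZr => //.
    exact: cvg_nnsfun_approx.
  - by move=> n; apply: emeasurable_funM => //; exact/measurable_EFinP.
  - by move=> n x _; rewrite mule_ge0 ?lee_fin.
  - move=> x _ a b ab; rewrite lee_wpmul2r ?lee_fin//.
    exact/lefP/nd_nnsfun_approx.
congr (limn _); apply/funext => n.
have indm r : measurable_fun setT (fun x => (r * \1_(h n @^-1` [set r]) x)%:E).
  by apply/measurable_EFinP; exact: measurable_funM.
transitivity (\int[nu]_x
   (\sum_(y \in range (h n)) (y * \1_(h n @^-1` [set y]) x)%:E)).
  by apply: eq_integral => t _; rewrite /= fimfunE -fsumEFin.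
rewrite ge0_integral_fsum//; last by move=> m y _; exact: nnfun_muleindic_ge0.
transitivity (\int[mu]_x (\sum_(y \in range (h n))
    (y * \1_(h n @^-1` [set y]) x)%:E * (p x)%:E)); last first.
  apply: eq_integral => x _.
  rewrite -ge0_mule_fsuml => [|y]; last exact: nnfun_muleindic_ge0.
  by rewrite fsumEFin // -(fimfunE _ x).
rewrite ge0_integral_fsum//; last 2 first.
  - by move=> y; exact: emeasurable_funM.
  - by move=> m y _; apply: mule_ge0; [exact: nnfun_muleindic_ge0|rewrite lee_fin].
apply: eq_fsbigr => r /[!inE] -[w _ rw].
have r0 : (0 <= r)%R by rewrite -rw.
have mB : measurable (h n @^-1` [set r]) by [].
under eq_integral do rewrite EFinM.
rewrite ge0_integralZl//; last exact/measurable_EFinP.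
rewrite integral_indic// setIT nuE//.
under [RHS]eq_integral do rewrite EFinM -muleA.
rewrite ge0_integralZl//; last 2 first.
  - by apply: emeasurable_funM => //; exact/measurable_EFinP.
  - by move=> x _; rewrite mule_ge0// lee_fin.
congr (_ * _); rewrite integral_mkcond; apply: eq_integral => x _.
by rewrite epatch_indic muleC.
Qed.

(** Multiplication by the nonnegative [p] commutes with positive and negative parts, so both sides
    are the same difference of extended integrals, whether or not [f] is integrable. *)
Lemma Rintegral_density (f : T -> R) : measurable_fun setT f ->
  (\int[nu]_x f x)%R = (\int[mu]_x (f x * p x))%R.
Proof.
move=> mf; rewrite /Rintegral; congr fine.
have mfE : measurable_fun setT (EFin \o f) by exact/measurable_EFinP.
rewrite integralE [RHS]integralE; congr (_ - _).
  rewrite ge0_integral_density//; last exact: measurable_funepos.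
  apply: eq_integral => x _; rewrite !funeposE /= -!EFin_max -EFinM.
  by rewrite maxr_pMl// mul0r.
rewrite ge0_integral_density//; last exact: measurable_funeneg.
apply: eq_integral => x _; rewrite !funenegE /= -!EFin_max -EFinM.
by rewrite maxr_pMl// mul0r mulNr.
Qed.

End density.

Section affine.
Context (R : realType).
Notation mu := (@lebesgue_measure R).

(** The pushforward of Lebesgue measure under the affine map, scaled by [s], gives half-open
    intervals their length, and this determines the measure. *)
Lemma lebesgue_measure_affine (m s : R) (A : set R) : 0 < s -> measurable A ->
  lebesgue_measure A = (s%:E * lebesgue_measure ((fun x => (m + s * x)%R) @^-1` A))%E.
Proof.
move=> s0 mA.
have maff : measurable_fun setT ((fun x => m + s * x) : measurableTypeR R -> measurableTypeR R).
  by apply: measurable_funD => //; exact: measurable_funM.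
pose sn := NngNum (ltW s0).
pose nu : {measure set (measurableTypeR R) -> \bar R} :=
  measure_function_pushforward__canonical__measure_function_Measure mu maff.
have := @lebesgue_measure_unique R (mscale sn nu) _ A mA.
apply => _ [[a b]] _ <-.
transitivity (s%:E * mu ((fun x => m + s * x)%R @^-1` `]a, b]))%E => //.
rewrite (_ : _ @^-1` _ = `](a - m) / s, (b - m) / s]%classic); last first.
  apply/seteqP; split => x /=; rewrite !in_itv/= ltr_pdivrMr// ler_pdivlMr//.
    by move=> /andP[? ?]; apply/andP; split; lra.
  by move=> /andP[? ?]; apply/andP; split; lra.
rewrite !lebesgue_measure_itv/= !lte_fin ltr_pM2r ?invr_gt0// ltrD2r.
case: ifPn => _; last by rewrite mule0.
by rewrite -!EFinB -EFinM; congr EFin; field; rewrite gt_eqF.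
Qed.

Lemma ge0_integral_affine (m s : R) (f : R -> \bar R) : 0 < s ->
  (forall x, (0 <= f x)%E) -> measurable_fun setT f ->
  (\int[mu]_x f x = s%:E * \int[mu]_x f (m + s * x)%R)%E.
Proof.
move=> s0 f0 mf.
have maff : measurable_fun setT ((fun x => m + s * x) : measurableTypeR R -> measurableTypeR R).
  by apply: measurable_funD => //; exact: measurable_funM.
pose sn := NngNum (ltW s0).
pose nu : {measure set (measurableTypeR R) -> \bar R} :=
  measure_function_pushforward__canonical__measure_function_Measure mu maff.
transitivity (\int[mscale sn nu]_x f x)%E.
  apply: eq_measure_integral => A mA _.
  exact: (lebesgue_measure_affine m s0 mA).
rewrite ge0_integral_mscale//=; congr (_ * _)%E.
exact: (ge0_integral_pushforward maff).
Qed.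

End affine.

(** * Gaussian integration by parts *)

Section line.
Context (R : realType).
Notation mu := (@lebesgue_measure R).
Implicit Types F f : R -> R.

(** On a symmetric interval the integral is an increment of [F]. The decay of order 1/|x| sends both
    boundary values to 0, and domination by |f| passes to the limit on the other side. *)
Lemma Rintegral_derivative_eq0 F f (C : R) :
  (forall x : R, is_derive x 1 F (f x)) -> continuous f ->
  mu.-integrable setT (EFin \o f) -> (forall x, `|x| * `|F x| <= C) ->
  \int[mu]_x f x = 0.
Proof.
move=> dF cf fi FC.
have mf : measurable_fun setT f by exact: continuous_measurable_fun.
have C0 : 0 <= C by apply: le_trans (FC 0); rewrite normr0 mul0r.
pose g n := f \_ `[- n.+1%:R, n.+1%:R].
have cvg1 : (\int[mu]_x (g n x)%:E)%E @[n --> \oo] --> (\int[mu]_x (f x)%:E)%E.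
  have [] // := @dominated_convergence _ _ _ mu setT measurableT
    (fun n x => (g n x)%:E) (fun x => (f x)%:E) (fun x => `|f x|%:E).
  - move=> n; apply/measurable_EFinP; apply/measurable_restrict => //.
    by apply: measurable_funTS.
  - exact/measurable_EFinP.
  - apply: aeW => x _; apply: cvg_EFin; first exact: nearW.
    apply: cvg_near_cst; near=> n; rewrite /= /g /patch ifT//.
    rewrite inE/= in_itv/= -ler_norml (@le_trans _ _ n%:R) ?ler_nat//.
    by near: n; exact: nbhs_infty_ger.
  - exact: (integrable_norm fi).
  - apply: aeW => x n _; rewrite lee_fin /g patchE; case: ifP => //.
    by rewrite normr0.
have gE n : (\int[mu]_x (g n x)%:E)%E = (F n.+1%:R - F (- n.+1%:R))%:E.
  transitivity (\int[mu]_(x in `[(- n.+1%:R)%R, (n.+1%:R)%R]) (f x)%:E)%E.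
    rewrite [RHS]integral_mkcond; apply: eq_integral => x _.
    by rewrite /g /patch /=; case: ifP.
  rewrite (@continuous_FTC2 _ _ F)//.
  - by rewrite (@lt_trans _ _ 0)// oppr_lt0.
  - exact: continuous_subspaceT.
  - split.
    + by move=> x _; apply: ex_derive.
    + apply: cvg_at_right_filter; apply: differentiable_continuous.
      by apply/derivable1_diffP; exact: ex_derive.
    + apply: cvg_at_left_filter; apply: differentiable_continuous.
      by apply/derivable1_diffP; exact: ex_derive.
  - by move=> x _; rewrite derive1E; apply: derive_val.
have cvg2 : (F n.+1%:R - F (- n.+1%:R))%:E @[n --> \oo] --> (0:R)%:E.
  apply: cvg_EFin; first exact: nearW.
  apply: norm_cvg0.
  apply: (@squeeze_cvgr _ _ _ _ (cst 0) (fun n => (2 * C) * n.+1%:R^-1)).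
  - apply: nearW => n; rewrite normr_ge0/= ler_pdivlMr//.
    have := FC n.+1%:R; have := FC (- n.+1%:R).
    rewrite normrN gtr0_norm//.
    have := ler_normB (F n.+1%:R) (F (- n.+1%:R)) => h h1 h2.
    have : `|F n.+1%:R - F (- n.+1%:R)| * n.+1%:R <= (`|F n.+1%:R| + `|F (- n.+1%:R)|) * n.+1%:R.
      by rewrite ler_wpM2r.
    lra.
  - exact: cvg_cst.
  - rewrite -[X in _ --> X](mulr0 (2 * C)); apply: cvgM; first exact: cvg_cst.
    exact: cvg_harmonic.
rewrite /Rintegral; move: cvg1; under eq_fun do rewrite gE.
by move=> /(cvg_unique _ cvg2) <-.
Unshelve. all: by end_near. Qed.

Notation pdf := (@normal_pdf R 0 1).

Lemma normal01E (z : R) : pdf z = normal_peak 1 * expR (- (z ^+ 2 / 2)).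
Proof.
rewrite normal_pdfE ?oner_eq0// /normal_fun; congr (_ * expR _).
by rewrite subr0 expr1n mulNr.
Qed.

Lemma is_derive_normal01 (x : R) : is_derive x 1 pdf (- x * pdf x).
Proof.
rewrite (_ : normal_pdf 0 1 = (fun z => normal_peak 1 * expR (- (z ^+ 2 / 2)))); last first.
  by apply/funext => z; rewrite normal01E.
apply: is_derive_eq; rewrite /GRing.scale/=.
by field.
Qed.

Lemma continuous_normal01 : continuous pdf.
Proof. by apply: continuous_normal_pdf; rewrite oner_eq0. Qed.

Lemma sqr_normal01_le (z : R) : (1 + z ^+ 2) * pdf z <= 2 * normal_peak 1.
Proof.
rewrite normal01E mulrCA (mulrC 2) ler_wpM2l ?normal_peak_ge0//.
rewrite expRN ler_pdivrMr ?expR_gt0//.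
have := expR_ge1Dx (z ^+ 2 / 2); lra.
Qed.

(** Half of the exponent absorbs the polynomial: 1 + z^2 <= 4 exp(z^2/4) leaves exp(-z^2/4), up to a
    constant the normal density of variance 2. *)
Lemma integrable_sqr_normal01 :
  mu.-integrable setT (EFin \o (fun z => (1 + z ^+ 2) * pdf z)).
Proof.
pose s : R := Num.sqrt 2.
have s2 : s ^+ 2 = 2 by rewrite sqr_sqrtr.
have s0 : s != 0 by rewrite gt_eqF// sqrtr_gt0.
have p0 := normal_peak_gt0 s0.
pose K : R := 4 * normal_peak 1 / normal_peak s.
have Kp : mu.-integrable setT (fun z => K%:E * (normal_pdf 0 s z)%:E)%E.
  by apply: integrableZl => //; exact: integrable_normal_pdf.
apply: le_integrable Kp => //.
  apply/measurable_EFinP; apply: measurable_funM; last exact: measurable_normal_pdf.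
  by apply: measurable_funD => //; apply: measurable_funX.
move=> z _ /=; rewrite lee_fin ger0_norm; last first.
  by rewrite mulr_ge0 ?normal_pdf_ge0// addr_ge0// sqr_ge0.
apply: le_trans (ler_norm _).
rewrite normal01E normal_pdfE// /normal_fun s2 subr0.
rewrite (_ : K * _ = normal_peak 1 * (4 * expR (- z ^+ 2 / (2 *+ 2)))); last first.
  by rewrite /K; field; rewrite gt_eqF.
rewrite mulrCA ler_wpM2l ?normal_peak_ge0//.
rewrite expRN ler_pdivrMr ?expR_gt0// -mulrA -expRD.
have -> : - z ^+ 2 / (2 *+ 2) + z ^+ 2 / 2 = z ^+ 2 / 4 by field.
have := expR_ge1Dx (z ^+ 2 / 4); have := sqr_ge0 z; lra.
Qed.

Lemma integrable_normal01 (K : R) (f : R -> R) : measurable_fun setT f ->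
  (forall z, `|f z| <= K * (1 + z ^+ 2)) ->
  mu.-integrable setT (EFin \o (fun z => f z * pdf z)).
Proof.
move=> mf fK.
have Kp := integrableZl measurableT K integrable_sqr_normal01.
apply: le_integrable Kp => //.
  by apply/measurable_EFinP; apply: measurable_funM => //; exact: measurable_normal_pdf.
move=> z _ /=; rewrite lee_fin (le_trans _ (ler_norm _))//.
by rewrite normrM mulrA (ger0_norm (normal_pdf_ge0 _ _ _)) ler_wpM2r ?normal_pdf_ge0.
Qed.

(** Stein's identity E[Z F(Z)] = E[F'(Z)] for a standard normal Z: the integrand is the derivative
    of -F times the density, whose own derivative is -x times itself. *)
Lemma Rintegral_normal01_parts (F f : R -> R) (C : R) :
  (forall x : R, is_derive x 1 F (f x)) -> continuous f ->
  (forall z, `|F z| <= C * (1 + `|z|)) -> (forall z, `|f z| <= C * (1 + z ^+ 2)) ->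
  \int[mu]_x ((x * F x - f x) * pdf x) = 0.
Proof.
move=> dF cf FC fC.
have C0 : 0 <= C by have := fC 0; rewrite expr0n/= addr0 mulr1; apply: le_trans.
have dE (x : R) : derivable F x 1 by apply: ex_derive.
have cF : continuous F.
  by move=> x; apply: differentiable_continuous; apply/derivable1_diffP; exact: dE.
have cxf : continuous (fun x : R => x * F x - f x).
  by move=> x; apply: cvgB; [apply: cvgM => //; exact: cF|exact: cf].
have bnd (z : R) : `|z| * (1 + `|z|) <= 2 * (1 + z ^+ 2).
  have -> : z ^+ 2 = `|z| ^+ 2 by rewrite real_normK ?num_real.
  have := sqr_ge0 (`|z| - 1); have := sqr_ge0 (`|z|); nra.
have xF z : `|z| * `|F z| <= 2 * C * (1 + z ^+ 2).
  apply: (@le_trans _ _ (`|z| * (C * (1 + `|z|)))); first by rewrite ler_wpM2l.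
  by rewrite mulrCA (mulrC 2) -mulrA ler_wpM2l.
apply: (@Rintegral_derivative_eq0 (fun x => - (F x * pdf x)) _ (4 * C * normal_peak 1)).
- move=> x.
  have ? := is_derive_normal01 x; have ? := dF x.
  by apply: is_derive_eq; rewrite /GRing.scale/=; ring.
- by move=> x; apply: cvgM; [exact: cxf|exact: continuous_normal01].
- apply: (@integrable_normal01 (3 * C)) => [|z].
    exact: continuous_measurable_fun.
  rewrite (le_trans (ler_normB _ _))// normrM.
  by have := xF z; have := fC z; lra.
- move=> x; rewrite normrN normrM (ger0_norm (normal_pdf_ge0 _ _ _)) mulrA.
  have := xF x => h.
  apply: (@le_trans _ _ (2 * C * (1 + x ^+ 2) * pdf x)).
    by rewrite ler_wpM2r ?normal_pdf_ge0.
  have := sqr_normal01_le x => h2.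
  rewrite -mulrA (_ : 4 * C * _ = 2 * C * (2 * normal_peak 1)); last by ring.
  by rewrite ler_wpM2l// mulr_ge0.
Qed.

Lemma Rintegral_normal01 : \int[mu]_x pdf x = 1.
Proof. by rewrite /Rintegral integral_normal_pdf. Qed.

Lemma Rintegral_id_normal01 : \int[mu]_x (x * pdf x) = 0.
Proof.
rewrite -[RHS](@Rintegral_normal01_parts (cst 1) (cst 0) 1).
- by apply: eq_Rintegral => x _ /=; rewrite mulr1 subr0.
- by move=> x; exact: cvg_cst.
- by move=> z; rewrite /= normr1 mul1r lerDl.
- by move=> z; rewrite /= normr0 mul1r addr_ge0// sqr_ge0.
Qed.

Lemma Rintegral_sqr_normal01 : \int[mu]_x (x ^+ 2 * pdf x) = 1.
Proof.
have : \int[mu]_x ((x * x - 1) * pdf x) = 0.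
  apply: (@Rintegral_normal01_parts id (cst 1) 1).
  - by move=> x; exact: cvg_cst.
  - by move=> z; rewrite /= mul1r lerDr.
  - by move=> z; rewrite /= normr1 mul1r lerDl sqr_ge0.
under eq_Rintegral do rewrite mulrBl -expr2 mul1r.
rewrite RintegralB//; last exact: integrable_normal_pdf.
  by move/eqP; rewrite Rintegral_normal01 subr_eq0 => /eqP.
apply: (@integrable_normal01 1); first exact: measurable_funX.
by move=> z; rewrite mul1r ger0_norm ?sqr_ge0// lerDr.
Qed.

End line.

(** * The cosine transform of the standard normal law *)

Section characteristic.
Context (R : realType).
Notation mu := (@lebesgue_measure R).
Notation pdf := (@normal_pdf R 0 1).
Implicit Types (xi theta : R).

Lemma measurable_cos_affine xi theta : measurable_fun setT (fun z => cos (xi * z + theta)).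
Proof.
apply: continuous_measurable_fun => z.
apply: (@continuous_comp _ _ _ (fun z => xi * z + theta) cos); last exact: continuous_cos.
by apply: cvgD; [apply: cvgM; [exact: cvg_cst|exact: cvg_id]|exact: cvg_cst].
Qed.

(** Differentiation under the integral gives -E[Z sin(xi Z + theta)], and Stein's identity for F(x)
    = sin(xi x + theta) turns this into -xi E[cos(xi Z + theta)]. The phase [theta] covers the real
    and the imaginary part of the characteristic function at once. *)
Lemma is_derive_normal01_cf theta xi :
  is_derive xi 1 (fun xi => \int[mu]_x (cos (xi * x + theta) * pdf x))
    (- xi * \int[mu]_x (cos (xi * x + theta) * pdf x)).
Proof.
pose f (xi x : R) := cos (xi * x + theta) * pdf x.
have df (x e : R) : is_derive e 1 (f^~ x) (- (x * sin (e * x + theta)) * pdf x).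
  rewrite /f; apply: is_derive_eq; rewrite /GRing.scale/=; ring.
have d1f e x : partial1of2 f e x = - (x * sin (e * x + theta)) * pdf x.
  by rewrite partial1of2E; have ? := df x e; rewrite derive_val.
have xi01 : `](xi - 1), (xi + 1)[%classic xi.
  by rewrite /= in_itv/=; apply/andP; split; lra.
have fi e : `](xi - 1), (xi + 1)[%classic e -> mu.-integrable setT (EFin \o f e).
  move=> _; apply: (@integrable_normal01 _ 1); first exact: measurable_cos_affine.
  by move=> z; rewrite mul1r (le_trans (cos_max _))// lerDl sqr_ge0.
have fd e x : `](xi - 1), (xi + 1)[%classic e -> setT x -> derivable (f^~ x) e 1.
  by move=> _ _; have ? := df x e; exact: ex_derive.
have G0 (y : R) : 0 <= (1 + y ^+ 2) * pdf y.
  by rewrite mulr_ge0 ?normal_pdf_ge0// addr_ge0// sqr_ge0.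
have Gb e x : `](xi - 1), (xi + 1)[%classic e -> setT x ->
    `|partial1of2 f e x| <= (1 + x ^+ 2) * pdf x.
  move=> _ _; rewrite d1f normrM (ger0_norm (normal_pdf_ge0 _ _ _)).
  rewrite ler_wpM2r ?normal_pdf_ge0// normrN normrM.
  have := sin_max (e * x + theta); have := normr_ge0 x.
  have : x ^+ 2 = `|x| ^+ 2 by rewrite real_normK ?num_real.
  move=> -> h1 h2; apply: (@le_trans _ _ `|x|); first by rewrite ler_piMr.
  by have := sqr_ge0 (`|x| - 2^-1); nra.
have D := derivable_under_integral measurableT xi01 fi fd G0
  (integrable_sqr_normal01 R) Gb.
have E := differentiation_under_integral measurableT xi01 fi fd G0
  (integrable_sqr_normal01 R) Gb.
apply: DeriveDef => //; rewrite -derive1E E.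
have : \int[mu]_x ((x * sin (xi * x + theta) - xi * cos (xi * x + theta)) * pdf x) = 0.
  apply: (@Rintegral_normal01_parts _ (fun x => sin (xi * x + theta)) _ (1 + `|xi|)).
  - by move=> x; apply: is_derive_eq; rewrite /GRing.scale/=; ring.
  - move=> z; apply: cvgM; first exact: cvg_cst.
    apply: (@continuous_comp _ _ _ (fun z => xi * z + theta) cos); last exact: continuous_cos.
    by apply: cvgD; [apply: cvgM; [exact: cvg_cst|exact: cvg_id]|exact: cvg_cst].
  - move=> z; apply: (le_trans (sin_max _)).
    by have := normr_ge0 z; have := normr_ge0 xi; nra.
  - move=> z; rewrite normrM.
    apply: (@le_trans _ _ `|xi|); first by rewrite ler_piMr// cos_max.
    by have := normr_ge0 xi; have := sqr_ge0 z; nra.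
have i1 : mu.-integrable setT (EFin \o (fun x => x * sin (xi * x + theta) * pdf x)).
  apply: (@integrable_normal01 _ 1).
    apply: measurable_funM => //.
    apply: continuous_measurable_fun => z.
    apply: (@continuous_comp _ _ _ (fun z => xi * z + theta) sin); last exact: continuous_sin.
    by apply: cvgD; [apply: cvgM; [exact: cvg_cst|exact: cvg_id]|exact: cvg_cst].
  move=> x; rewrite mul1r normrM.
  have := sin_max (xi * x + theta); have := normr_ge0 x.
  have : x ^+ 2 = `|x| ^+ 2 by rewrite real_normK ?num_real.
  move=> -> h1 h2; apply: (@le_trans _ _ `|x|); first by rewrite ler_piMr.
  by have := sqr_ge0 (`|x| - 2^-1); nra.
have i2 : mu.-integrable setT (EFin \o f xi) by exact: fi.
rewrite (@eq_Rintegral _ _ _ mu setT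
  (fun x : R => x * sin (xi * x + theta) * pdf x - xi * f xi x)); last first.
  by move=> x _; rewrite /f; ring.
have i3 : mu.-integrable setT (EFin \o (fun x : R => xi * f xi x)).
  exact: (integrableZl measurableT xi i2).
rewrite RintegralB// RintegralZl// => /eqP; rewrite subr_eq0 => /eqP e.
rewrite mulNr -e -mulN1r -RintegralZl//; apply: eq_Rintegral => x _.
by rewrite d1f; ring.
Qed.

(** The linear differential equation of the preceding lemma is solved by the integrating factor
    exp(xi^2/2); the value at 0 is cos theta. *)
Lemma normal01_cf theta xi :
  \int[mu]_x (cos (xi * x + theta) * pdf x) = cos theta * expR (- (xi ^+ 2 / 2)).
Proof.
pose h xi := \int[mu]_x (cos (xi * x + theta) * pdf x).
have dh (e : R) : is_derive e 1 h (- e * h e) by exact: is_derive_normal01_cf.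
have dk (e : R) : is_derive e 1 (fun e => h e * expR (e ^+ 2 / 2)) 0.
  by apply: is_derive_eq; rewrite /GRing.scale/=; field.
have := is_derive_0_is_cst xi 0 dk.
rewrite expr0n/= mul0r expR0 mulr1 /h.
under [in RHS]eq_Rintegral do rewrite mul0r add0r.
rewrite RintegralZl//; last exact: integrable_normal_pdf.
rewrite Rintegral_normal01 mulr1 expRN => <-.
by rewrite mulfK// gt_eqF// expR_gt0.
Qed.

End characteristic.

Section normal_affine.
Context (R : realType).
Notation mu := (@lebesgue_measure R).
Notation pdf := (@normal_pdf R 0 1).

Lemma normal_pdf_affine (m s z : R) : s != 0 ->
  `|s| * normal_pdf m s (m + `|s| * z) = pdf z.
Proof.
move=> s0; rewrite !normal_pdfE ?oner_eq0// mulrA /normal_fun; congr (_ * expR _).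
  rewrite /normal_peak expr1n mul1r -mulrnAr sqrtrM ?sqr_ge0// sqrtr_sqr.
  by rewrite invfM mulrA divff ?mul1r// normr_eq0.
rewrite subr0 (addrC m) addrK expr1n exprMn real_normK ?num_real//.
by field.
Qed.

Lemma ge0_integral_normal_pdf (m s : R) (h : R -> \bar R) : s != 0 ->
  (forall x, 0 <= h x)%E -> measurable_fun setT h ->
  (\int[mu]_x (h x * (normal_pdf m s x)%:E) =
   \int[mu]_z (h (m + `|s| * z)%R * (pdf z)%:E))%E.
Proof.
move=> s0 h0 mh.
have mh' : measurable_fun setT (h : measurableTypeR R -> \bar R) := mh.
have ns0 : 0 < `|s| by rewrite normr_gt0.
have mhs : measurable_fun setT (fun x => h x * (normal_pdf m s x)%:E)%E.
  apply: emeasurable_funM => //; apply/measurable_EFinP.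
  exact: measurable_normal_pdf.
rewrite [LHS](ge0_integral_affine m ns0)//; last first.
  by move=> x; rewrite mule_ge0// lee_fin normal_pdf_ge0.
rewrite -ge0_integralZl//; last 2 first.
- apply: emeasurable_funM.
    apply: measurableT_comp => //.
    by apply: measurable_funD => //; exact: measurable_funM.
  apply/measurable_EFinP.
  apply: measurableT_comp; first exact: measurable_normal_pdf.
  by apply: measurable_funD => //; exact: measurable_funM.
- by move=> x _; rewrite mule_ge0// lee_fin normal_pdf_ge0.
apply: eq_integral => z _; rewrite muleCA -EFinM; congr (_ * _%:E)%E.
exact: normal_pdf_affine.
Qed.

End normal_affine.

(** * Gaussian variables as affine images of a standard normal one *)

Section law.
Context d (T : measurableType d) (R : realType) (P : probability T R).
Notation mu := (@lebesgue_measure R).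
Notation pdf := (@normal_pdf R 0 1).

(** Tested on nonnegative functions, X has the law of m + s Z with Z standard normal. The value s =
    0 gives the Dirac mass, so the two cases of [gaussian_rv] need no separation afterwards. *)
Lemma gaussian_rv_affine (X : T -> R) : measurable_fun setT X -> gaussian_rv P X ->
  exists m s : R, 0 <= s /\ forall h : R -> \bar R, (forall x, 0 <= h x)%E ->
    measurable_fun setT h ->
    (\int[P]_w h (X w) = \int[mu]_z (h (m + s * z)%R * (pdf z)%:E))%E.
Proof.
move=> mX [m [s XE]]; exists m, `|s|; split => // h h0 mh.
have mpdf : measurable_fun setT pdf by exact: measurable_normal_pdf.
have mX' : measurable_fun setT (X : T -> measurableTypeR R) := mX.
have mh' : measurable_fun setT (h : measurableTypeR R -> \bar R) := mh.
rewrite -[LHS](@ge0_integral_pushforward _ _ _ (measurableTypeR R) _ X mX' P setT h)//.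
have [s0|s0] := eqVneq s 0.
  transitivity (\int[\d_(m : measurableTypeR R)]_y h y)%E.
    by apply: eq_measure_integral => A mA _; rewrite [LHS](XE A mA) s0 eqxx.
  rewrite integral_dirac// diracT mul1e s0 normr0.
  under [RHS]eq_integral do rewrite mul0r addr0.
  rewrite ge0_integralZl//; last 2 first.
    exact/measurable_EFinP.
    by move=> z _; rewrite lee_fin normal_pdf_ge0.
  by rewrite integral_normal_pdf mule1.
transitivity (\int[normal_prob m s]_y h y)%E.
  by apply: eq_measure_integral => A mA _; rewrite [LHS](XE A mA) (negbTE s0).
rewrite (@ge0_integral_density _ _ _ mu (normal_prob m s) _ (measurable_normal_pdf _ _)
  (normal_pdf_ge0 _ _) (fun A _ => erefl) h h0 mh').
by rewrite (ge0_integral_normal_pdf m s0 h0 mh).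
Qed.

Lemma gaussian_rv_Rintegral (X : T -> R) : measurable_fun setT X -> gaussian_rv P X ->
  exists m s : R, forall f : R -> R, measurable_fun setT f ->
    \int[P]_w f (X w) = \int[mu]_z (f (m + s * z) * pdf z) /\
    (mu.-integrable setT (EFin \o (fun z => f (m + s * z) * pdf z)) ->
     P.-integrable setT (EFin \o (f \o X))).
Proof.
move=> mX gX; have [m [s [s0 XE]]] := gaussian_rv_affine mX gX.
exists m, s => f mf.
have mfE : measurable_fun setT (EFin \o f) by exact/measurable_EFinP.
split.
  rewrite /Rintegral; congr fine; rewrite integralE [RHS]integralE.
  congr (_ - _)%E.
  - rewrite (_ : (fun w => _)^\+%E = (EFin \o f)^\+%E \o X); last first.
      by rewrite -funepos_comp.
    rewrite [LHS](XE (EFin \o f)^\+%E)//; last exact: measurable_funepos.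
    apply: eq_integral => z _; rewrite !funeposE /= -!EFin_max -EFinM.
    by rewrite maxr_pMl ?mul0r//; exact: normal_pdf_ge0.
  - rewrite (_ : (fun w => _)^\-%E = (EFin \o f)^\-%E \o X); last first.
      by rewrite -funeneg_comp.
    rewrite [LHS](XE (EFin \o f)^\-%E)//; last exact: measurable_funeneg.
    apply: eq_integral => z _; rewrite !funenegE /= -!EFin_max -EFinM.
    by rewrite maxr_pMl ?mul0r ?mulNr//; exact: normal_pdf_ge0.
move=> /integrableP[_ fi]; apply/integrableP; split.
  by apply/measurable_EFinP; exact: measurableT_comp.
rewrite (XE (abse \o (EFin \o f)))//; last exact: measurableT_comp.
apply: le_lt_trans fi; apply: ge0_le_integral => //.
- by move=> x _; apply: mule_ge0; rewrite lee_fin ?normal_pdf_ge0.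
- apply: emeasurable_funM; last by apply/measurable_EFinP; exact: measurable_normal_pdf.
  apply: measurableT_comp => //; apply: measurableT_comp => //.
  by apply: measurable_funD => //; exact: measurable_funM.
- apply: measurableT_comp => //; apply/measurable_EFinP; apply: measurable_funM.
    apply: measurableT_comp => //.
    by apply: measurable_funD => //; exact: measurable_funM.
  exact: measurable_normal_pdf.
- by move=> x _ /=; rewrite normrM (ger0_norm (normal_pdf_ge0 _ _ _)).
- by move=> x; exact: abse_ge0.
Qed.

Lemma gaussian_rv_integrable_sqr (X : T -> R) : measurable_fun setT X -> gaussian_rv P X ->
  P.-integrable setT (EFin \o (fun w => X w ^+ 2)).
Proof.
move=> mX gX; have [m [s XE]] := gaussian_rv_Rintegral mX gX.
have mX2 : measurable_fun setT (fun x : R => x ^+ 2) by exact: measurable_funX.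
apply: (XE _ mX2).2.
apply: (@integrable_normal01 _ (2 * m ^+ 2 + 2 * s ^+ 2)).
  apply: measurable_funX; apply: measurable_funD => //; exact: measurable_funM.
move=> z; rewrite ger0_norm ?sqr_ge0//.
have := sqr_ge0 (m - s * z); have := sqr_ge0 (m * z); have := sqr_ge0 s; nra.
Qed.

(** In the form m + s Z the mean is m; once m = 0 the second moment is s^2, and [normal01_cf]
    applies at the frequency xi s. *)
Lemma gaussian_rv_cf (X : T -> R) (xi theta : R) :
  measurable_fun setT X -> gaussian_rv P X -> \int[P]_w X w = 0 ->
  \int[P]_w cos (xi * X w + theta) =
  cos theta * expR (- (xi ^+ 2 * \int[P]_w (X w ^+ 2) / 2)).
Proof.
move=> mX gX EX0; have [m [s XE]] := gaussian_rv_Rintegral mX gX.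
have iz : mu.-integrable setT (EFin \o (fun z => z * pdf z)).
  apply: (@integrable_normal01 _ 1) => // z.
  have -> : z ^+ 2 = `|z| ^+ 2 by rewrite real_normK ?num_real.
  have := sqr_ge0 (`|z| - 2^-1); nra.
have iz2 : mu.-integrable setT (EFin \o (fun z => z ^+ 2 * pdf z)).
  apply: (@integrable_normal01 _ 1) => [|z]; first exact: measurable_funX.
  by rewrite mul1r ger0_norm ?sqr_ge0// lerDr.
have i1 : mu.-integrable setT (EFin \o pdf) by exact: integrable_normal_pdf.
have iZ (k : R) g : mu.-integrable setT (EFin \o g) ->
    mu.-integrable setT (EFin \o (fun z => k * g z)).
  by move=> gi; exact: (integrableZl measurableT k gi).
have m0 : m = 0.
  move: EX0; have [-> _] := XE id (@measurable_id _ _ _).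
  rewrite (@eq_Rintegral _ _ _ mu setT (fun z : R => m * pdf z + s * (z * pdf z))); last first.
    by move=> z _; ring.
  rewrite RintegralD//; [|exact: iZ..].
  rewrite !RintegralZl// Rintegral_normal01 Rintegral_id_normal01.
  by rewrite mulr0 addr0 mulr1.
have mX2 : measurable_fun setT (fun x : R => x ^+ 2) by exact: measurable_funX.
have -> : \int[P]_w (X w ^+ 2) = s ^+ 2.
  have [-> _] := XE _ mX2.
  rewrite (@eq_Rintegral _ _ _ mu setT (fun z : R => s ^+ 2 * (z ^+ 2 * pdf z))); last first.
    by move=> z _; rewrite m0; ring.
  by rewrite RintegralZl// Rintegral_sqr_normal01 mulr1.
have [-> _] := XE _ (measurable_cos_affine xi theta).
rewrite (@eq_Rintegral _ _ _ mu setT (fun z : R => cos ((xi * s) * z + theta) * pdf z)); last first.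
  by move=> z _; rewrite m0 add0r mulrA.
by rewrite normal01_cf exprMn.
Qed.

End law.

(** * Fourier uniqueness *)

Section bounded.
Context d (T : measurableType d) (R : realType).

Lemma bounded_integrable (mu : {measure set T -> \bar R}) (M : R) (f : T -> R) :
  (mu setT < +oo)%E -> measurable_fun setT f ->
  (forall x, `|f x| <= M) -> mu.-integrable setT (EFin \o f).
Proof.
move=> muT mf fM; apply: measurable_bounded_integrable => //.
exists M; split; first exact: num_real.
by move=> x Mx y _; exact: le_trans (fM y) (ltW Mx).
Qed.

Lemma bounded_integrable_prob (P : probability T R) (M : R) (f : T -> R) :
  measurable_fun setT f ->
  (forall x, `|f x| <= M) -> P.-integrable setT (EFin \o f).
Proof.
apply: bounded_integrable.
exact: le_lt_trans (probability_le1 P measurableT) (ltry _).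
Qed.

End bounded.

Section dominated.
Context d (T : measurableType d) (R : realType) (mu : {measure set T -> \bar R}).

Lemma dominated_cvg_Rintegral (f_ : nat -> T -> R) (f g : T -> R) :
  (forall n, measurable_fun setT (f_ n)) -> mu.-integrable setT (EFin \o g) ->
  (forall n x, `|f_ n x| <= g x) -> (forall x, f_ n x @[n --> \oo] --> f x) ->
  \int[mu]_x f_ n x @[n --> \oo] --> \int[mu]_x f x.
Proof.
move=> mf_ gi fg ff.
have mf : measurable_fun setT f.
  by apply: (measurable_fun_cvg mf_) => x _; exact: ff.
have [] // := @dominated_convergence _ _ _ mu setT measurableT
    (fun n x => (f_ n x)%:E) (fun x => (f x)%:E) (fun x => (g x)%:E).
- by move=> n; exact/measurable_EFinP.
- exact/measurable_EFinP.
- by apply: aeW => x _; apply: cvg_EFin; [exact: nearW|exact: ff].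
- by apply: aeW => x n _; rewrite lee_fin.
move=> fi _ h; apply: fine_cvg; rewrite /Rintegral fineK//.
exact: integrable_fin_num.
Qed.

End dominated.

Section swap.
Lemma ae_eq_integrable d (T : measurableType d) (R : realType)
    (mu : {measure set T -> \bar R}) (f g : T -> \bar R) :
  measurable_fun setT g -> ae_eq mu setT f g ->
  mu.-integrable setT f -> mu.-integrable setT g.
Proof.
move=> mg fg /integrableP[mf fi]; apply/integrableP; split => //.
rewrite [ltLHS](@ae_eq_integral _ _ _ mu setT (abse \o f) (abse \o g))//.
- exact: measurableT_comp.
- exact: measurableT_comp.
- by apply: filterS fg => x fgx xT; rewrite /= (fgx xT).
Qed.

Context d1 d2 (T1 : measurableType d1) (T2 : measurableType d2) (R : realType).
Variable m1 : {sigma_finite_measure set T1 -> \bar R}.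
Variable m2 : {sigma_finite_measure set T2 -> \bar R}.

(** The inner real-valued integral is the [fine] part of the extended one; the two can differ only
    where a section is not integrable, which is a null set. *)
Lemma Rintegral12 (f : T1 * T2 -> R) :
  (m1 \x m2)%E.-integrable setT (EFin \o f) ->
  m1.-integrable setT (EFin \o (fun x => \int[m2]_y f (x, y))) /\
  \int[m1]_x \int[m2]_y f (x, y) = \int[(m1 \x m2)%E]_z f z.
Proof.
move=> fi.
have mF := measurable_fubini_F fi.
have ae : ae_eq m1 setT (fubini_F m2 (EFin \o f))
    (EFin \o (fun x => \int[m2]_y f (x, y))).
  apply: filterS (ae_integrable1 fi) => x fx _.
  by rewrite /= /Rintegral fineK//; exact: integrable_fin_num.
have mG : measurable_fun setT (EFin \o (fun x => \int[m2]_y f (x, y))).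
  by apply/measurable_EFinP; exact: (measurableT_comp _ mF).
split; first exact: (ae_eq_integrable mG ae (integrable_fubini_F fi)).
rewrite /Rintegral; congr fine.
rewrite -(integral12_prod_meas1 fi); apply/esym.
exact: (@ae_eq_integral _ _ _ m1 setT _ _ measurableT mF mG ae).
Qed.

Lemma Rintegral21 (f : T1 * T2 -> R) :
  (m1 \x m2)%E.-integrable setT (EFin \o f) ->
  \int[m2]_y \int[m1]_x f (x, y) = \int[(m1 \x m2)%E]_z f z.
Proof.
move=> fi.
have mF := measurable_fubini_G fi.
have ae : ae_eq m2 setT (fubini_G m1 (EFin \o f))
    (EFin \o (fun y => \int[m1]_x f (x, y))).
  apply: filterS (ae_integrable2 fi) => x fx _.
  by rewrite /= /Rintegral fineK//; exact: integrable_fin_num.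
have mG : measurable_fun setT (EFin \o (fun y => \int[m1]_x f (x, y))).
  by apply/measurable_EFinP; exact: (measurableT_comp _ mF).
rewrite /Rintegral; congr fine.
rewrite -(integral21_prod_meas1 fi); apply/esym.
exact: (@ae_eq_integral _ _ _ m2 setT _ _ measurableT mF mG ae).
Qed.

Lemma ge0_measurable_Rintegral12 (f : T1 * T2 -> R) : measurable_fun setT f ->
  (forall z, 0 <= f z) -> measurable_fun setT (fun x => \int[m2]_y f (x, y)).
Proof.
move=> mf f0; apply: measurableT_comp => //.
apply: (@measurable_fun_fubini_tonelli_F _ _ _ _ _ m2 (EFin \o f)).
  exact/measurable_EFinP.
by move=> z; rewrite /= lee_fin.
Qed.

Lemma integrable_prod_dominated (f : T1 * T2 -> R) (a : T1 -> R) (b : T2 -> R) :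
  measurable_fun setT f -> (forall x, 0 <= a x) -> (forall y, 0 <= b y) ->
  m1.-integrable setT (EFin \o a) -> m2.-integrable setT (EFin \o b) ->
  (forall x y, `|f (x, y)| <= a x * b y) ->
  (m1 \x m2)%E.-integrable setT (EFin \o f).
Proof.
move=> mf a0 b0 ai bi fab.
have mfE : measurable_fun setT (EFin \o f) by exact/measurable_EFinP.
have ma := measurable_int _ ai; have mb := measurable_int _ bi.
apply/integrable12ltyP => //.
apply: (@le_lt_trans _ _ (\int[m1]_x ((a x)%:E * \int[m2]_y (b y)%:E))%E).
  apply: ge0_le_integral => //.
  - by move=> x _; exact: integral_ge0.
  - apply: (@measurable_fun_fubini_tonelli_F _ _ _ _ _ m2 (abse \o (EFin \o f))) => //.
    exact: measurableT_comp.
  - by move=> z; exact: abse_ge0.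
  - by apply: emeasurable_funM.
  move=> x _; rewrite -ge0_integralZl//; first last.
  - by rewrite lee_fin.
  - by move=> y _; rewrite lee_fin.
  apply: ge0_le_integral => //.
  - by apply: measurableT_comp => //; exact: measurableT_comp.
  - by apply: emeasurable_funM => //; exact: measurable_cst.
  - by move=> y _; rewrite -EFinM lee_fin fab.
have b_ge0 : (0 <= \int[m2]_y (b y)%:E)%E.
  by apply: integral_ge0 => y _; rewrite lee_fin.
have a_ge0 x : setT x -> (0 <= (a x)%:E)%E by rewrite lee_fin.
rewrite ge0_integralZr//.
have ib : (\int[m2]_y (b y)%:E \is a fin_num)%E by exact: integrable_fin_num.
have ia : (\int[m1]_x (a x)%:E \is a fin_num)%E by exact: integrable_fin_num.
by rewrite -(fineK ib) -(fineK ia) -EFinM ltry.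
Qed.

Lemma Rintegral_swap (f : T1 * T2 -> R) :
  (m1 \x m2)%E.-integrable setT (EFin \o f) ->
  \int[m1]_x \int[m2]_y f (x, y) = \int[m2]_y \int[m1]_x f (x, y).
Proof. by move=> fi; rewrite (Rintegral12 fi).2 (Rintegral21 fi). Qed.

End swap.

(** * Gaussian smoothing of a law weighted by a bounded function *)

Section smoothed.
Context d (T : measurableType d) (R : realType) (P : probability T R).
Notation mu := (@lebesgue_measure R).
Notation pdf := (@normal_pdf R 0 1).
Variables (X Y : T -> R) (M : R).
Hypothesis mX : measurable_fun setT X.
Hypothesis mY : measurable_fun setT Y.
Hypothesis YM : forall w, `|Y w| <= M.

Let M0 : 0 <= M.
Proof. by apply: le_trans (YM point). Qed.

Lemma integrable_indic_bounded (A : set R) : measurable A ->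
  P.-integrable setT (EFin \o (fun w => Y w * \1_A (X w))).
Proof.
move=> mA; apply: (@bounded_integrable_prob _ _ _ _ M).
  by apply: measurable_funM => //; apply: measurableT_comp => //; exact: measurable_indic.
move=> w; rewrite normrM -[leRHS]mulr1 ler_pM//.
by rewrite indicE; case: (_ \in _); rewrite ?normr1 ?normr0.
Qed.

Lemma Rintegral_indicC (A : set R) : measurable A ->
  \int[P]_w (Y w * \1_(~` A) (X w)) = \int[P]_w Y w - \int[P]_w (Y w * \1_A (X w)).
Proof.
move=> mA; rewrite -RintegralB//; [|exact: (@bounded_integrable_prob _ _ _ _ M)
  |exact: integrable_indic_bounded].
apply: eq_Rintegral => w _; rewrite !indicE in_setC; case: (_ \in _) => /=; ring.
Qed.

Lemma Rintegral_indic_bigcup (F : nat -> set (measurableTypeR R)) :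
  (forall n, measurable (F n)) -> trivIset setT F ->
  (\int[P]_w (Y w * \1_(\bigcup_k F k) (X w)))%:E =
  (\sum_(n <oo) (\int[P]_w (Y w * \1_(F n) (X w)))%:E)%E.
Proof.
move=> mF tF.
have mX' : measurable_fun setT (X : T -> measurableTypeR R) := mX.
have mXF n : measurable (X @^-1` F n).
  by rewrite -[X in measurable X]setTI; exact: (mX' measurableT _ (mF n)).
have E (A : set R) : measurable A ->
    (\int[P]_(w in X @^-1` A) (Y w)%:E = (\int[P]_w (Y w * \1_A (X w)))%:E)%E.
  move=> mA; rewrite /Rintegral fineK; last first.
    exact: (integrable_fin_num measurableT (integrable_indic_bounded mA)).
  rewrite [LHS]integral_mkcond; apply: eq_integral => w _.
  rewrite /patch indicE (_ : (w \in X @^-1` A) = (X w \in A)); last first.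
    by apply/idP/idP => /set_mem h; exact/mem_set.
  by case: ifP; rewrite ?mulr1 ?mulr0.
rewrite -E; last by apply: bigcup_measurable => k _; exact: mF.
rewrite preimage_bigcup integral_bigcup//.
- by apply: eq_eseriesr => n _; rewrite E//; exact: mF.
- by move=> i j _ _ [w [Fi Fj]]; apply: tF => //; exists (X w).
- apply: (@integrableS _ _ _ _ setT) => //.
    by apply: bigcup_measurable => k _; exact: mXF.
  exact: (@bounded_integrable_prob _ _ _ _ M).
Qed.

(* The Gaussian bump in [X] is itself a normal average of cosines of [X], so it is
   determined by the cosine transform. *)
Lemma Rintegral_gauss_bump (k z : R) :
  \int[P]_w (Y w * expR (- ((k * (z - X w)) ^+ 2 / 2))) =
  \int[mu]_g (pdf g * \int[P]_w (Y w * cos (k * g * X w + - (k * z * g)))).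
Proof.
pose f (u : T * R) := Y u.1 * (cos (k * (X u.1 - z) * u.2 + 0) * pdf u.2).
have mX1 : measurable_fun setT (fun u : T * R => X u.1) by exact: measurableT_comp.
have mpdf : measurable_fun setT pdf by exact: measurable_normal_pdf.
have mcos : measurable_fun setT (@cos R).
  by apply: continuous_measurable_fun; exact: continuous_cos.
have mf : measurable_fun setT f.
  apply: measurable_funM; first exact: measurableT_comp.
  apply: measurable_funM; last exact: measurableT_comp.
  apply: (measurableT_comp mcos); apply: measurable_funD => //.
  apply: measurable_funM => //; apply: measurable_funM => //.
  exact: measurable_funB.
have fi : (P \x mu)%E.-integrable setT (EFin \o f).
  apply: (@integrable_prod_dominated _ _ _ _ _ P mu f (cst M) pdf) => //.
  - by move=> z'; exact: normal_pdf_ge0.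
  - by apply: (@bounded_integrable_prob _ _ _ _ M) => // x; rewrite /= ger0_norm.
  - exact: integrable_normal_pdf.
  move=> w g; rewrite /f /= !normrM (ger0_norm (normal_pdf_ge0 _ _ _)).
  apply: ler_pM => //; first by rewrite mulr_ge0 ?normal_pdf_ge0.
  by rewrite ler_piMl ?normal_pdf_ge0// cos_max.
rewrite (@eq_Rintegral _ _ _ P setT (fun w => \int[mu]_g f (w, g))); last first.
  move=> w _; rewrite /f /= RintegralZl//; last first.
    apply: (@integrable_normal01 _ 1); first exact: measurable_cos_affine.
    by move=> g; rewrite mul1r (le_trans (cos_max _))// lerDl sqr_ge0.
  rewrite normal01_cf cos0 mul1r; congr (_ * expR (- (_ / 2))).
  by ring.
rewrite (Rintegral_swap fi) /f /=.
apply: eq_Rintegral => g _.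
rewrite [LHS](@eq_Rintegral _ _ _ P setT (fun w =>
  pdf g * (Y w * cos ((k * g) * X w + (- (k * z * g)))))); last first.
  by move=> w _; rewrite (_ : k * (X w - z) * g + 0 = k * g * X w - k * z * g); ring.
rewrite RintegralZl//; apply: (@bounded_integrable_prob _ _ _ _ M).
  apply: measurable_funM => //; apply: (measurableT_comp mcos).
  by apply: measurable_funD => //; exact: measurable_funM.
by move=> w; rewrite normrM -[leRHS]mulr1 ler_pM// cos_max.
Qed.

(** The bump is 1 where X = z and shrinks to 0 elsewhere, so the limit sees only the atom at [z].
    Atoms are needed for the endpoint term of [cvg_gauss_cdf]. *)
Lemma cvg_gauss_bump (z : R) :
  \int[P]_w (Y w * expR (- ((n%:R * (z - X w)) ^+ 2 / 2))) @[n --> \oo] -->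
  \int[P]_w (Y w * \1_[set z] (X w)).
Proof.
have mz (n : nat) : measurable_fun setT
    (fun w => Y w * expR (- ((n%:R * (z - X w)) ^+ 2 / 2))).
  apply: measurable_funM => //; apply: measurableT_comp => //.
  apply: measurableT_comp => //; apply: measurable_funM => //.
  apply: measurable_funX; apply: measurable_funM => //.
  exact: measurable_funB.
apply: (@dominated_cvg_Rintegral _ _ _ P
  (fun n w => Y w * expR (- ((n%:R * (z - X w)) ^+ 2 / 2)))
  (fun w => Y w * \1_[set z] (X w)) (cst M) mz).
- by apply: (@bounded_integrable_prob _ _ _ _ M) => // x; rewrite /= ger0_norm.
- move=> n w; rewrite normrM -[leRHS]mulr1 ler_pM// ger0_norm ?expR_ge0//.
  by rewrite -expR0 ler_expR oppr_le0 divr_ge0// sqr_ge0.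
move=> w; apply: cvgM; first exact: cvg_cst.
rewrite indicE; have [<-|zX] := eqVneq z (X w).
  rewrite mem_set//= subrr.
  rewrite (_ : (fun n : nat => _) = cst 1); first exact: cvg_cst.
  by apply/funext => n; rewrite mulr0 expr0n/= mul0r oppr0 expR0.
rewrite memNset/=; last by move=> Xz; rewrite Xz eqxx in zX.
pose e := (z - X w) ^+ 2 / 2.
have e0 : 0 < e by rewrite divr_gt0// exprn_even_gt0//= subr_eq0.
apply: (@squeeze_cvgr _ _ _ _ (cst 0) (fun n : nat => e^-1 * n%:R^-1)).
- near=> n; rewrite expR_ge0/= expRN -invfM.
  have n1 : 1 <= n%:R :> R by rewrite ler1n; near: n; exists 1%N.
  rewrite lef_pV2 ?posrE ?expR_gt0//; last by rewrite mulr_gt0// (lt_le_trans ltr01).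
  have := expR_ge1Dx ((n%:R * (z - X w)) ^+ 2 / 2).
  have -> : (n%:R * (z - X w)) ^+ 2 / 2 = n%:R ^+ 2 * e by rewrite /e exprMn mulrA.
  apply: le_trans; apply: (@le_trans _ _ (n%:R ^+ 2 * e)); last by rewrite lerDr.
  have nn : n%:R <= n%:R ^+ 2 :> R by rewrite expr2 ler_peMl// (le_trans ler01).
  by rewrite (mulrC e) ler_wpM2r// ltW.
- exact: cvg_cst.
- rewrite -[X in _ --> X](mulr0 e^-1); apply: cvgM; first exact: cvg_cst.
  apply/gtr0_cvgV0; last exact: cvgr_idn.
  by near=> n; rewrite ltr0n; near: n; exists 1%N.
Unshelve. all: by end_near. Qed.

(** Adding normal noise of standard deviation [s] to X smooths its law. By Fubini the smoothed mass
    of a half-line is an average of Gaussian bumps, and these are determined by the cosine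
    transform. *)
Lemma Rintegral_gauss_cdf (b s : R) : 0 < s ->
  \int[P]_w (Y w * \int[mu]_z (\1_(`]-oo, b[) (X w + s * z) * pdf z)) =
  \int[mu]_z (\1_(`]-oo, b[) z * normal_peak s *
    \int[P]_w (Y w * expR (- ((s^-1 * (z - X w)) ^+ 2 / 2)))).
Proof.
move=> s0; have sn0 : s != 0 by rewrite gt_eqF.
pose f (u : T * R) := Y u.1 * (\1_(`]-oo, b[) u.2 * normal_pdf (X u.1) s u.2).
have mb : measurable_fun setT (\1_(`]-oo, b[) : R -> R) by exact: measurable_indic.
have mX1 : measurable_fun setT (fun u : T * R => X u.1) by exact: measurableT_comp.
have normE w z : normal_pdf (X w) s z =
    normal_peak s * expR (- ((s^-1 * (z - X w)) ^+ 2 / 2)).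
  by rewrite normal_pdfE// /normal_fun; congr (_ * expR _); field.
have mf : measurable_fun setT f.
  apply: measurable_funM; first exact: measurableT_comp.
  apply: measurable_funM; first exact: measurableT_comp.
  rewrite (_ : (fun x => _) = (fun u : T * R =>
      normal_peak s * expR (- ((s^-1 * (u.2 - X u.1)) ^+ 2 / 2)))); last first.
    by apply/funext => u; rewrite normE.
  apply: measurable_funM => //; apply: measurableT_comp => //.
  apply: measurableT_comp => //; apply: measurable_funM => //.
  apply: measurable_funX; apply: measurable_funM => //.
  exact: measurable_funB.
have fi : (P \x mu)%E.-integrable setT (EFin \o f).
  apply/integrable12ltyP; first exact/measurable_EFinP.
  apply: (@le_lt_trans _ _ (\int[P]_x M%:E)%E); last first.
    by rewrite integral_cst//= probability_setT mule1 ltry.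
  apply: ge0_le_integral => //.
  - by move=> x _; exact: integral_ge0.
  - apply: (@measurable_fun_fubini_tonelli_F _ _ _ _ _ mu (abse \o (EFin \o f))) => //.
      by apply: measurableT_comp => //; exact/measurable_EFinP.
    by move=> u; exact: abse_ge0.
  move=> w _; rewrite -[leRHS]mule1 -(integral_normal_pdf (X w) s).
  rewrite -ge0_integralZl//; first last.
  - by move=> z _; rewrite lee_fin normal_pdf_ge0.
  - by apply/measurable_EFinP; exact: measurable_normal_pdf.
  apply: ge0_le_integral => //.
  - apply: measurableT_comp => //; apply/measurable_EFinP.
    exact: (measurableT_comp mf).
  - by apply/measurable_EFinP; apply: measurable_funM => //; exact: measurable_normal_pdf.
  move=> z _; rewrite -EFinM lee_fin /f /= !normrM.
  rewrite (ger0_norm (normal_pdf_ge0 _ _ _)) ler_pM//.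
    by rewrite mulr_ge0 ?normal_pdf_ge0.
  by rewrite ler_piMl ?normal_pdf_ge0// indicE; case: (_ \in _); rewrite ?normr1 ?normr0.
have gE w : \int[mu]_z (\1_(`]-oo, b[) (X w + s * z) * pdf z) =
    \int[mu]_z (\1_(`]-oo, b[) z * normal_pdf (X w) s z).
  apply: (congr1 fine); apply/esym.
  under [LHS]eq_integral do rewrite EFinM.
  rewrite [LHS]ge0_integral_normal_pdf//; last exact/measurable_EFinP.
  by apply: eq_integral => z _; rewrite (gtr0_norm s0) EFinM.
have iw w : mu.-integrable setT
    (EFin \o (fun z : R => \1_(`]-oo, b[) z * normal_pdf (X w) s z)).
  apply: le_integrable (integrable_normal_pdf (X w) s) => //.
    apply/measurable_EFinP; apply: measurable_funM => //.
    exact: measurable_normal_pdf.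
  move=> z _ /=; rewrite lee_fin normrM ler_piMl// indicE.
  by case: (_ \in _); rewrite ?normr1 ?normr0.
transitivity (\int[P]_w \int[mu]_z f (w, z)).
  apply: eq_Rintegral => w _; rewrite gE.
  by rewrite -(RintegralZl (Y w) measurableT (iw w)).
rewrite (Rintegral_swap fi) /f /=.
apply: eq_Rintegral => z _.
rewrite [LHS](@eq_Rintegral _ _ _ P setT (fun w => (\1_(`]-oo, b[) z * normal_peak s) *
   (Y w * expR (- ((s^-1 * (z - X w)) ^+ 2 / 2))))); last first.
  by move=> w _; rewrite normE; ring.
rewrite RintegralZl//; apply: (@bounded_integrable_prob _ _ _ _ M).
  apply: measurable_funM => //; apply: measurableT_comp => //.
  apply: measurableT_comp => //; apply: measurable_funM => //.
  apply: measurable_funX; apply: measurable_funM => //.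
  exact: measurable_funB.
move=> w; rewrite normrM -[leRHS]mulr1 ler_pM// ger0_norm ?expR_ge0//.
by rewrite -expR0 ler_expR oppr_le0 divr_ge0// sqr_ge0.
Qed.

(** As the noise vanishes, the smoothed indicator converges to the indicator off [b], while at [b]
    it keeps the value P(Z < 0) for every n. This constant, 1/2, stays an unevaluated integral: it
    only has to be the same for two laws. *)
Lemma cvg_gauss_cdf (b : R) :
  \int[P]_w (Y w * \int[mu]_z (\1_(`]-oo, b[) (X w + n.+1%:R^-1 * z) * pdf z))
    @[n --> \oo] -->
  \int[P]_w (Y w * \1_(`]-oo, b[) (X w)) +
  \int[mu]_z (\1_(`]-oo, b[) (b + 1%:R^-1 * z) * pdf z) *
    \int[P]_w (Y w * \1_[set b] (X w)).
Proof.
pose F (n : nat) x := \int[mu]_z (\1_(`]-oo, b[) (x + n.+1%:R^-1 * z) * pdf z).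
have s0 (n : nat) : 0 < n.+1%:R^-1 :> R by rewrite invr_gt0.
have mb : measurable_fun setT (\1_(`]-oo, b[) : R -> R) by exact: measurable_indic.
have m1 (n : nat) (x : R) : measurable_fun setT
    (fun z : R => \1_(`]-oo, b[) (x + n.+1%:R^-1 * z) * pdf z).
  apply: measurable_funM; last exact: measurable_normal_pdf.
  apply: measurableT_comp => //.
  by apply: measurable_funD => //; exact: measurable_funM.
have le1 (n : nat) (x z : R) :
    `|\1_(`]-oo, b[) (x + n.+1%:R^-1 * z) * pdf z| <= pdf z.
  rewrite normrM (ger0_norm (normal_pdf_ge0 _ _ _)) ler_piMl ?normal_pdf_ge0//.
  by rewrite indicE; case: (_ \in _); rewrite ?normr1 ?normr0.
have ipdf : mu.-integrable setT (EFin \o pdf) by exact: integrable_normal_pdf.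
have i1 n x : mu.-integrable setT
    (EFin \o (fun z : R => \1_(`]-oo, b[) (x + n.+1%:R^-1 * z) * pdf z)).
  apply: le_integrable ipdf => //; first by apply/measurable_EFinP; exact: m1.
  by move=> z _ /=; rewrite lee_fin (le_trans (le1 _ _ _))// ler_norm.
have F1 n x : `|F n x| <= 1.
  apply: le_trans (le_normr_Rintegral measurableT (i1 n x)) _.
  rewrite -[leRHS](Rintegral_normal01 R).
  apply: le_Rintegral => //; first exact: (integrable_norm (i1 n x)).
have mF n : measurable_fun setT (F n).
  pose f (u : R * R) := \1_(`]-oo, b[) (u.1 + n.+1%:R^-1 * u.2) * pdf u.2.
  apply: (@ge0_measurable_Rintegral12 _ _ _ _ _ mu f); last first.
    by move=> u; rewrite /f mulr_ge0 ?normal_pdf_ge0.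
  apply: measurable_funM; last first.
    by apply: measurableT_comp => //; exact: measurable_normal_pdf.
  apply: measurableT_comp => //.
  by apply: measurable_funD => //; exact: measurable_funM.
pose c := F 0%N b.
have cF x : F n x @[n --> \oo] --> \1_(`]-oo, b[) x + c * \1_[set b] x.
  have [xb|bx|->] := ltgtP x b.
  - rewrite !indicE mem_set/= ?in_itv//= memNset/=; last first.
      by move=> xb'; rewrite xb' ltxx in xb.
    rewrite mulr0 addr0 -[X in _ --> X](Rintegral_normal01 R).
    apply: (@dominated_cvg_Rintegral _ _ _ mu
      (fun n z => \1_(`]-oo, b[) (x + n.+1%:R^-1 * z) * pdf z) pdf pdf) => // [n|z]; first exact: m1.
    rewrite -[X in _ --> X]mul1r; apply: cvgM; last exact: cvg_cst.
    apply: cvg_near_cst; near=> n; rewrite indicE mem_set//= in_itv/=.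
    rewrite -ltrBrDl mulrC ltr_pdivrMr// mulrC -ltr_pdivrMr ?subr_gt0//.
    rewrite (@le_lt_trans _ _ n%:R) ?ltr_nat//.
    by near: n; exact: nbhs_infty_ger.
  - rewrite !indicE memNset/=; last by rewrite in_itv/= ltNge (ltW bx).
    rewrite memNset/=; last by move=> xb'; rewrite xb' ltxx in bx.
    rewrite mulr0 addr0.
    rewrite -[X in _ --> X](mul0r (fine (mu setT))) -[X in _ --> X](@Rintegral_cst _ _ _ mu)//.
    apply: (@dominated_cvg_Rintegral _ _ _ mu
      (fun n z => \1_(`]-oo, b[) (x + n.+1%:R^-1 * z) * pdf z) (cst 0) pdf) => // [n|z]; first exact: m1.
    rewrite -[X in _ --> X](mul0r (pdf z)); apply: cvgM; last exact: cvg_cst.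
    apply: cvg_near_cst; near=> n; rewrite indicE memNset//= in_itv/=.
    apply/negP; rewrite -leNgt -lerBlDl -ler_pdivrMl// invrK.
    rewrite mulrC -ler_ndivrMl ?subr_lt0//.
    rewrite (@le_trans _ _ n%:R) ?ler_nat//.
    by near: n; exact: nbhs_infty_ger.
  - rewrite !indicE memNset/= ?in_itv/= ?ltxx// mem_set//= add0r mulr1.
    have -> : (fun n => F n b) = cst c; last exact: cvg_cst.
    apply/funext => n; rewrite /c /F; apply: eq_Rintegral => z _.
    congr (_ * _); rewrite !indicE !mem_setE/= !in_itv/= -!ltrBrDl subrr.
    by rewrite !pmulr_rlt0.
have iM : P.-integrable setT (EFin \o cst M).
  by apply: (@bounded_integrable_prob _ _ _ _ M) => // x; rewrite /= ger0_norm.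
have -> : \int[P]_w (Y w * \1_(`]-oo, b[) (X w)) + c * \int[P]_w (Y w * \1_[set b] (X w)) =
    \int[P]_w (Y w * (\1_(`]-oo, b[) (X w) + c * \1_[set b] (X w))).
  rewrite [RHS](@eq_Rintegral _ _ _ P setT (fun w => Y w * \1_(`]-oo, b[) (X w) +
    c * (Y w * \1_[set b] (X w)))); last by move=> w _; ring.
  rewrite RintegralD//; first 1 last.
  - exact: integrable_indic_bounded.
  - exact: (integrableZl measurableT c (integrable_indic_bounded (measurable_set1 b))).
  by rewrite RintegralZl//; exact: integrable_indic_bounded.
apply: (@dominated_cvg_Rintegral _ _ _ P (fun n w => Y w * F n (X w))
  (fun w => Y w * (\1_(`]-oo, b[) (X w) + c * \1_[set b] (X w))) (cst M)) => //.
- by move=> n; apply: measurable_funM => //; exact: measurableT_comp.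
- by move=> n w; rewrite normrM -[leRHS]mulr1 ler_pM.
- by move=> w; apply: cvgM; [exact: cvg_cst|exact: cF].
Unshelve. all: by end_near. Qed.

End smoothed.

Section uniqueness.
Context d1 d2 (T1 : measurableType d1) (T2 : measurableType d2) (R : realType).
Variables (P1 : probability T1 R) (P2 : probability T2 R).
Variables (X1 Y1 : T1 -> R) (X2 Y2 : T2 -> R) (M : R).
Hypothesis mX1 : measurable_fun setT X1.
Hypothesis mY1 : measurable_fun setT Y1.
Hypothesis Y1M : forall w, `|Y1 w| <= M.
Hypothesis mX2 : measurable_fun setT X2.
Hypothesis mY2 : measurable_fun setT Y2.
Hypothesis Y2M : forall w, `|Y2 w| <= M.
Hypothesis cfE : forall xi theta, \int[P1]_w (Y1 w * cos (xi * X1 w + theta)) =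
  \int[P2]_w (Y2 w * cos (xi * X2 w + theta)).

Lemma cf_bump_eq (k z : R) :
  \int[P1]_w (Y1 w * expR (- ((k * (z - X1 w)) ^+ 2 / 2))) =
  \int[P2]_w (Y2 w * expR (- ((k * (z - X2 w)) ^+ 2 / 2))).
Proof.
rewrite (Rintegral_gauss_bump P1 mX1 mY1 Y1M) (Rintegral_gauss_bump P2 mX2 mY2 Y2M).
by apply: eq_Rintegral => g _; rewrite cfE.
Qed.

Lemma cf_atom_eq (z : R) : \int[P1]_w (Y1 w * \1_[set z] (X1 w)) =
  \int[P2]_w (Y2 w * \1_[set z] (X2 w)).
Proof.
have := @cvg_gauss_bump _ _ _ P2 X2 Y2 M mX2 mY2 Y2M z.
under eq_fun do rewrite -cf_bump_eq.
by move=> /(cvg_unique _ (@cvg_gauss_bump _ _ _ P1 X1 Y1 M mX1 mY1 Y1M z)); apply.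
Qed.

(** The smoothed masses agree for every n, hence in the limit, and [cf_atom_eq] cancels the endpoint
    terms. *)
Lemma cf_halfline_eq (b : R) : \int[P1]_w (Y1 w * \1_(`]-oo, b[) (X1 w)) =
  \int[P2]_w (Y2 w * \1_(`]-oo, b[) (X2 w)).
Proof.
have := @cvg_gauss_cdf _ _ _ P2 X2 Y2 M mX2 mY2 Y2M b.
under eq_fun => n.
  rewrite (@Rintegral_gauss_cdf _ _ _ P2 X2 Y2 M mX2 mY2 Y2M) ?invr_gt0//.
  under eq_Rintegral do rewrite -cf_bump_eq.
  rewrite -(@Rintegral_gauss_cdf _ _ _ P1 X1 Y1 M mX1 mY1 Y1M) ?invr_gt0//.
  over.
move=> /(cvg_unique _ (@cvg_gauss_cdf _ _ _ P1 X1 Y1 M mX1 mY1 Y1M b)).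
by rewrite -cf_atom_eq => /(_ _)/addIr; apply.
Qed.

(** Open half-lines form a pi-system generating the Borel sets, and the sets of agreement form a
    Dynkin system. The weights are what makes the theorem usable for vectors: they carry the
    coordinates that are not being treated. *)
Lemma cf_unique (B : set R) : measurable B ->
  \int[P1]_w (Y1 w * \1_B (X1 w)) = \int[P2]_w (Y2 w * \1_B (X2 w)).
Proof.
have EY : \int[P1]_w Y1 w = \int[P2]_w Y2 w.
  have := cfE 0 0; under eq_Rintegral do rewrite mul0r add0r cos0 mulr1.
  by under [X in _ = X -> _]eq_Rintegral do rewrite mul0r add0r cos0 mulr1.
have mE : @measurable _ (measurableTypeR R) = <<s @RGenInftyO.G R >>.
  exact: RGenInftyO.measurableE.
move=> mB; have : <<s @RGenInftyO.G R >> B by rewrite -mE.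
apply: (@dynkin_induction _ (measurableTypeR R) _
  (fun B => \int[P1]_w (Y1 w * \1_B (X1 w)) = \int[P2]_w (Y2 w * \1_B (X2 w))) mE) => {B mB}.
- move=> _ _ [x ->] [y ->]; exists (Num.min x y).
  apply/seteqP; split => z /=; rewrite !in_itv/= lt_min.
    by move=> [-> ->].
  by move=> /andP[-> ->].
- under eq_Rintegral do rewrite indicT mulr1.
  by under [RHS]eq_Rintegral do rewrite indicT mulr1.
- by move=> _ [x ->]; exact: cf_halfline_eq.
- move=> S mS S0.
  rewrite (Rintegral_indicC P1 mX1 mY1 Y1M)// (Rintegral_indicC P2 mX2 mY2 Y2M)//.
  by rewrite EY S0.
move=> F mF tF F0.
have mFu : measurable (\bigcup_k F k : set (measurableTypeR R)).
  by apply: bigcup_measurable => k _; exact: mF.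
apply: EFin_inj.
rewrite (Rintegral_indic_bigcup P1 mX1 mY1 Y1M mF tF).
rewrite (Rintegral_indic_bigcup P2 mX2 mY2 Y2M mF tF).
by apply: eq_eseriesr => n _; rewrite [X in X%:E](F0 n).
Qed.

End uniqueness.

(** * Independence of a Gaussian residual *)

Section null_sets.
Context d (T : measurableType d) (R : realType) (P : probability T R).

(** As the total integral is 0, the sets over which [f] integrates to 0 form a Dynkin system.
    Ambient measurability belongs to the induction, which runs in the sigma-algebra generated by
    [C]. *)
Lemma integral_sigma_eq0 (C : set (set T)) (f : T -> R) (M : R) :
  setI_closed C -> C `<=` measurable -> measurable_fun setT f ->
  (forall w, `|f w| <= M) -> \int[P]_w f w = 0 ->
  (forall S, C S -> \int[P]_(w in S) f w = 0) ->
  forall S, <<s C >> S -> measurable S /\ \int[P]_(w in S) f w = 0.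
Proof.
move=> CI CM mf fM f0 fC.
have fi : P.-integrable setT (EFin \o f) by exact: bounded_integrable_prob fM.
have fiS S : measurable S -> P.-integrable S (EFin \o f).
  by move=> mS; apply: integrableS fi.
apply: (@dynkin_induction _ (g_sigma_algebraType C) _
  (fun S => measurable (S : set T) /\ \int[P]_(w in S) f w = 0)) => //.
- by move=> S CS; split; [exact: CM|exact: fC].
- move=> S _ [mS S0]; split; first exact: measurableC.
  have := f0; rewrite -(setUv S) Rintegral_setU ?S0 ?add0r//.
  + exact: measurableC.
  + by rewrite setUv.
  + by apply/disj_setPS => w [].
- move=> F _ tF FP.
  have mF n : measurable (F n : set T) by case: (FP n).
  split; first exact: bigcup_measurable.
  rewrite /Rintegral integral_bigcup//; last by apply: fiS; exact: bigcup_measurable.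
  rewrite eseries0// => n _ _.
  rewrite -[LHS]fineK; last by apply: integrable_fin_num => //; exact: fiS.
  by apply: (congr1 EFin); case: (FP n).
Qed.

Lemma Rintegral_mul_indic (f : T -> R) (S : set T) :
  \int[P]_(w in S) f w = \int[P]_w (\1_S w * f w).
Proof.
rewrite Rintegral_mkcond; apply: eq_Rintegral => w _.
by rewrite /patch indicE; case: ifP; rewrite ?mul1r ?mul0r.
Qed.

End null_sets.

Section independence.
Context d (T : measurableType d) (R : realType) (P : probability T R).
Notation mu := (@lebesgue_measure R).
Notation pdf := (@normal_pdf R 0 1).
Variables (m : nat) (U : nat -> T -> R) (G : T -> R) (s : R).
Hypothesis mU : forall k, measurable_fun setT (U k).
Hypothesis mG : measurable_fun setT G.
(** Independence of [G] from the past and normality of its law, in the form in which Wiener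
    integrals deliver them. *)
Hypothesis cf : forall (xi : nat -> R) (eta theta : R),
  \int[P]_w cos (\sum_(0 <= k < m) xi k * U k w + eta * G w + theta) =
  expR (- ((eta * s) ^+ 2 / 2)) *
  \int[P]_w cos (\sum_(0 <= k < m) xi k * U k w + theta).

Let mcos : measurable_fun setT (@cos R).
Proof. by apply: continuous_measurable_fun; exact: continuous_cos. Qed.

Let ind (B : nat -> set R) (j : nat) (w : T) : R := \prod_(0 <= k < j) \1_(B k) (U k w).

Let mind B j : (forall k, measurable (B k)) -> measurable_fun setT (ind B j).
Proof.
move=> mB; apply: measurable_prod => k _.
by apply: measurableT_comp => //; exact: measurable_indic.
Qed.

Let ind_le1 B j w : `|ind B j w| <= 1.
Proof.
rewrite /ind normr_prod; apply: prodr_ile1 => k _; rewrite normr_ge0/=.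
by rewrite indicE; case: (_ \in _); rewrite ?normr1 ?normr0.
Qed.

Let mlin (xi : nat -> R) i j : measurable_fun setT (fun w => \sum_(i <= k < j) xi k * U k w).
Proof. by apply: measurable_sum => k; exact: measurable_funM. Qed.

(* Fourier uniqueness trades one cosine factor for one indicator at a time. *)
Lemma indep_cf (B : nat -> set R) (j : nat) : (forall k, measurable (B k)) -> (j <= m)%N ->
  forall (xi : nat -> R) (eta theta : R),
  \int[P]_w (ind B j w * cos (\sum_(j <= k < m) xi k * U k w + eta * G w + theta)) =
  expR (- ((eta * s) ^+ 2 / 2)) *
  \int[P]_w (ind B j w * cos (\sum_(j <= k < m) xi k * U k w + theta)).
Proof.
move=> mB; elim: j => [_ xi eta theta|j IH jm xi eta theta].
  rewrite (@eq_Rintegral _ _ _ P setT (fun w =>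
    cos (\sum_(0 <= k < m) xi k * U k w + eta * G w + theta))); last first.
    by move=> w _; rewrite /ind big_geq// mul1r.
  rewrite cf; congr (_ * _); apply: eq_Rintegral => w _.
  by rewrite /ind big_geq// mul1r.
have {}IH := IH (ltnW jm).
pose e := expR (- ((eta * s) ^+ 2 / 2)).
pose S w := \sum_(j.+1 <= k < m) xi k * U k w.
have mS : measurable_fun setT S by exact: mlin.
(* The frequency of coordinate [j] is set free: it becomes the variable of the uniqueness
   theorem. *)
have IH' zeta phi :
    \int[P]_w (ind B j w * cos (zeta * U j w + S w + eta * G w + phi)) =
    e * \int[P]_w (ind B j w * cos (zeta * U j w + S w + phi)).
  have E w : \sum_(j <= k < m) (if k == j then zeta else xi k) * U k w =
      zeta * U j w + S w.
    rewrite big_ltn// eqxx; congr (_ + _); apply: eq_big_nat => k /andP[jk _].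
    by rewrite gtn_eqF.
  have := IH (fun k => if k == j then zeta else xi k) eta phi.
  under eq_Rintegral do rewrite E.
  by under [X in _ = _ * X -> _]eq_Rintegral do rewrite E.
(* The weight in [cf_unique] itself contains a cosine; the product formula brings the product of the
   two cosines back to the single cosines of [IH']. *)
have cosMM (a b : R) : cos a * cos b = 2^-1 * cos (b + a) + 2^-1 * cos ((- b) + a).
  by rewrite (addrC (- b)) cosB cosD; field.
have mcosf (f : T -> R) : measurable_fun setT f ->
    P.-integrable setT (EFin \o (fun w => ind B j w * cos (f w))).
  move=> mf; apply: (@bounded_integrable_prob _ _ _ _ 1).
    by apply: measurable_funM; [exact: mind|exact: measurableT_comp].
  by move=> w; rewrite normrM mulr_ile1// cos_max.
have split2 (f : T -> R) (zeta phi : R) : measurable_fun setT f ->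
    \int[P]_w (ind B j w * cos (f w) * cos (zeta * U j w + phi)) =
    2^-1 * \int[P]_w (ind B j w * cos (zeta * U j w + phi + f w)) +
    2^-1 * \int[P]_w (ind B j w * cos (- (zeta * U j w + phi) + f w)).
  move=> mf.
  have mzU : measurable_fun setT (fun w => zeta * U j w + phi).
    by apply: measurable_funD => //; exact: measurable_funM.
  have i1 := mcosf _ (measurable_funD mzU mf).
  have i2 := mcosf _ (measurable_funD (measurableT_comp (@oppr_measurable R setT) mzU) mf).
  rewrite -(RintegralZl _ measurableT i1) -(RintegralZl _ measurableT i2).
  rewrite -RintegralD//; [|exact: (integrableZl measurableT _ i1)
    |exact: (integrableZl measurableT _ i2)].
  apply: eq_Rintegral => w _; rewrite -mulrA cosMM; ring.
have mA : measurable_fun setT (fun w => S w + eta * G w + theta).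
  apply: measurable_funD => //; apply: measurable_funD => //.
  exact: measurable_funM.
have mA0 : measurable_fun setT (fun w => S w + theta) by exact: measurable_funD.
have key := @cf_unique _ _ _ _ _ P P (U j)
  (fun w => ind B j w * cos (S w + eta * G w + theta)) (U j)
  (fun w => e * (ind B j w * cos (S w + theta))) 1.
have e01 : 0 <= e <= 1.
  by rewrite expR_ge0/= -[leRHS]expR0 ler_expR oppr_le0 divr_ge0// sqr_ge0.
transitivity (\int[P]_w (ind B j w * cos (S w + eta * G w + theta) * \1_(B j) (U j w))).
  apply: eq_Rintegral => w _; rewrite /ind big_nat_recr//= /S; ring.
transitivity (\int[P]_w (e * (ind B j w * cos (S w + theta)) * \1_(B j) (U j w))).
  apply: key => //.
  - by apply: measurable_funM; [exact: mind|exact: measurableT_comp].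
  - by move=> w; rewrite normrM mulr_ile1// cos_max.
  - apply: measurable_funM => //; apply: measurable_funM; [exact: mind|exact: measurableT_comp].
  - move=> w; case/andP: e01 => e0 e1; rewrite !normrM (ger0_norm e0).
    by rewrite !mulr_ile1 ?mulr_ge0 ?cos_max.
  - move=> zeta phi; rewrite split2//.
    transitivity (e * \int[P]_w (ind B j w * cos (S w + theta) * cos (zeta * U j w + phi))).
      rewrite split2// mulrDr !(mulrCA e).
      congr (2^-1 * _ + 2^-1 * _).
      + rewrite -[RHS](_ : e * \int[P]_w (ind B j w * cos (zeta * U j w + S w + (phi + theta))) = _).
          by rewrite -IH'; apply: eq_Rintegral => w _; congr (_ * cos _); ring.
        by congr (_ * _); apply: eq_Rintegral => w _; congr (_ * cos _); ring.
      + rewrite -[RHS](_ : e * \int[P]_w (ind B j w * cos (- zeta * U j w + S w + (- phi + theta))) = _).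
          by rewrite -IH'; apply: eq_Rintegral => w _; congr (_ * cos _); ring.
        by congr (_ * _); apply: eq_Rintegral => w _; congr (_ * cos _); ring.
    rewrite -RintegralZl//; first by apply: eq_Rintegral => w _; ring.
    apply: (@bounded_integrable_prob _ _ _ _ 1).
      apply: measurable_funM; first by apply: measurable_funM; [exact: mind|exact: measurableT_comp].
      apply: (measurableT_comp mcos); apply: measurable_funD => //.
      exact: measurable_funM.
    by move=> w; rewrite !normrM !mulr_ile1 ?mulr_ge0 ?cos_max// mulr_ile1// cos_max.
rewrite -RintegralZl//.
  apply: eq_Rintegral => w _; rewrite /ind big_nat_recr//= /S /e; ring.
apply: (@bounded_integrable_prob _ _ _ _ 1).
  by apply: measurable_funM; [exact: mind|exact: measurableT_comp].
by move=> w; rewrite normrM mulr_ile1// cos_max.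
Qed.

(** A pi-system generating the past, sigma(U_0, ..., U_(m-1)); the product form is that of the
    indicators in [indep_cf]. *)
Definition cylinders : set (set T) := [set A | exists B : nat -> set R,
  (forall k, measurable (B k)) /\ A = [set w | forall k, (k < m)%N -> B k (U k w)]].

Lemma cylinders_measurable : cylinders `<=` measurable.
Proof.
move=> _ [B [mB ->]].
rewrite (_ : [set w | _] = \bigcap_(k in [set k | (k < m)%N]) (U k @^-1` B k)); last first.
  by apply/seteqP; split => w /= h k; apply: h.
apply: fin_bigcap_measurable => [|k _]; last by rewrite -[X in measurable X]setTI; exact: mU.
exact: finite_II.
Qed.

Lemma indic_cylinder (B : nat -> set R) (w : T) :
  \1_[set w | forall k, (k < m)%N -> B k (U k w)] w = ind B m w.
Proof.
rewrite indicE /ind; have [h|] := boolP (w \in _).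
  rewrite big_nat big1// => k km; rewrite indicE mem_set//.
  by move/set_mem : h; apply.
move=> nh; have : ~ (forall k, (k < m)%N -> B k (U k w)).
  by move=> h; move/negP : nh; apply; exact/mem_set.
move=> /existsNP[k /not_implyP[km nB]].
rewrite big_mkord (bigD1 (Ordinal km))//= indicE memNset// mul0r//.
Qed.

(** On cylinders this is [indep_cf] at j = m, where no cosine of the past is left. Subtracting the
    mean from the cosine makes the claim a vanishing integral, which extends to the generated
    sigma-algebra. *)
Lemma Rintegral_sigma_cos (S : set T) (eta theta : R) : <<s cylinders >> S ->
  measurable S /\ \int[P]_w (\1_S w * cos (eta * G w + theta)) =
  expR (- ((eta * s) ^+ 2 / 2)) * cos theta * fine (P S).
Proof.
move=> CS; pose e := expR (- ((eta * s) ^+ 2 / 2)).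
pose f w := cos (eta * G w + theta) - e * cos theta.
have mf0 : measurable_fun setT (fun w => cos (eta * G w + theta)).
  by apply: (measurableT_comp mcos); apply: measurable_funD => //; exact: measurable_funM.
have mf : measurable_fun setT f by exact: measurable_funB.
have i1 (S' : set T) : measurable S' ->
    P.-integrable setT (EFin \o (fun w => \1_S' w * cos (eta * G w + theta))).
  move=> mS'; apply: (@bounded_integrable_prob _ _ _ _ 1).
    by apply: measurable_funM => //; exact: measurable_indic.
  by move=> w; rewrite normrM mulr_ile1 ?cos_max// indicE; case: (_ \in _); rewrite ?normr1 ?normr0.
have i2 (S' : set T) : measurable S' ->
    P.-integrable setT (EFin \o (fun w => \1_S' w * (e * cos theta))).
  move=> mS'; apply: (@bounded_integrable_prob _ _ _ _ `|e * cos theta|).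
    by apply: measurable_funM => //; exact: measurable_indic.
  by move=> w; rewrite normrM ler_piMl// indicE; case: (_ \in _); rewrite ?normr1 ?normr0.
have fE (S' : set T) : measurable S' -> \int[P]_(w in S') f w =
    \int[P]_w (\1_S' w * cos (eta * G w + theta)) - e * cos theta * fine (P S').
  move=> mS'; rewrite Rintegral_mul_indic.
  rewrite (@eq_Rintegral _ _ _ P setT (fun w => \1_S' w * cos (eta * G w + theta) -
    \1_S' w * (e * cos theta))); last by move=> w _; rewrite mulrBr.
  rewrite RintegralB//; [|exact: i1|exact: i2]; congr (_ - _).
  by rewrite -Rintegral_mul_indic Rintegral_cst.
have fC (S' : set T) : cylinders S' -> \int[P]_(w in S') f w = 0.
  move=> CS'; have mS' := cylinders_measurable CS'.
  rewrite fE//; case: CS' mS' => B [mB ->] mS'.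
  have := indep_cf mB (leqnn m) (cst 0) eta theta.
  under eq_Rintegral do rewrite big_geq// add0r.
  under [X in _ = _ * X -> _]eq_Rintegral do rewrite big_geq// add0r.
  under eq_Rintegral do rewrite -indic_cylinder.
  under [X in _ = _ * X -> _]eq_Rintegral do rewrite -indic_cylinder.
  move=> ->; rewrite -Rintegral_mul_indic Rintegral_cst// -/e; ring.
have fM w : `|f w| <= 1 + `|e * cos theta|.
  by rewrite (le_trans (ler_normB _ _))// lerD2r cos_max.
have CT : cylinders setT.
  by exists (fun=> setT); split => //; apply/seteqP; split.
have f0 : \int[P]_w f w = 0 by exact: fC.
have CI : setI_closed cylinders.
  move=> _ _ [A [mA ->]] [B [mB ->]]; exists (fun k => A k `&` B k); split.
    by move=> k; exact: measurableI.
  apply/seteqP; split => w /=.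
    by move=> [h1 h2] k km; split; [exact: h1|exact: h2].
  by move=> h; split => k km; case: (h k km).
have [mS S0] := integral_sigma_eq0 CI cylinders_measurable mf fM f0 fC CS.
by split => //; move/eqP: S0; rewrite fE// subr_eq0 => /eqP.
Qed.

(** For fixed [S] the uniqueness theorem is applied across two spaces: [G] with weight \1_S on
    Omega, and z |-> s z with the constant weight P(S) under the standard normal law. *)
Lemma sigma_indep_normal (S : set T) (A : set R) : <<s cylinders >> S -> measurable A ->
  P (S `&` G @^-1` A) = (P S * normal_prob 0 1 ((fun z => s * z)%R @^-1` A))%E.
Proof.
move=> CS mA; have [mS _] := Rintegral_sigma_cos 0 0 CS.
pose gam : probability (measurableTypeR R) R := normal_prob (0:R) 1.
have mGA : measurable (G @^-1` A) by rewrite -[X in measurable X]setTI; exact: mG.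
have msz : measurable_fun setT (fun z : R => s * z) by exact: measurable_funM.
have msA : measurable ((fun z : R => s * z) @^-1` A).
  by rewrite -[X in measurable X]setTI; exact: msz.
have PS : fine (P S) <= 1.
  by rewrite -lee_fin fineK ?fin_num_measure// probability_le1.
have key := @cf_unique _ _ _ _ R P gam G (\1_S) (fun z : R => s * z) (cst (fine (P S))) 1.
have {key} : \int[P]_w (\1_S w * \1_A (G w)) =
    \int[gam]_z (fine (P S) * \1_A (s * z)).
  apply: key => //.
  - by move=> w; rewrite indicE; case: (_ \in _); rewrite ?normr1 ?normr0.
  - by move=> z; rewrite /= ger0_norm// fine_ge0.
  move=> xi theta; have [_ ->] := Rintegral_sigma_cos xi theta CS.
  have mc : measurable_fun setT (fun z : R => fine (P S) * cos (xi * s * z + theta)).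
    by apply: measurable_funM => //; exact: measurable_cos_affine.
  transitivity (\int[gam]_z (fine (P S) * cos (xi * s * z + theta))); last first.
    by apply: eq_Rintegral => z _; rewrite mulrA.
  rewrite (@Rintegral_density _ _ _ mu gam (normal_pdf 0 1))//; last 2 first.
  - exact: measurable_normal_pdf.
  - by move=> z; exact: normal_pdf_ge0.
  rewrite (@eq_Rintegral _ _ _ mu setT (fun z : R =>
    fine (P S) * (cos (xi * s * z + theta) * pdf z))); last by move=> z _; rewrite mulrA.
  rewrite RintegralZl ?normal01_cf//; first ring.
  apply: (@integrable_normal01 _ 1); first exact: measurable_cos_affine.
  by move=> z; rewrite mul1r (le_trans (cos_max _))// lerDl sqr_ge0.
have indI (w : T) : \1_S w * \1_A (G w) = \1_(S `&` G @^-1` A) w :> R.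
  by rewrite indicI /= !indicE.
under eq_Rintegral do rewrite indI.
have -> : \int[gam]_z (fine (P S) * \1_A (s * z)) =
    fine (P S) * fine (gam ((fun z => s * z) @^-1` A)).
  rewrite RintegralZl//.
    by congr (_ * fine _); have := integral_indic gam measurableT msA; rewrite setIT => <-.
  apply: (@bounded_integrable_prob _ _ _ gam 1).
    by apply: measurableT_comp => //; exact: measurable_indic.
  by move=> z; rewrite indicE; case: (_ \in _); rewrite ?normr1 ?normr0.
rewrite /Rintegral integral_indic ?setIT//; last exact: measurableI.
move=> h; apply/eqP; rewrite -[X in X == _]fineK ?fin_num_measure//; last exact: measurableI.
by rewrite h EFinM !fineK ?fin_num_measure.
Qed.

End independence.

(** * Smoothness of Gaussian convolutions *)

Section gauss_poly.
Context (R : realType).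
Implicit Types (a y : R) (q : {poly R}).

(** This class is closed under differentiation, so one bound and one derivative formula serve all
    orders. *)
Definition gauss_poly a q y : R := q.[y] * expR (- (a * y ^+ 2)).

(** Each factor y of the Horner form is absorbed by half of the exponent, which leaves the parameter
    a/2 for the remaining polynomial; hence an induction over all positive [a]. *)
Lemma gauss_poly_bounded a q : 0 < a -> exists M, forall y, `|gauss_poly a q y| <= M.
Proof.
elim/poly_ind: q a => [|q c IH] a a0.
  by exists 0 => y; rewrite /gauss_poly horner0 mul0r normr0.
have b0 : 0 < a / 2 by rewrite divr_gt0.
have [M qM] := IH _ b0.
have M0 : 0 <= M by apply: le_trans (qM 0).
have y1 y : `|y| * expR (- (a / 2 * y ^+ 2)) <= 1 + (a / 2)^-1.
  rewrite expRN ler_pdivrMr ?expR_gt0//.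
  have := expR_ge1Dx (a / 2 * y ^+ 2) => e1.
  apply: (@le_trans _ _ ((1 + (a / 2)^-1) * (1 + a / 2 * y ^+ 2))); last first.
    by rewrite ler_wpM2l// addr_ge0// invr_ge0 ltW.
  rewrite mulrDl mul1r mulrDr mulr1 mulKf ?gt_eqF//.
  have -> : y ^+ 2 = `|y| ^+ 2 by rewrite real_normK ?num_real.
  have : 0 <= (a / 2)^-1 by rewrite invr_ge0 ltW.
  have : 0 <= a / 2 * `|y| ^+ 2 by rewrite mulr_ge0 ?sqr_ge0// ltW.
  have := sqr_ge0 (`|y| - 2^-1); nra.
exists (M * (1 + (a / 2)^-1) + `|c|) => y.
rewrite /gauss_poly hornerMXaddC mulrDl (le_trans (ler_normD _ _))//.
apply: lerD; last first.
  rewrite normrM (ger0_norm (expR_ge0 _)) ler_piMr// -[leRHS]expR0 ler_expR oppr_le0.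
  by rewrite mulr_ge0 ?sqr_ge0// ltW.
rewrite (_ : q.[y] * y * _ = gauss_poly (a / 2) q y * (y * expR (- (a / 2 * y ^+ 2)))); last first.
  rewrite /gauss_poly (_ : - (a * y ^+ 2) = - (a / 2 * y ^+ 2) + - (a / 2 * y ^+ 2)); last by field.
  by rewrite expRD; ring.
rewrite normrM ler_pM// normrM (ger0_norm (expR_ge0 _)); exact: y1.
Qed.

Definition gauss_poly_deriv a q : {poly R} := q^`() - (2 * a) *: ('X * q).

Lemma is_derive_gauss_poly a q y :
  is_derive y 1 (gauss_poly a q) (gauss_poly a (gauss_poly_deriv a q) y).
Proof.
rewrite /gauss_poly.
have ? : is_derive y 1 (horner q) (q^`()).[y] by exact: is_derive_poly.
apply: is_derive_eq; rewrite /GRing.scale/= /gauss_poly_deriv !hornerE/=; ring.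
Qed.

Lemma continuous_gauss_poly a q : continuous (gauss_poly a q).
Proof.
move=> y; apply: differentiable_continuous; apply/derivable1_diffP.
have ? := is_derive_gauss_poly a q y; exact: ex_derive.
Qed.

End gauss_poly.

Section smoothing.
Context d (T : measurableType d) (R : realType) (P : probability T R).
Variables (Z : T -> R) (a : R).
Hypothesis mZ : measurable_fun setT Z.
Hypothesis a0 : 0 < a.

Definition gauss_smoothing (q : {poly R}) (y : R) : R :=
  \int[P]_w gauss_poly a q (y - Z w).

(** The derivative of the integrand is bounded uniformly in [y] and [w], and under a probability a
    constant is an integrable majorant, whatever the moments of [Z]. *)
Lemma is_derive_gauss_smoothing q (y : R) : is_derive y 1 (gauss_smoothing q)
  (gauss_smoothing (gauss_poly_deriv a q) y).
Proof.
pose f (x : R) w := gauss_poly a q (x - Z w).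
have df (x : R) w : is_derive x 1 (f ^~ w) (gauss_poly a (gauss_poly_deriv a q) (x - Z w)).
  rewrite /f.
  have ? := is_derive_gauss_poly a q (x - Z w).
  have h : is_derive x 1 (fun x : R => x - Z w) 1 by apply: is_derive_eq; rewrite subr0.
  by have := is_derive1_comp (f := gauss_poly a q) (g := fun x : R => x - Z w);
    move/(_ _ _ _ _ _); rewrite mulr1.
have d1f x w : partial1of2 f x w = gauss_poly a (gauss_poly_deriv a q) (x - Z w).
  by rewrite partial1of2E; have ? := df x w; rewrite derive_val.
have [M qM] := gauss_poly_bounded q a0.
have [M' qM'] := gauss_poly_bounded (gauss_poly_deriv a q) a0.
have M'0 : 0 <= M' by apply: le_trans (qM' 0).
have Iy : `](y - 1), (y + 1)[%classic y.
  by rewrite /= in_itv/=; apply/andP; split; lra.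
have fi x : `](y - 1), (y + 1)[%classic x -> P.-integrable setT (EFin \o f x).
  move=> _; apply: (@bounded_integrable_prob _ _ _ _ M) => //.
    apply: measurableT_comp; last exact: measurable_funB.
    by apply: continuous_measurable_fun; exact: continuous_gauss_poly.
  by move=> w; exact: qM.
have fd x w : `](y - 1), (y + 1)[%classic x -> setT w -> derivable (f ^~ w) x 1.
  by move=> _ _; have ? := df x w; exact: ex_derive.
have G0 (w : T) : 0 <= cst M' w by [].
have iG : P.-integrable setT (EFin \o cst M').
  by apply: (@bounded_integrable_prob _ _ _ _ M') => // x; rewrite /= ger0_norm.
have Gb x w : `](y - 1), (y + 1)[%classic x -> setT w ->
    `|partial1of2 f x w| <= cst M' w.
  by move=> _ _; rewrite d1f qM'.
have D := derivable_under_integral measurableT Iy fi fd G0 iG Gb.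
have E := differentiation_under_integral measurableT Iy fi fd G0 iG Gb.
apply: DeriveDef => //; rewrite -derive1E E.
by apply: eq_Rintegral => w _; rewrite d1f.
Qed.

Lemma smooth_gauss_smoothing q : smooth (gauss_smoothing q).
Proof.
have dE k : derive1n k (gauss_smoothing q) =
    gauss_smoothing (iter k (gauss_poly_deriv a) q).
  elim: k => [//|k IH]; rewrite derive1nS IH; apply/funext => y; rewrite derive1E.
  have ? := is_derive_gauss_smoothing (iter k (gauss_poly_deriv a) q) y.
  by rewrite derive_val.
move=> k x; rewrite dE.
have ? := is_derive_gauss_smoothing (iter k (gauss_poly_deriv a) q) x.
exact: ex_derive.
Qed.

End smoothing.

(** * The law of a sum with an independent normal variable *)

Section law_add.
Context d (T : measurableType d) (R : realType) (P : probability T R).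
Notation mu := (@lebesgue_measure R).
Notation pdf := (@normal_pdf R 0 1).
Variables (Z G : T -> R) (s : R).
Hypothesis mZ : measurable_fun setT Z.
Hypothesis mG : measurable_fun setT G.
Hypothesis s0 : 0 < s.
Hypothesis ZG : forall A B : set R, measurable A -> measurable B ->
  P (Z @^-1` A `&` G @^-1` B) =
  (P (Z @^-1` A) * normal_prob 0 1 ((fun z => s * z)%R @^-1` B))%E.

Definition density_add (y : R) : R := \int[P]_w normal_pdf (Z w) s y.

Let sn0 : s != 0. Proof. by rewrite gt_eqF. Qed.

Lemma density_addE : density_add =
  gauss_smoothing P Z (2 * s ^+ 2)^-1 (normal_peak s)%:P.
Proof.
apply/funext => y; apply: eq_Rintegral => w _.
rewrite normal_pdfE// /gauss_poly hornerC /normal_fun; congr (_ * expR _).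
by field; rewrite sn0.
Qed.

Lemma smooth_density_add : smooth density_add.
Proof.
rewrite density_addE; apply: smooth_gauss_smoothing => //.
by rewrite invr_gt0 mulr_gt0// exprn_gt0.
Qed.

(** By [ZG] the law of (Z, G) is a product measure. Its sections give a normal law with mean Z and
    standard deviation [s], and Tonelli exchanges the average over Z with the integral over [A]. *)
Lemma law_add_normal (A : set R) : measurable A ->
  P ((fun w => Z w + G w) @^-1` A) = (\int[mu]_(y in A) (density_add y)%:E)%E.
Proof.
move=> mA.
pose gam : probability (measurableTypeR R) R := normal_prob (0:R) 1.
have mZ' : measurable_fun setT (Z : T -> measurableTypeR R) := mZ.
have mG' : measurable_fun setT (G : T -> measurableTypeR R) := mG.
have msz : measurable_fun setT ((fun z => s * z) : measurableTypeR R -> measurableTypeR R).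
  exact: measurable_funM.
have mZG : measurable_fun setT ((fun w => (Z w, G w)) : T -> measurableTypeR R * measurableTypeR R).
  exact: measurable_fun_pair.
pose Zm : {mfun T >-> measurableTypeR R} := @mfun_Sub _ _ T (measurableTypeR R) Z (mem_set mZ').
pose Sm : {mfun measurableTypeR R >-> measurableTypeR R} :=
  @mfun_Sub _ _ (measurableTypeR R) (measurableTypeR R) _ (mem_set msz).
pose ZGm : {mfun T >-> (measurableTypeR R * measurableTypeR R)%type} :=
  @mfun_Sub _ _ T (measurableTypeR R * measurableTypeR R)%type _ (mem_set mZG).
pose D : set (measurableTypeR R * measurableTypeR R) := (fun u => u.1 + u.2) @^-1` A.
have mD : measurable D.
  rewrite -[X in measurable X]setTI.
  have madd : measurable_fun setT
      ((fun u => u.1 + u.2) : measurableTypeR R * measurableTypeR R -> measurableTypeR R).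
    exact: measurable_funD.
  exact: madd.
have PU : (distribution P Zm \x distribution gam Sm)%E D =
    P ((fun w => Z w + G w) @^-1` A).
  apply: (@product_measure_unique _ _ _ _ R (distribution P Zm) (distribution gam Sm)
    (distribution P ZGm)) => // A' B mA' mB; exact: ZG.
rewrite -PU.
transitivity (\int[P]_w gam ((fun z => s * z)%R @^-1` xsection D (Z w)))%E.
  apply: (@ge0_integral_pushforward _ _ _ (measurableTypeR R) R Z mZ' P setT
    (fun x => gam ((fun z => s * z)%R @^-1` xsection D x))) => //.
  exact: (@measurable_fun_xsection _ _ _ _ _ (distribution gam Sm) D mD).
pose g (u : T * R) := normal_pdf (Z u.1) s u.2 * \1_A u.2.
have mg : measurable_fun setT g.
  apply: measurable_funM; last by apply: measurableT_comp => //; exact: measurable_indic.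
  rewrite (_ : (fun x => _) = (fun u : T * R =>
      normal_peak s * expR (- (u.2 - Z u.1) ^+ 2 / (s ^+ 2 *+ 2)))); last first.
    by apply/funext => u; rewrite normal_pdfE.
  apply: measurable_funM => //; apply: measurableT_comp => //.
  apply: measurable_funM => //; apply: measurableT_comp => //.
  apply: measurable_funX; apply: measurable_funB => //.
  exact: measurableT_comp.
transitivity (\int[P]_w \int[mu]_y (g (w, y))%:E)%E.
  apply: eq_integral => w _ /=.
  transitivity (gam ((fun z => Z w + s * z) @^-1` A)).
    rewrite /distribution /pushforward /=; congr (gam _).
    by apply/seteqP; split => z /=; rewrite /xsection /= inE.
  transitivity (\int[mu]_z ((\1_A (Z w + `|s| * z))%:E * (pdf z)%:E))%E.
    rewrite /gam /= /normal_prob integral_mkcond; apply: eq_integral => z _.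
    rewrite (gtr0_norm s0) /patch indicE.
    rewrite (_ : (z \in _) = (Z w + s * z \in A)); last first.
      by apply/idP/idP => /set_mem h; exact/mem_set.
    by case: ifP => _; rewrite ?mul1e ?mul0e.
  rewrite -(@ge0_integral_normal_pdf _ _ _ (fun x => (\1_A x)%:E))//.
    by apply: eq_integral => y _; rewrite /g /= EFinM muleC.
  by apply/measurable_EFinP; exact: measurable_indic.
rewrite (@fubini_tonelli _ _ _ _ _ P mu (EFin \o g)); last 2 first.
  exact/measurable_EFinP.
  by move=> u; rewrite /= lee_fin mulr_ge0// normal_pdf_ge0.
rewrite [RHS]integral_mkcond; apply: eq_integral => y _.
have iw : P.-integrable setT (EFin \o (fun w => normal_pdf (Z w) s y)).
  apply: (@bounded_integrable_prob _ _ _ _ (normal_peak s)).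
    rewrite (_ : (fun x => _) = (fun w =>
      normal_peak s * expR (- (y - Z w) ^+ 2 / (s ^+ 2 *+ 2)))); last first.
      by apply/funext => w; rewrite normal_pdfE.
    apply: measurable_funM => //; apply: measurableT_comp => //.
    apply: measurable_funM => //; apply: measurableT_comp => //.
    by apply: measurable_funX; apply: measurable_funB.
  by move=> w; rewrite ger0_norm ?normal_pdf_ge0// normal_pdf_ub.
rewrite /patch /g /= indicE; case: ifP => _.
  rewrite /density_add /Rintegral fineK; last exact: (integrable_fin_num measurableT iw).
  by apply: eq_integral => w _; rewrite mulr1.
by under eq_integral do rewrite mulr0; rewrite integral0.
Qed.

End law_add.

(** * The fractional kernel as an integral of products of windows *)

Section power_integrals.
Context (R : realType).
Notation mu := (@lebesgue_measure R).

Lemma cvg_powRN (c : R) : 0 < c -> x `^ (- c) @[x --> +oo] --> (0 : R).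
Proof.
move=> c0; apply/cvgrPdist_le => e e0; near=> x.
rewrite sub0r normrN ger0_norm ?powR_ge0// powRN.
have x0 : 0 < x by near: x; exact: nbhs_pinfty_gt.
rewrite -[leRHS]invrK lef_pV2 ?posrE ?powR_gt0 ?invr_gt0//.
have -> : e^-1 = (e^-1 `^ c^-1) `^ c.
  by rewrite -powRrM mulVf ?gt_eqF// powRr1// invr_ge0 ltW.
apply: ge0_ler_powR; rewrite ?nnegrE ?powR_ge0 ?(ltW c0) ?(ltW x0)//.
Unshelve. all: by end_near. Qed.

(** The factor l - x is the measure of the left ends for which a window of length l covers two
    points at distance x. Both exponents of the primitive, 2H-2 and 2H-3, are negative, so it
    vanishes at infinity. *)
Lemma integral_tent (H x : R) : 2^-1 < H < 1 -> 0 < x ->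
  (\int[mu]_(l in `[x, +oo[) ((l `^ (2 * H - 4) * (l - x))%:E) =
   (x `^ (2 * H - 2) / ((2 - 2 * H) * (3 - 2 * H)))%:E)%E.
Proof.
move=> /andP[H1 H2] x0.
pose F (l : R) := (2 * H - 2)^-1 * l `^ (2 * H - 2) - x / (2 * H - 3) * l `^ (2 * H - 3).
have d1 : 2 * H - 2 != 0 by lra.
have d2 : 2 * H - 3 != 0 by lra.
have dF (l : R) : 0 < l -> is_derive l 1 F (l `^ (2 * H - 4) * (l - x)).
  move=> l0.
  have e1 := is_derive1_powR (2 * H - 2) l0.
  have e2 := is_derive1_powR (2 * H - 3) l0.
  apply: is_derive_eq; rewrite /GRing.scale/=.
  have -> : 2 * H - 2 - 1 = (2 * H - 4) + 1 by ring.
  have -> : 2 * H - 3 - 1 = 2 * H - 4 by ring.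
  rewrite powRD ?powRr1 ?ltW//; last by rewrite (gt_eqF l0) implybT.
  by field; rewrite d1 d2.
have cF (l : R) : 0 < l -> {for l, continuous F}.
  move=> l0; apply: differentiable_continuous; apply/derivable1_diffP.
  have ? := dF l l0; exact: ex_derive.
rewrite (@ge0_continuous_FTC2y _ _ F x 0).
- rewrite -EFinB; congr EFin; rewrite /F sub0r opprB.
  have -> : x `^ (2 * H - 2) = x `^ (2 * H - 3) * x.
    have -> : 2 * H - 2 = (2 * H - 3) + 1 by ring.
    by rewrite (powRD (r := 2 * H - 3)) ?(powRr1 (ltW x0))// (gt_eqF x0) implybT.
  have d3 : 2 - 2 * H != 0 by lra.
  have d4 : 3 - 2 * H != 0 by lra.
  by field; rewrite d1 d2 d3 d4.
- by move=> l xl; rewrite mulr_ge0 ?powR_ge0 ?subr_ge0.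
- apply: continuous_in_subspaceT => l; rewrite inE/= in_itv/= andbT => xl.
  have l0 : 0 < l by exact: lt_le_trans xl.
  have cP : {for l, continuous (fun t : R => t `^ (2 * H - 4))}.
    apply: differentiable_continuous; apply/derivable1_diffP.
    by have ? := is_derive1_powR (2 * H - 4) l0; exact: ex_derive.
  by apply: cvgM; [exact: cP|apply: cvgB; [exact: cvg_id|exact: cvg_cst]].
- rewrite /F -[X in _ --> X](subrr 0); apply: cvgB.
    rewrite -[X in _ --> X](mulr0 (2 * H - 2)^-1); apply: cvgM; first exact: cvg_cst.
    have -> : 2 * H - 2 = - (2 - 2 * H) by ring.
    by apply: cvg_powRN; lra.
  rewrite -[X in _ --> X](mulr0 (x / (2 * H - 3))); apply: cvgM; first exact: cvg_cst.
  have -> : 2 * H - 3 = - (3 - 2 * H) by ring.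
  by apply: cvg_powRN; lra.
- by move=> l xl; have ? := dF l (lt_trans x0 xl); exact: ex_derive.
- by apply: cvg_at_right_filter; exact: cF.
- move=> l; rewrite in_itv/= andbT => xl; have ? := dF l (lt_trans x0 xl).
  by rewrite derive1E derive_val.
Qed.

End power_integrals.

Section window.
Context (R : realType) (H : R).
Notation mu := (@lebesgue_measure R).

(* The window [t.2, t.2 + t.1], weighted so that integrating the product of two windows over t
   gives back the kernel |u - v|^(2H-2), up to the factor (2-2H)(3-2H). *)
Definition window (u : R) (t : R * R) : R :=
  if (0 < t.1) && (t.2 <= u <= t.2 + t.1) then t.1 `^ (H - 2) else 0.

Lemma window_ge0 u t : 0 <= window u t.
Proof. by rewrite /window; case: ifP => // _; exact: powR_ge0. Qed.

Lemma measurable_window : measurable_fun setT (fun z : R * (R * R) => window z.1 z.2).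
Proof.
have m0 : measurable_fun setT (fun z : R * (R * R) => z.1) by exact: measurable_fst.
have m1 : measurable_fun setT (fun z : R * (R * R) => z.2.1).
  exact: (measurableT_comp measurable_fst measurable_snd).
have m2 : measurable_fun setT (fun z : R * (R * R) => z.2.2).
  exact: (measurableT_comp measurable_snd measurable_snd).
apply: measurable_fun_if => //.
- apply: measurable_and; first exact: measurable_fun_ltr.
  apply: measurable_and; first exact: measurable_fun_ler.
  by apply: measurable_fun_ler => //; exact: measurable_funD.
- by apply: measurable_funTS; exact: (measurableT_comp (measurable_powR _) m1).
Qed.

Lemma measurable_window1 u : measurable_fun setT (window u).
Proof. exact: (measurableT_comp measurable_window (measurable_pair1 u)). Qed.

Lemma measurable_window2 t : measurable_fun setT (window^~ t).
Proof. exact: (measurableT_comp measurable_window (measurable_pair2 t)). Qed.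

Hypothesis H_range : 2^-1 < H < 1.

(** At length l the admissible left ends form the interval from max(u, v) - l to min(u, v), which
    leaves the tent integral at x = |u - v|. On the diagonal the left side is infinite while the
    power of 0 is 0. *)
Lemma integral_window (u v : R) : u != v ->
  (\int[(mu \x mu)]_t (window u t * window v t)%:E =
   (`|u - v| `^ (2 * H - 2) / ((2 - 2 * H) * (3 - 2 * H)))%:E)%E.
Proof.
move=> uv; rewrite fubini_tonelli1; last 2 first.
- apply/measurable_EFinP; apply: measurable_funM; exact: measurable_window1.
- by move=> t; rewrite lee_fin mulr_ge0// window_ge0.
have uv0 : 0 < `|u - v| by rewrite normr_gt0 subr_eq0.
rewrite -integral_tent// [RHS]integral_mkcond; apply: eq_integral => l _.
rewrite /fubini_F /patch /=.
have [l0|l0] := leP l 0.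
  rewrite memNset/=; last by rewrite in_itv/= andbT; apply/negP; rewrite -ltNge (le_lt_trans l0).
  by rewrite integral0_eq// => r _; rewrite /window /= ltNge l0/= mul0r.
transitivity (\int[mu]_r ((l `^ (2 * H - 4))%:E *
    (\1_(`[(Num.max u v - l), (Num.min u v)]%classic) r)%:E))%E.
  apply: eq_integral => r _; rewrite -EFinM; congr EFin.
  have -> : 2 * H - 4 = (H - 2) + (H - 2) by ring.
  rewrite powRD; last by rewrite (gt_eqF l0) implybT.
  rewrite /window /= l0/= indicE.
  have -> : (r \in `[(Num.max u v - l), (Num.min u v)]%classic) =
      (r <= u <= r + l) && (r <= v <= r + l).
    rewrite mem_setE in_itv/= lerBlDr ge_max le_min.
    by apply/andP/andP => -[/andP[? ?] /andP[? ?]]; split; apply/andP.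
  by case: (r <= u <= r + l); case: (r <= v <= r + l) => /=; rewrite ?mulr1 ?mulr0 ?mul0r.
rewrite ge0_integralZl//; last 2 first.
- by apply/measurable_EFinP; exact: measurable_indic.
- by rewrite lee_fin powR_ge0.
rewrite integral_indic//= setIT lebesgue_measure_itv/= lte_fin.
have mm : Num.max u v - Num.min u v = `|u - v|.
  have [uv'|uv'] := leP u v.
    by rewrite ler0_norm ?subr_le0// opprB.
  by rewrite gtr0_norm ?subr_gt0.
rewrite -subr_gt0 opprB (_ : Num.min u v + (l - Num.max u v) = l - `|u - v|); last by rewrite -mm; ring.
case: ifPn => [h|].
  rewrite mem_set/=; last by rewrite in_itv/= andbT -subr_ge0 ltW.
  by rewrite -EFinD -EFinM; congr (_ * _)%:E; rewrite -mm; ring.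
rewrite -leNgt subr_le0 => h; rewrite mule0.
case: ifPn => // /set_mem/=; rewrite in_itv/= andbT => h'.
by rewrite (_ : l = `|u - v|) ?subrr ?mulr0//; apply/le_anti/andP.
Qed.

End window.

(* [lebesgue2] is a fresh constant because the library attaches the sigma-finite
   structure of a product measure to subprobabilities only. *)
Definition lebesgue2 (R : realType) :
    set (measurableTypeR R * measurableTypeR R)%type -> \bar R :=
  (@lebesgue_measure R \x @lebesgue_measure R)%E.

Arguments lebesgue2 : clear implicits.

HB.instance Definition _ (R : realType) := Measure.copy (lebesgue2 R)
  (@lebesgue_measure R \x @lebesgue_measure R)%E.

Lemma lebesgue2_sigma_finite (R : realType) : sigma_finite setT (lebesgue2 R).
Proof.
by case: (lebesgue_integral_fubini.measure_function_Measure_isSigmaFinite__to__measure_function_isSigmaFinite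
  (@lebesgue_measure R) (@lebesgue_measure R)).
Qed.

HB.instance Definition _ (R : realType) :=
  Measure_isSigmaFinite.Build _ _ _ (lebesgue2 R) (lebesgue2_sigma_finite R).

Section energy.
Context (R : realType) (H T : R).
Notation mu := (@lebesgue_measure R).
Notation RR := (measurableTypeR R).
Notation mu2 := (lebesgue2 R).
Notation win := (window H).
Hypothesis H_range : 2^-1 < H < 1.
Implicit Types (a b : R -> R) (t z : RR * RR).

Let K z : R := `|z.1 - z.2| `^ (2 * H - 2).
Let kap : R := (2 - 2 * H) * (3 - 2 * H).

Let kap_gt0 : 0 < kap.
Proof. by case/andP: H_range => ? ?; rewrite /kap mulr_gt0//; lra. Qed.

Lemma ae_offdiagonal : {ae mu2, forall z : RR * RR, z.1 != z.2}.
Proof.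
pose D : set (measurableTypeR R * measurableTypeR R) := [set z | z.1 - z.2 = 0].
have mD : measurable D.
  have msub : measurable_fun setT ((fun z => z.1 - z.2) : measurableTypeR R * measurableTypeR R -> measurableTypeR R).
    exact: measurable_funB.
  rewrite (_ : D = setT `&` (fun z => z.1 - z.2) @^-1` [set 0]); last by rewrite setTI.
  exact: msub.
exists D; split => //.
  transitivity (\int[mu]_x mu (xsection D x))%E => //.
  rewrite integral0_eq// => x _.
  rewrite (_ : xsection D x = [set x]) ?lebesgue_measure_set1//.
  apply/seteqP; split => y; rewrite /xsection /= inE /D /=.
    by move/eqP; rewrite subr_eq0 => /eqP.
  by move=> ->; rewrite subrr.
by move=> z /= /negP; rewrite negbK => /eqP h; rewrite /D /= h subrr.
Qed.

Let measurable_K : measurable_fun setT K.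
Proof.
apply: (measurableT_comp (measurable_powR _)).
by apply: measurableT_comp => //; exact: measurable_funB.
Qed.

Let mwin : measurable_fun setT
  (fun y : (RR * RR) * (RR * RR) => win y.1.1 y.2 * win y.1.2 y.2).
Proof.
have m1 : measurable_fun setT (fun y : (RR * RR) * (RR * RR) => (y.1.1, y.2)).
  apply: measurable_fun_pair => //.
  exact: (measurableT_comp measurable_fst measurable_fst).
have m2 : measurable_fun setT (fun y : (RR * RR) * (RR * RR) => (y.1.2, y.2)).
  apply: measurable_fun_pair => //.
  exact: (measurableT_comp measurable_snd measurable_fst).
by apply: measurable_funM; [exact: (measurableT_comp (measurable_window H) m1)
  |exact: (measurableT_comp (measurable_window H) m2)].
Qed.

Let mtensor a b : measurable_fun setT a -> measurable_fun setT b ->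
  measurable_fun setT (fun z : RR * RR => a z.1 * b z.2).
Proof. by move=> ma mb; apply: measurable_funM; exact: measurableT_comp. Qed.

Let mf4 a b : measurable_fun setT a -> measurable_fun setT b ->
  measurable_fun setT (fun y : (RR * RR) * (RR * RR) =>
    a y.1.1 * b y.1.2 * (win y.1.1 y.2 * win y.1.2 y.2)).
Proof.
move=> ma mb; apply: measurable_funM => //.
exact: (measurableT_comp (mtensor ma mb) measurable_fst).
Qed.

Lemma tonelli_tensor (a b : R -> R) : (forall u, 0 <= a u) -> (forall u, 0 <= b u) ->
  measurable_fun setT a -> measurable_fun setT b ->
  (\int[mu2]_z (a z.1 * b z.2)%:E =
   (\int[mu]_u (a u)%:E) * (\int[mu]_u (b u)%:E))%E.
Proof.
move=> a0 b0 ma mb; rewrite fubini_tonelli1; last 2 first.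
- by apply/measurable_EFinP; exact: mtensor.
- by move=> z; rewrite lee_fin mulr_ge0.
rewrite /fubini_F /=.
have -> : (fun x => \int[mu]_y (a x * b y)%:E)%E = (fun x => (a x)%:E * \int[mu]_y (b y)%:E)%E.
  apply/funext => x; under eq_integral do rewrite EFinM.
  rewrite ge0_integralZl//; [exact/measurable_EFinP|by move=> u _; rewrite lee_fin|by rewrite lee_fin].
rewrite ge0_integralZr//; [exact/measurable_EFinP|by move=> u _; rewrite lee_fin|].
by apply: integral_ge0 => u _; rewrite lee_fin.
Qed.

Lemma tonelli_kernel a b : (forall u, 0 <= a u) -> (forall u, 0 <= b u) ->
  measurable_fun setT a -> measurable_fun setT b ->
  (\int[mu2]_z (a z.1 * b z.2 * K z)%:E = kap%:E *
   \int[mu2]_t ((\int[mu]_u (a u * win u t)%:E) * (\int[mu]_u (b u * win u t)%:E)))%E.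
Proof.
move=> a0 b0 ma mb.
pose f (y : (RR * RR) * (RR * RR)) := a y.1.1 * b y.1.2 * (win y.1.1 y.2 * win y.1.2 y.2).
have mf : measurable_fun setT f by exact: mf4.
have f0 y : 0 <= f y by rewrite /f !mulr_ge0// window_ge0.
have mfE : measurable_fun setT (EFin \o f) by exact/measurable_EFinP.
have f0E y : (0 <= (EFin \o f) y)%E by rewrite /= lee_fin.
have mF : measurable_fun setT (fun z => \int[mu2]_t (f (z, t))%:E)%E.
  exact: (measurable_fun_fubini_tonelli_F (EFin \o f) mfE f0E).
transitivity (\int[mu2]_z (kap%:E * \int[mu2]_t (f (z, t))%:E))%E.
  apply: ae_eq_integral => //.
  - by apply/measurable_EFinP; apply: measurable_funM => //; exact: mtensor.
  - by apply: emeasurable_funM => //; exact: mF.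
  apply: filterS ae_offdiagonal => z zz _ /=.
  rewrite /f /=; under eq_integral do rewrite EFinM.
  rewrite ge0_integralZl//; last 3 first.
  - apply/measurable_EFinP; apply: measurable_funM; exact: measurable_window1.
  - by move=> t _; rewrite lee_fin mulr_ge0// window_ge0.
  - by rewrite lee_fin mulr_ge0.
  rewrite integral_window// -!EFinM; congr EFin; rewrite /K /kap; field.
  by case/andP: H_range => ? ?; apply/andP; split; lra.
rewrite ge0_integralZl//; last 2 first.
- by move=> z _; apply: integral_ge0 => t _; rewrite lee_fin.
- by rewrite lee_fin ltW.
congr (_ * _)%E; rewrite (@fubini_tonelli _ _ _ _ _ mu2 mu2 (EFin \o f))//.
apply: eq_integral => t _.
rewrite -(@tonelli_tensor (fun u => a u * win u t) (fun u => b u * win u t)).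
- by apply: eq_integral => z _; rewrite /f /=; congr EFin; ring.
- by move=> u; rewrite mulr_ge0// window_ge0.
- by move=> u; rewrite mulr_ge0// window_ge0.
- by apply: measurable_funM => //; exact: measurable_window2.
- by apply: measurable_funM => //; exact: measurable_window2.
Qed.

(** Not divided by the window length: with the weight l^(H-2) contained in [window], this map is an
    isometry into L^2 up to a constant. *)
Definition window_avg a t : R := \int[mu]_u (a u * win u t).

(* The absolute value makes the last clause equivalent to the absolute convergence of the double
   integral of [a u * a v * |u - v|^(2H-2)]. *)
Definition finite_energy a := [/\ measurable_fun setT a,
  (forall u, ~~ (0 <= u <= T) -> a u = 0), mu.-integrable setT (EFin \o a) &
  mu2.-integrable setT (EFin \o (fun t => window_avg (fun u => `|a u|) t ^+ 2))].

Lemma integrable_mul_window a t : mu.-integrable setT (EFin \o a) ->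
  mu.-integrable setT (EFin \o (fun u => a u * win u t)).
Proof.
move=> ai; have /integrableP[/measurable_EFinP ma _] := ai.
apply: le_integrable (integrableZl measurableT (t.1 `^ (H - 2)) ai) => //.
  by apply/measurable_EFinP; apply: measurable_funM => //; exact: measurable_window2.
move=> u _ /=; rewrite lee_fin !normrM mulrC ler_wpM2r//.
rewrite (ger0_norm (window_ge0 _ _ _)) (ger0_norm (powR_ge0 _ _)) /window.
by case: ifP => // _; exact: powR_ge0.
Qed.

(** Tonelli gives measurability for nonnegative integrands; a signed one is the difference of |a| +
    a and |a|. *)
Lemma measurable_window_avg a : mu.-integrable setT (EFin \o a) ->
  measurable_fun setT (window_avg a).
Proof.
move=> ai; have /integrableP[/measurable_EFinP ma _] := ai.
have m (b : R -> R) : measurable_fun setT b -> (forall u, 0 <= b u) ->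
    measurable_fun setT (window_avg b).
  move=> mb b0.
  pose f (y : (RR * RR) * RR) := b y.2 * win y.2 y.1.
  apply: (@ge0_measurable_Rintegral12 _ _ _ _ _ mu f).
    apply: measurable_funM; first exact: measurableT_comp.
    have ms : measurable_fun setT (fun y : (RR * RR) * RR => (y.2, y.1)).
      by apply: measurable_fun_pair.
    exact: (measurableT_comp (measurable_window H) ms).
  by move=> y; rewrite /f mulr_ge0// window_ge0.
have -> : window_avg a = (fun t => window_avg (fun u => `|a u| + a u) t -
    window_avg (fun u => `|a u|) t).
  apply/funext => t; rewrite /window_avg.
  have ni := integrable_norm ai.
  have i1 : mu.-integrable setT (EFin \o (fun u => `|a u| + a u)).
    exact: (integrableD measurableT ni ai).
  rewrite -RintegralB//; [|exact: integrable_mul_window|exact: integrable_mul_window].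
  by apply: eq_Rintegral => u _; ring.
apply: measurable_funB; apply: m => //.
- by apply: measurable_funD => //; exact: measurableT_comp.
- by move=> u; rewrite -lerBlDr sub0r (le_trans (ler_norm _))// normrN.
- exact: measurableT_comp.
Qed.

Lemma le_normr_window_avg a b t : mu.-integrable setT (EFin \o a) ->
  mu.-integrable setT (EFin \o b) -> (forall u, `|a u| <= b u) ->
  `|window_avg a t| <= window_avg b t.
Proof.
move=> ai bi ab; have i1 := integrable_mul_window t ai; have i2 := integrable_mul_window t bi.
apply: le_trans (le_normr_Rintegral measurableT i1) _.
apply: le_Rintegral => //; first exact: (integrable_norm i1).
by move=> u _; rewrite normrM (ger0_norm (window_ge0 _ _ _)) ler_wpM2r// window_ge0.
Qed.

Lemma window_avgD (c : R) a b t : mu.-integrable setT (EFin \o a) ->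
  mu.-integrable setT (EFin \o b) ->
  window_avg (fun u => a u + c * b u) t = window_avg a t + c * window_avg b t.
Proof.
move=> ai bi; have i1 := integrable_mul_window t ai; have i2 := integrable_mul_window t bi.
rewrite /window_avg -(RintegralZl c measurableT i2) -RintegralD//.
  by apply: eq_Rintegral => u _; ring.
exact: (integrableZl measurableT c i2).
Qed.

Lemma finite_energyD (c : R) a b : finite_energy a -> finite_energy b ->
  finite_energy (fun u => a u + c * b u).
Proof.
move=> [ma sa ai ea] [mb sb bi eb].
have abi : mu.-integrable setT (EFin \o (fun u => a u + c * b u)).
  exact: (integrableD measurableT ai (integrableZl measurableT c bi)).
split => //.
- by apply: measurable_funD => //; exact: measurable_funM.
- by move=> u h; rewrite sa// sb// mulr0 addr0.
have na := integrable_norm ai; have nb := integrable_norm bi; have nab := integrable_norm abi.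
have nb' : mu.-integrable setT (EFin \o (fun u => `|a u| + `|c| * `|b u|)).
  exact: (integrableD measurableT na (integrableZl measurableT `|c| nb)).
apply: (@le_integrable _ _ _ mu2 setT measurableT _ (fun t =>
   (2 * window_avg (fun u => `|a u|) t ^+ 2)%:E + (2 * c ^+ 2 * window_avg (fun u => `|b u|) t ^+ 2)%:E)%E).
- apply/measurable_EFinP; apply: measurable_funX; exact: measurable_window_avg.
- move=> t _ /=; rewrite lee_fin ger0_norm ?sqr_ge0//.
  have h : window_avg (fun u => `|a u + c * b u|) t <=
      window_avg (fun u => `|a u|) t + `|c| * window_avg (fun u => `|b u|) t.
    rewrite -window_avgD// (le_trans (ler_norm _))//; apply: le_normr_window_avg => //.
    by move=> u; rewrite normr_id (le_trans (ler_normD _ _))// normrM.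
  have h0 : 0 <= window_avg (fun u => `|a u + c * b u|) t.
    by apply: Rintegral_ge0 => u _; rewrite mulr_ge0// window_ge0.
  rewrite (le_trans _ (ler_norm _))//.
  set A := window_avg (fun u => `|a u|) t in h *; set B := window_avg (fun u => `|b u|) t in h *.
  have -> : c ^+ 2 = `|c| ^+ 2 by rewrite real_normK ?num_real.
  apply: (@le_trans _ _ ((A + `|c| * B) ^+ 2)); first by rewrite ler_sqr ?nnegrE// (le_trans h0).
  have := sqr_ge0 (A - `|c| * B); nra.
- apply: integrableD => //; first exact: (integrableZl measurableT 2 ea).
  exact: (integrableZl measurableT (2 * c ^+ 2) eb).
Qed.

(** The signed version of [tonelli_kernel]. Square integrability of the averages of |a| and |b|
    makes the integrand in all four variables absolutely integrable, so Fubini applies. *)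
Lemma window_avg_isometry a b : finite_energy a -> finite_energy b ->
  mu2.-integrable setT (EFin \o (fun t => window_avg a t * window_avg b t)) /\
  \int[mu]_v \int[mu]_u (a u * b v * K (u, v)) =
  kap * \int[mu2]_t (window_avg a t * window_avg b t).
Proof.
move=> [ma _ ai ea] [mb _ bi eb].
pose f (y : (RR * RR) * (RR * RR)) := a y.1.1 * b y.1.2 * (win y.1.1 y.2 * win y.1.2 y.2).
have mf : measurable_fun setT f by exact: mf4.
pose A t := window_avg (fun u => `|a u|) t.
pose B t := window_avg (fun u => `|b u|) t.
have A0 t : 0 <= A t by apply: Rintegral_ge0 => u _; rewrite mulr_ge0// window_ge0.
have B0 t : 0 <= B t by apply: Rintegral_ge0 => u _; rewrite mulr_ge0// window_ge0.
have na := integrable_norm ai; have nb := integrable_norm bi.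
have mA : measurable_fun setT A by exact: measurable_window_avg.
have mB : measurable_fun setT B by exact: measurable_window_avg.
have ABi : mu2.-integrable setT (EFin \o (fun t => A t * B t)).
  apply: le_integrable (integrableD measurableT ea eb) => //.
    by apply/measurable_EFinP; exact: measurable_funM.
  move=> t _ /=; rewrite lee_fin ger0_norm ?mulr_ge0// (le_trans _ (ler_norm _))//.
  rewrite -/(A t) -/(B t); have := sqr_ge0 (A t - B t); nra.
have wAE (c : R -> R) t : mu.-integrable setT (EFin \o c) ->
    (\int[mu]_u (`|c u| * win u t)%:E = (window_avg (fun u => `|c u|) t)%:E)%E.
  move=> ci; rewrite /window_avg /Rintegral fineK//.
  exact: (integrable_fin_num measurableT (integrable_mul_window t (integrable_norm ci))).
have fi : (mu2 \x mu2)%E.-integrable setT (EFin \o f).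
  apply/integrable21ltyP; first exact/measurable_EFinP.
  have /integrableP[_] := ABi; apply: le_lt_trans.
  rewrite le_eqVlt; apply/orP; left; apply/eqP; apply: eq_integral => t _.
  rewrite /= ger0_norm ?mulr_ge0// EFinM -(wAE a t ai) -(wAE b t bi).
  rewrite -(@tonelli_tensor (fun u => `|a u| * win u t) (fun u => `|b u| * win u t)).
  - by apply: eq_integral => z _; rewrite /f /= !normrM !(ger0_norm (window_ge0 _ _ _)); congr EFin; ring.
  - by move=> u; rewrite mulr_ge0// window_ge0.
  - by move=> u; rewrite mulr_ge0// window_ge0.
  - by apply: measurable_funM; [exact: measurableT_comp|exact: measurable_window2].
  - by apply: measurable_funM; [exact: measurableT_comp|exact: measurable_window2].
have inner t : \int[mu2]_z f (z, t) = window_avg a t * window_avg b t.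
  have i1 := integrable_mul_window t ai; have i2 := integrable_mul_window t bi.
  pose g (z : RR * RR) := (a z.1 * win z.1 t) * (b z.2 * win z.2 t).
  have gi : mu2.-integrable setT (EFin \o g).
    apply: (@integrable_prod_dominated _ _ _ _ _ mu mu g (fun u => `|a u * win u t|)
      (fun u => `|b u * win u t|)) => //.
    - apply: (mtensor (a := fun u => a u * win u t) (b := fun u => b u * win u t)).
      + by apply: measurable_funM => //; exact: measurable_window2.
      + by apply: measurable_funM => //; exact: measurable_window2.
    - exact: (integrable_norm i1).
    - exact: (integrable_norm i2).
    - by move=> u v; rewrite /g /= normrM.
  transitivity (\int[mu2]_z g z).
    by apply: eq_Rintegral => z _; rewrite /f /g /=; ring.
  rewrite -(Rintegral12 gi).2 /g /=.
  transitivity (\int[mu]_x (window_avg b t * (a x * win x t))).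
    by apply: eq_Rintegral => x _; rewrite (RintegralZl _ measurableT i2) mulrC.
  by rewrite (RintegralZl _ measurableT i1) mulrC.
split.
  apply: (@le_integrable _ _ _ mu2 setT measurableT _ (EFin \o (fun t => A t * B t))) => //.
    by apply/measurable_EFinP; apply: measurable_funM; exact: measurable_window_avg.
  move=> t _ /=; rewrite lee_fin [leRHS]ger0_norm ?mulr_ge0// normrM.
  by rewrite ler_pM//; apply: le_normr_window_avg.
have abK : ae_eq mu2 setT (EFin \o (fun z => kap * \int[mu2]_t f (z, t)))
    (EFin \o (fun z => a z.1 * b z.2 * K z)).
  apply: filterS ae_offdiagonal => z zz _ /=; congr EFin.
  have iw : mu2.-integrable setT (EFin \o (fun t => win z.1 t * win z.2 t)).
    apply/integrableP; split.
      by apply/measurable_EFinP; apply: measurable_funM; exact: measurable_window1.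
    under eq_integral do rewrite /= ger0_norm ?mulr_ge0 ?window_ge0//.
    by rewrite integral_window// ltry.
  rewrite /f /= (RintegralZl _ measurableT iw) {1}/Rintegral integral_window//=.
  rewrite /K /kap; field.
  by case/andP: H_range => ? ?; apply/andP; split; lra.
have fi1 := (Rintegral12 fi).1.
have kfi : mu2.-integrable setT (EFin \o (fun z => kap * \int[mu2]_t f (z, t))).
  exact: (integrableZl measurableT kap fi1).
have mabK : measurable_fun setT (fun z => a z.1 * b z.2 * K z).
  by apply: measurable_funM => //; exact: mtensor.
have abKi : mu2.-integrable setT (EFin \o (fun z => a z.1 * b z.2 * K z)).
  by apply: ae_eq_integrable abK kfi; exact/measurable_EFinP.
have -> : \int[mu]_v \int[mu]_u (a u * b v * K (u, v)) =
    \int[mu2]_z (a z.1 * b z.2 * K z) by exact: (Rintegral21 abKi).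
transitivity (\int[mu2]_z (kap * \int[mu2]_t f (z, t))).
  apply: (congr1 fine); apply/esym; apply: ae_eq_integral abK => //.
    exact: (measurable_int _ kfi).
  exact/measurable_EFinP.
rewrite (RintegralZl kap measurableT fi1) (Rintegral_swap fi); congr (_ * _).
by apply: eq_Rintegral => t _.
Qed.

End energy.

(** * Functions of finite energy *)

Section energy_entry.
Context (R : realType) (H T : R).
Notation mu := (@lebesgue_measure R).
Notation RR := (measurableTypeR R).
Notation mu2 := (lebesgue2 R).
Notation win := (window H).
Notation wavg := (window_avg H).
Notation fen := (finite_energy H T).
Hypothesis H_range : 2^-1 < H < 1.
Hypothesis T_gt0 : 0 < T.
Implicit Types (a b : R -> R) (t z : RR * RR).

Let kap : R := (2 - 2 * H) * (3 - 2 * H).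

Let kap_gt0 : 0 < kap.
Proof. by case/andP: H_range => ? ?; rewrite /kap mulr_gt0//; lra. Qed.

(** Finite energy forces integrability of [a] itself: a window covering [0, T] sees the whole
    integral of |a|, and such windows fill a set of positive measure. *)
Lemma finite_energy_window a : measurable_fun setT a ->
  (forall u, ~~ (0 <= u <= T) -> a u = 0) ->
  (\int[mu2]_t ((\int[mu]_u (`|a u| * win u t)%:E) *
     (\int[mu]_u (`|a u| * win u t)%:E)) < +oo)%E -> fen a.
Proof.
move=> ma sa fin.
have hw (l r u : R) : T + 1 <= l -> -1 <= r -> r <= 0 -> 0 <= u -> u <= T ->
    r <= u <= r + l.
  by move=> *; apply/andP; split; lra.
have H20 : 0 <= 2 - H by case/andP: H_range => ? ?; lra.
have mna : measurable_fun setT (fun u => `|a u|) by exact: measurableT_comp.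
pose E t := (\int[mu]_u (`|a u| * win u t)%:E)%E.
have E0 t : (0 <= E t)%E by apply: integral_ge0 => u _; rewrite lee_fin mulr_ge0// window_ge0.
have mE : measurable_fun setT E.
  pose f (y : (RR * RR) * RR) := `|a y.2| * win y.2 y.1.
  apply: (@measurable_fun_fubini_tonelli_F _ _ _ _ _ mu (EFin \o f)).
    apply/measurable_EFinP; apply: measurable_funM.
      by apply: measurableT_comp mna _; exact: measurable_snd.
    have ms : measurable_fun setT (fun y : (RR * RR) * RR => (y.2, y.1)).
      by apply: measurable_fun_pair.
    exact: (measurableT_comp (measurable_window H) ms).
  by move=> y; rewrite /= lee_fin mulr_ge0// window_ge0.
pose I := (\int[mu]_u `|a u|%:E)%E.
have I0 : (0 <= I)%E by apply: integral_ge0 => u _; rewrite lee_fin.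
(* Windows of length in [T + 1, T + 2] starting in [-1, 0] cover [0, T]; [k] is the least weight
   among them, and the box [B] of these windows has measure 1. *)
pose k : R := (T + 2) `^ (H - 2).
have k0 : 0 < k by rewrite powR_gt0// addr_gt0.
pose B : set (RR * RR) := `[(T + 1), (T + 2)]%classic `*` `[(-1), 0]%classic.
have mB : measurable B by apply: measurableX; exact: measurable_itv.
have mu2B : mu2 B = 1%E.
  transitivity (mu `[(T + 1)%R, (T + 2)%R]%classic * mu `[(-1)%R, 0%R]%classic)%E.
    by apply: product_measure1E; exact: measurable_itv.
  have itv1 (p q : R) : q = p + 1 -> mu `[p, q]%classic = 1%E.
    move=> ->; rewrite lebesgue_measure_itv/= lte_fin ltrDl ltr01 -EFinD.
    by congr EFin; ring.
  by rewrite !itv1 ?mule1//; ring.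
have kI t : B t -> (k%:E * I <= E t)%E.
  case: t => l r [/=]; rewrite !in_itv/= => /andP[l1 l2] /andP[r1 r2].
  rewrite /I -ge0_integralZl//; last 2 first.
  - exact/measurable_EFinP.
  - by rewrite lee_fin ltW.
  apply: ge0_le_integral => //.
  - by move=> u _; rewrite -EFinM lee_fin mulr_ge0// ltW.
  - by apply: emeasurable_funM => //; exact/measurable_EFinP.
  - apply/measurable_EFinP; apply: measurable_funM => //.
    exact: measurable_window2.
  move=> u _; rewrite -EFinM lee_fin mulrC.
  have [/andP[u0 uT]|nu] := boolP (0 <= u <= T); last by rewrite sa// normr0 !mul0r.
  have l0 : 0 < l by apply: lt_le_trans l1; rewrite addr_gt0.
  have T20 : 0 < T + 2 by rewrite addr_gt0.
  rewrite ler_wpM2l// /window /= ifT; last first.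
    by rewrite l0 hw.
  rewrite /k (_ : H - 2 = - (2 - H)); last by ring.
  rewrite !powRN lef_pV2 ?posrE ?powR_gt0//.
  by apply: ge0_ler_powR; rewrite ?nnegrE// ltW.
have Ioo : (I < +oo)%E.
  rewrite ltNge leye_eq; apply/negP => /eqP Iy.
  suff : (+oo <= \int[mu2]_t (E t * E t))%E by rewrite leNgt fin.
  apply: (@le_trans _ _ (\int[mu2]_(t in B) (E t * E t))%E); last first.
    apply: ge0_subset_integral => //; first by apply: emeasurable_funM.
    by move=> t _; exact: mule_ge0.
  rewrite (@eq_integral _ _ _ mu2 B (cst +oo%E)).
    by rewrite integral_cst// [X in (_ * X)%E]mu2B mule1.
  move=> t /set_mem Bt; have := kI t Bt; rewrite Iy gt0_muley ?lte_fin// leye_eq.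
  by move=> /eqP ->; rewrite mulyy.
have ai : mu.-integrable setT (EFin \o a).
  by apply/integrableP; split => //; exact/measurable_EFinP.
split => //.
have EE t : E t = (wavg (fun u => `|a u|) t)%:E.
  rewrite /window_avg /Rintegral fineK//.
  exact: (integrable_fin_num measurableT (integrable_mul_window H t (integrable_norm ai))).
apply/integrableP; split.
  apply/measurable_EFinP; apply: measurable_funX.
  exact: (measurable_window_avg H (integrable_norm ai)).
apply: le_lt_trans fin; rewrite le_eqVlt; apply/orP; left; apply/eqP.
apply: eq_integral => t _ /=; rewrite ger0_norm ?sqr_ge0// expr2 EFinM.
by rewrite -/(E t) EE.
Qed.

(** Absolute convergence of the double integral is a statement about |phi|, which [tonelli_kernel]
    carries over to the windows. *)
Lemma function_in_H_finite_energy phi : function_in_H T H phi ->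
  fen (phi \_ `[0, T]).
Proof.
move=> [mphi /integrableP[_ iphi]].
pose a := phi \_ `[0, T]%classic.
have ma : measurable_fun setT a by apply/measurable_restrict => //; rewrite setTI.
have mna : measurable_fun setT (fun u => `|a u|) by exact: measurableT_comp.
apply: finite_energy_window => //.
  move=> u; rewrite /a /patch; case: ifPn => // /set_mem/=.
  by rewrite in_itv/= => ->.
have := @tonelli_kernel R H H_range (fun u => `|a u|) (fun u => `|a u|)
  (fun u => normr_ge0 _) (fun u => normr_ge0 _) mna mna.
set J := (X in (_ = _ * X)%E) => tk.
have J0 : (0 <= J)%E.
  by apply: integral_ge0 => t _; apply: mule_ge0;
    apply: integral_ge0 => u _; rewrite lee_fin mulr_ge0// window_ge0.
rewrite ltNge leye_eq; apply/negP => /eqP Jy'.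
have Jy : J = +oo%E := Jy'.
move: tk; rewrite Jy gt0_muley ?lte_fin//; apply/eqP; rewrite lt_eqF//.
apply: le_lt_trans iphi; rewrite [leRHS]integral_mkcond.
rewrite le_eqVlt; apply/orP; left; apply/eqP; apply: eq_integral => z _.
rewrite /patch /= in_setX /a /patch.
case: (z.1 \in `[0, T]%classic); case: (z.2 \in `[0, T]%classic) => //=; rewrite ?normr0 ?mulr0 ?mul0r//.
rewrite !normrM; congr ((_ * _)%:E); apply/esym.
exact: (ger0_norm (powR_ge0 _ _)).
Qed.

(** Window integrals ignore null sets, so domination almost everywhere bounds each of them by [C]
    times that of [b], and the energy by C^2 times. *)
Lemma finite_energy_dominated a b (C : R) : measurable_fun setT a ->
  (forall u, ~~ (0 <= u <= T) -> a u = 0) -> 0 <= C ->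
  {ae mu, forall u, `|a u| <= C * `|b u|} -> fen b -> fen a.
Proof.
move=> ma sa C0 ab [mb sb bi eb].
have mna : measurable_fun setT (fun u => `|a u|) by exact: measurableT_comp.
have mnb : measurable_fun setT (fun u => `|b u|) by exact: measurableT_comp.
have nb := integrable_norm bi.
have Eab t : (\int[mu]_u (`|a u| * win u t)%:E <= (C * wavg (fun u => `|b u|) t)%:E)%E.
  have i1 := integrable_mul_window H t nb.
  have -> : (C * wavg (fun u => `|b u|) t)%:E =
      (\int[mu]_u (C * (`|b u| * win u t))%:E)%E.
    rewrite EFinM /window_avg /Rintegral fineK; last exact: (integrable_fin_num measurableT i1).
    under [RHS]eq_integral do rewrite EFinM.
    by rewrite integralZl.
  apply: ae_ge0_le_integral => //.
  - by move=> u _; rewrite lee_fin mulr_ge0// window_ge0.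
  - by apply/measurable_EFinP; apply: measurable_funM => //; exact: measurable_window2.
  - by move=> u _; rewrite lee_fin !mulr_ge0// window_ge0.
  - apply/measurable_EFinP; apply: measurable_funM => //; apply: measurable_funM => //.
    exact: measurable_window2.
  - case: ab => N [mN N0 sN]; exists N; split=> //; apply: subset_trans sN.
    by apply: subsetC => u abu _; rewrite lee_fin mulrA ler_wpM2r// window_ge0.
apply: finite_energy_window => //.
have := integrableZl measurableT (C ^+ 2) eb => /integrableP[mCe]; apply: le_lt_trans.
have E0 t : (0 <= \int[mu]_u (`|a u| * win u t)%:E)%E.
  by apply: integral_ge0 => u _; rewrite lee_fin mulr_ge0// window_ge0.
apply: ge0_le_integral => //.
- by move=> t _; exact: mule_ge0.
- have mE : measurable_fun setT (fun t => \int[mu]_u (`|a u| * win u t)%:E)%E.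
    pose f (y : (RR * RR) * RR) := `|a y.2| * win y.2 y.1.
    apply: (@measurable_fun_fubini_tonelli_F _ _ _ _ _ mu (EFin \o f)).
      apply/measurable_EFinP; apply: measurable_funM.
        by apply: measurableT_comp mna _; exact: measurable_snd.
      have ms : measurable_fun setT (fun y : (RR * RR) * RR => (y.2, y.1)).
        by apply: measurable_fun_pair.
      exact: (measurableT_comp (measurable_window H) ms).
    by move=> y; rewrite /= lee_fin mulr_ge0// window_ge0.
  exact: emeasurable_funM.
- exact: measurableT_comp.
move=> t _; rewrite /= (_ : C ^+ 2 * _ = (C * wavg (fun u => `|b u|) t) ^+ 2); last by ring.
rewrite ger0_norm ?sqr_ge0// expr2 EFinM.
by apply: lee_pmul.
Qed.

End energy_entry.

(** * The geometry of square-integrable functions *)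

Section square_integrable.
Context d (T : measurableType d) (R : realType) (m : {measure set T -> \bar R}).
Implicit Types (f g h : T -> R) (c : R).

Definition sqr_integrable f := measurable_fun setT f /\
  m.-integrable setT (EFin \o (fun x => f x ^+ 2)).

(** Over an arbitrary measure and on functions instead of classes, this form serves both sides of
    the isometry: random variables under [P] and window averages under [lebesgue2]. *)
Definition dot f g : R := \int[m]_x (f x * g x).

Lemma sqr_integrable_mul f g : sqr_integrable f -> sqr_integrable g ->
  m.-integrable setT (EFin \o (fun x => f x * g x)).
Proof.
move=> [mf fi] [mg gi]; apply: le_integrable (integrableD measurableT fi gi) => //.
  by apply/measurable_EFinP; exact: measurable_funM.
move=> x _ /=; rewrite lee_fin [leRHS]ger0_norm ?addr_ge0 ?sqr_ge0// normrM.
have := sqr_ge0 (`|f x| - `|g x|); have := sqr_ge0 (f x); have := sqr_ge0 (g x).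
rewrite -(real_normK (num_real (f x))) -(real_normK (num_real (g x))); nra.
Qed.

Lemma dotC f g : dot f g = dot g f.
Proof. by apply: eq_Rintegral => x _; rewrite mulrC. Qed.

Lemma dot0r f : dot f (fun=> 0) = 0.
Proof. by rewrite /dot; under eq_Rintegral do rewrite mulr0; rewrite Rintegral_cst// mul0r. Qed.

Lemma dot_ge0 f : 0 <= dot f f.
Proof. by apply: Rintegral_ge0 => x _; rewrite -expr2 sqr_ge0. Qed.

Lemma dotDr c f g h : sqr_integrable f -> sqr_integrable g -> sqr_integrable h ->
  dot f (fun x => g x + c * h x) = dot f g + c * dot f h.
Proof.
move=> sf sg sh; have i1 := sqr_integrable_mul sf sg; have i2 := sqr_integrable_mul sf sh.
rewrite /dot -RintegralZl// -RintegralD//; last exact: (integrableZl measurableT c i2).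
by apply: eq_Rintegral => x _; ring.
Qed.

Lemma sqr_integrableD c f g : sqr_integrable f -> sqr_integrable g ->
  sqr_integrable (fun x => f x + c * g x).
Proof.
move=> sf sg; have [mf fi] := sf; have [mg gi] := sg; split.
  by apply: measurable_funD => //; exact: measurable_funM.
have i := integrableD measurableT fi (integrableD measurableT
  (integrableZl measurableT (2 * c) (sqr_integrable_mul sf sg))
  (integrableZl measurableT (c ^+ 2) gi)).
apply: eq_integrable i => // x _ /=; rewrite -!EFinM -!EFinD; congr EFin; ring.
Qed.

Lemma sqr_integrable0 : sqr_integrable (fun _ => 0).
Proof.
split; first exact: measurable_cst.
by apply: eq_integrable (integrable0 m setT) => // x _; rewrite /= expr0n.
Qed.

Lemma eq_sqr_integrable f g : f =1 g -> sqr_integrable f -> sqr_integrable g.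
Proof. by move=> /funext ->. Qed.

Lemma sqr_integrableZ c f : sqr_integrable f -> sqr_integrable (fun x => c * f x).
Proof.
move=> sf; apply: eq_sqr_integrable (sqr_integrableD c sqr_integrable0 sf) => x.
by rewrite add0r.
Qed.

Lemma sqr_integrable_sum (I : Type) (r : seq I) (c : I -> R) (F : I -> T -> R) :
  (forall i, sqr_integrable (F i)) ->
  sqr_integrable (fun x => \sum_(i <- r) c i * F i x).
Proof.
move=> sF; elim: r => [|i r ih].
  by apply: eq_sqr_integrable sqr_integrable0 => x; rewrite big_nil.
apply: eq_sqr_integrable (sqr_integrableD (c i) ih (sF i)) => x.
by rewrite big_cons addrC.
Qed.

Lemma dot_sumr (I : Type) (r : seq I) (c : I -> R) (F : I -> T -> R) f :
  sqr_integrable f -> (forall i, sqr_integrable (F i)) ->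
  dot f (fun x => \sum_(i <- r) c i * F i x) = \sum_(i <- r) c i * dot f (F i).
Proof.
move=> sf sF; elim: r => [|i r ih].
  rewrite big_nil /dot; under eq_Rintegral do rewrite big_nil mulr0.
  by rewrite Rintegral_cst// mul0r.
rewrite big_cons -ih addrC -dotDr//; last exact: sqr_integrable_sum.
by congr (dot f _); apply/funext => x; rewrite big_cons addrC.
Qed.

(** The degenerate case of Cauchy--Schwarz: when [g] has norm 0, the squared norm of f + c g is
    affine in c and bounded below, so its slope vanishes. *)
Lemma dot_eq0 f g : sqr_integrable f -> sqr_integrable g ->
  dot g g = 0 -> dot f g = 0.
Proof.
move=> sf sg g0; apply/eqP/negP => /negP fg0.
have h c : 0 <= dot f f + 2 * c * dot f g.
  have := dot_ge0 (fun x => f x + c * g x).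
  have sfg := sqr_integrableD c sf sg.
  by rewrite dotDr// ![dot (fun x => _ + _) _]dotC !dotDr// g0 (dotC g f); lra.
have := h (- (dot f f + 1) / (2 * dot f g)).
rewrite (_ : 2 * _ * _ = - (dot f f + 1)); last by field.
lra.
Qed.

Lemma dotDD c f g : sqr_integrable f -> sqr_integrable g ->
  dot (fun x => f x + c * g x) (fun x => f x + c * g x) =
  dot f f + 2 * c * dot f g + c ^+ 2 * dot g g.
Proof.
move=> sf sg; have sfg := sqr_integrableD c sf sg.
by rewrite dotDr// ![dot (fun x => _ + _) _]dotC !dotDr// (dotC g f); ring.
Qed.

Lemma le_dotDD c f g : sqr_integrable f -> sqr_integrable g ->
  dot (fun x => f x + c * g x) (fun x => f x + c * g x) <=
  2 * dot f f + 2 * c ^+ 2 * dot g g.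
Proof.
move=> sf sg; have := dot_ge0 (fun x => f x + - c * g x).
rewrite !dotDD// sqrrN; lra.
Qed.

(** A Gram--Schmidt step, by induction for all functions simultaneously: the residual of g on the
    first n vectors is projected on the residual of [e n]. The vectors may be linearly dependent. *)
Lemma orthogonal_projection (e : nat -> T -> R) (n : nat) f :
  (forall k, sqr_integrable (e k)) -> sqr_integrable f ->
  exists a : nat -> R, forall j, (j < n)%N ->
    dot (fun x => f x - \sum_(0 <= k < n) a k * e k x) (e j) = 0.
Proof.
move=> se.
pose res n (a : nat -> R) f x := f x + (-1) * \sum_(0 <= k < n) a k * e k x.
have sres n' a g : sqr_integrable g -> sqr_integrable (res n' a g).
  by move=> sg; apply: sqr_integrableD => //; exact: sqr_integrable_sum.
suff H : forall g, sqr_integrable g ->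
    exists a : nat -> R, forall j, (j < n)%N -> dot (res n a g) (e j) = 0.
  move=> /H[a aP]; exists a => j jn; rewrite -[RHS](aP j jn).
  by congr (dot _ _); apply/funext => x; rewrite /res mulN1r.
elim: n => [|n ih] g sg; first by exists (fun=> 0).
have [a aP] := ih g sg; have [b bP] := ih (e n) (se n).
pose g' := res n a g; pose e' := res n b (e n).
have sg' : sqr_integrable g' by exact: sres.
have se' : sqr_integrable e' by exact: sres.
pose c := dot g' e' / dot e' e'.
(* If the residual of [e n] has norm 0, the quotient [c] is 0 and [dot_eq0] saves the equation. *)
have ge' : dot g' e' = c * dot e' e'.
  have [e0|e0] := eqVneq (dot e' e') 0; last by rewrite /c divfK.
  by rewrite (dot_eq0 sg' se' e0) e0 mulr0.
pose a' k := if k == n then c else a k - c * b k.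
exists a' => j; rewrite ltnS leq_eqVlt => jn.
have resE : res n.+1 a' g = (fun x => g' x + (- c) * e' x).
  apply/funext => x; rewrite /g' /e' /res big_nat_recr//= {2}/a' eqxx.
  rewrite (eq_big_nat _ _ (F2 := fun k => a k * e k x + (- c) * (b k * e k x))); last first.
    by move=> k /andP[_ kn]; rewrite /a' ltn_eqF//; ring.
  by rewrite big_split/= -mulr_sumr; ring.
rewrite resE.
have orth i : (i < n)%N -> dot (fun x => g' x + - c * e' x) (e i) = 0.
  by move=> lin; rewrite dotC dotDr// ![dot (e i) _]dotC aP// bP// mulr0 addr0.
case/orP: jn => [/eqP -> |]; last exact: orth.
have enE : e n = (fun x => e' x + 1 * \sum_(0 <= k < n) b k * e k x).
  by apply/funext => x; rewrite /e' /res; ring.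
have sge := sqr_integrableD (- c) sg' se'.
rewrite enE dotDr//; last exact: sqr_integrable_sum.
rewrite dot_sumr// big1_seq ?mulr0 ?addr0; last first.
  by move=> i /=; rewrite mem_index_iota => /andP[_ lin]; rewrite orth// mulr0.
by rewrite dotC dotDr// dotC ge'; ring.
Qed.

Lemma cvg0_dotDD c (F G : nat -> T -> R) :
  (forall k, sqr_integrable (F k)) -> (forall k, sqr_integrable (G k)) ->
  (fun k => dot (F k) (F k)) @ \oo --> (0 : R) ->
  (fun k => dot (G k) (G k)) @ \oo --> (0 : R) ->
  (fun k => let E := fun x => F k x + c * G k x in dot E E) @ \oo --> (0 : R).
Proof.
move=> sF sG F0 G0.
apply: (@squeeze_cvgr _ _ _ _ (cst 0)
  (fun k => 2 * dot (F k) (F k) + 2 * c ^+ 2 * dot (G k) (G k))).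
- by apply: nearW => k /=; rewrite dot_ge0 /=; exact: le_dotDD.
- exact: cvg_cst.
- rewrite (_ : 0 = 2 * 0 + 2 * c ^+ 2 * 0); last by ring.
  by apply: cvgD; apply: cvgMl_tmp.
Qed.

Lemma cvg_dot (F : nat -> T -> R) f : sqr_integrable f ->
  (forall k, sqr_integrable (F k)) ->
  (fun k => let G := fun x => f x - F k x in dot G G) @ \oo --> (0 : R) ->
  (fun k => dot (F k) (F k)) @ \oo --> dot f f.
Proof.
move=> sf sF F0.
apply/cvgrPdist_le => e e0.
(* Weight in 2 |<f, G>| <= eta |f|^2 + eta^-1 |G|^2, chosen to make the first term at most e/2; the
   1 guards against f of norm 0. *)
pose eta := e / (2 * (dot f f + 1)).
have ff := dot_ge0 f.
have eta0 : 0 < eta by rewrite divr_gt0// mulr_gt0//; lra.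
have etaE : eta * dot f f <= e / 2.
  rewrite /eta (_ : _ * _ = e / 2 * (dot f f / (dot f f + 1))); last by field; lra.
  by apply: ler_piMr; [rewrite divr_ge0 ?ltW|rewrite ler_pdivrMr; lra].
clearbody eta.
have k1 : 0 < 1 + eta^-1 by rewrite addr_gt0// invr_gt0.
move/cvgrPdist_le : F0 => /(_ (e / 2 / (1 + eta^-1))) /(_ _)[].
  by rewrite !divr_gt0.
move=> K _ KP; exists K => // k Kk; have := KP k Kk.
rewrite /= sub0r normrN ger0_norm ?dot_ge0//.
set G := (fun x => f x - F k x); rewrite ler_pdivlMr// => GG.
have sG : sqr_integrable G.
  by apply: eq_sqr_integrable (sqr_integrableD (-1) sf (sF k)) => x; rewrite mulN1r.
have FE : F k = (fun x => f x + (-1) * G x) by apply/funext => x; rewrite /G; ring.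
rewrite FE dotDD//.
have := dot_ge0 (fun x => eta * f x + 1 * G x); rewrite dotDD//; last exact: sqr_integrableZ.
have := dot_ge0 (fun x => eta * f x + (-1) * G x); rewrite dotDD//; last exact: sqr_integrableZ.
have sef := sqr_integrableZ eta sf.
have dZ g : sqr_integrable g -> dot (fun x => eta * f x) g = eta * dot f g.
  move=> sg; rewrite dotC -[RHS]add0r -(dotC g) /dot.
  rewrite -RintegralZl//; last exact: sqr_integrable_mul.
  by rewrite add0r; apply: eq_Rintegral => x _; ring.
rewrite !dZ// (dotC f (fun x => _ * _)) dZ// => h1 h2.
have {}h1 : 2 * dot f G <= eta * dot f f + eta^-1 * dot G G.
  rewrite -(ler_pM2l eta0) mulrDr !mulrA divff ?gt_eqF// mul1r; lra.
have {}h2 : - (2 * dot f G) <= eta * dot f f + eta^-1 * dot G G.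
  rewrite -(ler_pM2l eta0) mulrDr !mulrA divff ?gt_eqF// mul1r; lra.
by have := dot_ge0 G => GG0; rewrite ler_norml; apply/andP; split; lra.
Qed.

End square_integrable.

(** An isometry known on generators extends to finite combinations, since both sides expand into the
    same double sum. *)
Lemma dot_transfer d1 d2 (T1 : measurableType d1) (T2 : measurableType d2)
    (R : realType) (m1 : {measure set T1 -> \bar R}) (m2 : {measure set T2 -> \bar R})
    (I : Type) (X : I -> T1 -> R) (Y : I -> T2 -> R) (kappa : R) (r : seq I) (c : I -> R) :
  (forall i, sqr_integrable m1 (X i)) -> (forall i, sqr_integrable m2 (Y i)) ->
  (forall i j, dot m1 (X i) (X j) = kappa * dot m2 (Y i) (Y j)) ->
  let SX := fun x => \sum_(i <- r) c i * X i x in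
  let SY := fun x => \sum_(i <- r) c i * Y i x in
  dot m1 SX SX = kappa * dot m2 SY SY.
Proof.
move=> sX sY XY SX SY.
rewrite !dot_sumr//; try exact: sqr_integrable_sum.
rewrite mulr_sumr; apply: eq_bigr => i _; rewrite mulrCA; congr (_ * _).
rewrite dotC [in RHS]dotC !dot_sumr// mulr_sumr; apply: eq_bigr => j _.
by rewrite XY mulrCA.
Qed.

(** * The energy of a Volterra kernel *)

Lemma integrable_indic_lty d (X : measurableType d) (R : realType)
    (m : {measure set X -> \bar R}) (A : set X) : measurable A -> (m A < +oo)%E ->
  m.-integrable setT (EFin \o (\1_A : X -> R)).
Proof.
move=> mA Aoo; apply/integrableP; split; first exact/measurable_EFinP.
under eq_integral do rewrite /= ger0_norm//.
by rewrite integral_indic// setIT.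
Qed.

Section energy_norm.
Context (R : realType) (H T : R).
Notation mu := (@lebesgue_measure R).
Notation RR := (measurableTypeR R).
Notation mu2 := (lebesgue2 R).
Notation wavg := (window_avg H).
Notation fen := (finite_energy H T).
Hypothesis H_range : 2^-1 < H < 1.
Hypothesis T_gt0 : 0 < T.
Implicit Types (a b : R -> R) (t z : RR * RR).

Let kap : R := (2 - 2 * H) * (3 - 2 * H).

Lemma sqr_integrable_window_avg a : fen a -> sqr_integrable mu2 (wavg a).
Proof.
move=> fa; have [_ _ ai _] := fa; split; first exact: measurable_window_avg.
have [i _] := window_avg_isometry H_range fa fa.
by apply: eq_integrable i.
Qed.

Lemma kernel_restrict_window_avg (D E : set R) a b : fen (a \_ D) -> fen (b \_ E) ->
  \int[mu]_(v in E) \int[mu]_(u in D) (a u * b v * `|u - v| `^ (2 * H - 2)) =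
  kap * dot mu2 (wavg (a \_ D)) (wavg (b \_ E)).
Proof.
move=> fa fb; have [_ <-] := window_avg_isometry H_range fa fb.
rewrite Rintegral_mkcond; apply: eq_Rintegral => v _; rewrite {1}/patch.
have -> (v' : R) : \int[mu]_(u in D) (a u * b v' * `|u - v'| `^ (2 * H - 2)) =
    \int[mu]_u ((a \_ D) u * b v' * `|u - v'| `^ (2 * H - 2)).
  rewrite Rintegral_mkcond; apply: eq_Rintegral => u _; rewrite /patch.
  by case: ifP => // _; rewrite !mul0r.
rewrite /patch; case: ifP => // _.
under eq_Rintegral do rewrite mulr0 mul0r.
by rewrite Rintegral_cst// mul0r.
Qed.

Lemma inner_H_window_avg a : fen (a \_ `[0, T]) ->
  inner_H T H a a = H * (2 * H - 1) * kap *
    dot mu2 (wavg (a \_ `[0, T])) (wavg (a \_ `[0, T])).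
Proof. by move=> fa; rewrite /inner_H kernel_restrict_window_avg// mulrA. Qed.

(* The kernel is bounded below by T^(alpha-1) on [0, T[, hence dominates indicators. At the
   right endpoint it is 0^(alpha-1) = 0, whence the exceptional null set. *)
Lemma finite_energy_indic (alpha q : R) : alpha < 1 -> 0 <= q <= T ->
  fen (fractional_kernel alpha T \_ `[0, T]) -> fen \1_`[0, q].
Proof.
move=> a1 /andP[q0 qT].
apply: (@finite_energy_dominated _ _ _ H_range T_gt0 _ _ (T `^ (1 - alpha))).
- exact: measurable_indic.
- move=> u nu; rewrite indicE; case: (boolP (u \in _)) => //; rewrite inE/= in_itv/=.
  by move=> /andP[u0 uq]; move: nu; rewrite u0 (le_trans uq).
- exact: powR_ge0.
exists [set T]; split; [exact: measurable_set1|exact: lebesgue_measure_set1|].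
apply: subsetCl => u /= uT.
rewrite indicE; case: (boolP (u \in _)) => [|_]; last first.
  by rewrite normr0 mulr_ge0 ?powR_ge0.
rewrite inE/= in_itv/= => /andP[u0 uq]; have uT' := le_trans uq qT.
have uI : (u : R) \in `[0, T]%classic by rewrite inE/= in_itv/= u0 uT'.
rewrite /patch uI /fractional_kernel indicE uI mul1r !ger0_norm ?powR_ge0//.
have uT2 : 0 < T - u by rewrite subr_gt0 lt_neqAle uT' andbT; exact/eqP.
rewrite -(opprB 1 alpha) powRN mulrC -ler_pdivrMl ?invr_gt0 ?powR_gt0// invrK mulr1.
by apply: ge0_ler_powR; rewrite ?nnegrE ?gerBl// ltW// subr_gt0.
Qed.

(** Supplied in the end by [finite_energy_indic]; as a hypothesis it keeps the theory of Wiener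
    integrals free of [alpha]. *)
Hypothesis fen1 : forall q, 0 <= q <= T -> fen \1_`[0, q].

Lemma finite_energy_step s : step_on T s -> fen (step_fun s) /\
  forall t, wavg (step_fun s) t = \sum_(p <- s) p.1 * wavg \1_`[0, p.2] t.
Proof.
elim: s => [_|p s ih sT].
  have -> : step_fun [::] = (fun=> 0) :> (R -> R).
    by apply/funext => u; rewrite /step_fun big_nil.
  have T0 : 0 <= T <= T by rewrite ltW/=.
  split.
    have := finite_energyD (-1) (fen1 T0) (fen1 T0).
    by congr fen; apply/funext => u; ring.
  move=> t; rewrite big_nil /window_avg; under eq_Rintegral do rewrite mul0r.
  by rewrite Rintegral_cst// mul0r.
have [|fs ws] := ih; first by move=> q qs; apply: sT; rewrite inE qs orbT.
have fp := fen1 (sT p (mem_head _ _)).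
have E : step_fun (p :: s) = (fun u => step_fun s u + p.1 * \1_`[0, p.2] u).
  by apply/funext => u; rewrite /step_fun big_cons addrC.
rewrite E; split; first exact: finite_energyD.
have [_ _ i1 _] := fs; have [_ _ i2 _] := fp.
by move=> t; rewrite window_avgD// ws big_cons addrC.
Qed.

Lemma patch_support a : (forall u, ~~ (0 <= u <= T) -> a u = 0) -> a \_ `[0, T] = a.
Proof.
move=> sa; apply/funext => u; rewrite /patch; case: ifPn => // nu.
by rewrite sa//; apply: contra nu => u0T; rewrite inE/= in_itv.
Qed.

(* Windows starting after [p] ignore the possibly negative part of [a]; a box of such windows has
   a uniformly positive average. *)
Lemma dot_window_avg_gt0 a (p h eps : R) : fen a -> 0 < h -> 0 < eps ->
  (forall u, p < u -> 0 <= a u) ->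
  (forall u, p + h / 2 <= u <= p + 3 * h / 4 -> eps <= a u) ->
  0 < dot mu2 (wavg a) (wavg a).
Proof.
move=> fa h0 e0 a0 ae.
have [ma _ ai _] := fa.
(* Every window of the box [B] starts after [p] and contains [J]; the constant [k] below is [eps]
   times the least weight in the box. *)
pose J := `[(p + h / 2), (p + 3 * h / 4)]%classic.
pose B : set (RR * RR) := `[h, (2 * h)]%classic `*` `[(p + h / 4), (p + h / 2)]%classic.
have mB : measurable B by apply: measurableX; exact: measurable_itv.
have mJ : measurable J by exact: measurable_itv.
have muI (x y : R) : x <= y -> mu `[x, y]%classic = (y - x)%:E.
  rewrite lebesgue_measure_itv/= lte_fin le_eqVlt => /orP[/eqP ->|->].
    by rewrite ltxx subrr.
  by rewrite -EFinD.
have muJ : mu J = (h / 4)%:E by rewrite muI; [congr EFin; field|lra].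
have muB : mu2 B = (h * (h / 4))%:E.
  transitivity (mu `[h, (2 * h)%R]%classic *
      mu `[(p + h / 4)%R, (p + h / 2)%R]%classic)%E.
    by apply: product_measure1E; exact: measurable_itv.
  by rewrite !muI; [rewrite -EFinM; congr EFin; field|lra|lra].
pose k := eps * (2 * h) `^ (H - 2).
have h20 : 0 < 2 * h by lra.
have k0 : 0 < k by rewrite mulr_gt0// powR_gt0.
have wB t : B t -> k * (h / 4) <= wavg a t.
  case: t => l r [/=]; rewrite !in_itv/= => /andP[l1 l2] /andP[r1 r2].
  have l0 : 0 < l by exact: lt_le_trans l1.
  have Ji : mu.-integrable setT (EFin \o (\1_J : R -> R)).
    by apply: integrable_indic_lty => //; rewrite [X in (X < _)%E]muJ ltry.
  rewrite (_ : k * (h / 4) = \int[mu]_u (k * \1_J u)).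
    apply: le_Rintegral => //.
    - exact: (integrableZl measurableT k Ji).
    - exact: (integrable_mul_window H (l, r) ai).
    move=> u _; rewrite /window /= l0 /=.
    case: ifPn => [/andP[ru ul]|nru]; last first.
      rewrite indicE (_ : u \in J = false) ?mulr0//; apply/negbTE; apply: contra nru.
      by rewrite inE /J/= in_itv/= => /andP[u1 u2]; apply/andP; split; lra.
    have au : 0 <= a u by apply: a0; lra.
    rewrite indicE; case: (boolP (u \in J)) => [|_]; last first.
      by rewrite mulr0 mulr_ge0// powR_ge0.
    rewrite inE /J/= in_itv/= mulr1 => /ae eau.
    apply: ler_pM => //; [exact: ltW|exact: powR_ge0|].
    have Hm : 0 <= 2 - H by case/andP: H_range => ? ?; lra.
    rewrite (_ : H - 2 = - (2 - H)); last by ring.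
    rewrite !powRN lef_pV2 ?posrE ?powR_gt0//.
    by apply: ge0_ler_powR; rewrite ?nnegrE// ltW.
  rewrite RintegralZl//; congr (_ * _).
  by rewrite /Rintegral integral_indic// setIT [X in fine X]muJ.
have Bi : mu2.-integrable setT (EFin \o (\1_B : RR * RR -> R)).
  by apply: integrable_indic_lty => //; rewrite [X in (X < _)%E]muB ltry.
apply: (@lt_le_trans _ _ (\int[mu2]_t ((k * (h / 4)) ^+ 2 * \1_B t))).
  have kh : 0 < (k * (h / 4)) ^+ 2 by rewrite exprn_gt0// mulr_gt0// divr_gt0.
  rewrite RintegralZl// mulr_gt0//.
  by rewrite /Rintegral integral_indic// setIT [X in fine X]muB /= mulr_gt0 ?divr_gt0.
apply: le_Rintegral => //.
- exact: (integrableZl measurableT _ Bi).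
- have sa := sqr_integrable_window_avg fa; exact: (sqr_integrable_mul sa sa).
move=> t _; rewrite indicE; case: (boolP (t \in B)) => [/set_mem Bt|_].
  rewrite mulr1 -expr2 ler_sqr ?nnegrE ?wB//; first by rewrite mulr_ge0 ?ltW ?divr_gt0.
  by apply: le_trans (wB t Bt); rewrite mulr_ge0 ?ltW ?divr_gt0.
by rewrite mulr0 -expr2 sqr_ge0.
Qed.

End energy_norm.

(** * The Gamma function *)

Section Gamma_positive.
Context (R : realType).
Notation mu := (@lebesgue_measure R).

(** For a < 1 the integrand is unbounded near 0, so the primitive is used on [1/(n+2), 1] and
    monotone convergence exhausts ]0, 1]. The shift by 2 keeps these intervals nondegenerate. *)
Lemma integral_powR_unit (a : R) : 0 < a ->
  (\int[mu]_(x in `]0%R, 1%R]) (x `^ (a - 1))%:E <= (a^-1)%:E)%E.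
Proof.
move=> a0.
pose F n : set R := `[(n.+2%:R^-1), 1]%classic.
have n0 n : 0 < n.+2%:R^-1 :> R by rewrite invr_gt0.
have n1 n : n.+2%:R^-1 < 1 :> R by rewrite invf_lt1// ltr1n.
have FE : \bigcup_n F n = `]0, 1]%classic.
  apply/seteqP; split => x.
    case=> n _; rewrite /F/= !in_itv/= => /andP[nx ->].
    by rewrite (lt_le_trans (n0 n) nx).
  rewrite /= in_itv/= => /andP[x0 x1].
  have [n _ nx] := @near_infty_natSinv_lt R (PosNum x0).
  exists n => //; rewrite /F/= in_itv/= x1 andbT.
  apply: le_trans (ltW (nx n (leqnn n))); rewrite /= lef_pV2 ?posrE// ler_nat.
  exact: leqnSn.
have mP : measurable_fun setT (fun x : R => x `^ (a - 1)) by exact: measurable_powR.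
have := @ge0_nondecreasing_set_cvg_integral _ (measurableTypeR R) R F (fun x => (x `^ (a - 1))%:E) mu.
rewrite FE => h.
have {}h : ((\int[mu]_(x in F i) (x `^ (a - 1))%:E)%E @[i --> \oo] -->
    (\int[mu]_(x in `]0%R, 1%R]) (x `^ (a - 1))%:E)%E).
  apply: h.
  - apply/nondecreasing_seqP => n; apply/subsetPset => x.
    rewrite /F/= !in_itv/= => /andP[nx ->]; rewrite andbT (le_trans _ nx)//.
    by rewrite lef_pV2 ?posrE// ler_nat.
  - by move=> n; exact: measurable_itv.
  - by move=> n; apply/measurable_EFinP; exact: measurable_funTS.
  - by move=> n x _; rewrite lee_fin powR_ge0.
rewrite -(cvg_lim _ h)//; apply: lime_le; first by apply/cvg_ex; eexists; exact: h.
apply: nearW => n.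
pose G (x : R) := a^-1 * x `^ a.
have dG (x : R) : 0 < x -> is_derive x 1 G (x `^ (a - 1)).
  move=> x0; have e := is_derive1_powR a x0.
  apply: is_derive_eq; rewrite /GRing.scale/= mulrA mulVf ?mul1r// gt_eqF//.
have cG (x : R) : 0 < x -> {for x, continuous G}.
  move=> x0; apply: differentiable_continuous; apply/derivable1_diffP.
  have ? := dG x x0; exact: ex_derive.
rewrite (@continuous_FTC2 _ _ G)//; last 3 first.
- apply: continuous_in_subspaceT => x; rewrite inE/= in_itv/= => /andP[nx _].
  have x0 : 0 < x by exact: lt_le_trans nx.
  apply: differentiable_continuous; apply/derivable1_diffP.
  by have ? := is_derive1_powR (a - 1) x0; exact: ex_derive.
- split.
  + move=> x; rewrite in_itv/= => /andP[nx _]; have ? := dG x (lt_trans (n0 n) nx).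
    exact: ex_derive.
  + by apply: cvg_at_right_filter; exact: cG.
  + by apply: cvg_at_left_filter; exact: cG.
- move=> x; rewrite in_itv/= => /andP[nx _]; have ? := dG x (lt_trans (n0 n) nx).
  by rewrite derive1E derive_val.
rewrite -EFinB lee_fin /G powR1 mulr1 gerBl mulr_ge0 ?powR_ge0// invr_ge0 ltW//.
Qed.

(** Finiteness has to be proved too, because [fine] sends an infinite integral to 0: the integrand
    is at most x^(a-1) on ]0, 1] plus the exponential density. Positivity is read off on [1, 2]. *)
Lemma Gamma_gt0 (a : R) : 0 < a < 1 -> 0 < Gamma a.
Proof.
case/andP => a0 a1.
pose D := `]0, +oo[%classic : set R.
pose g (x : R) := x `^ (a - 1) * expR (- x).
have mP : measurable_fun setT (fun x : R => x `^ (a - 1)) by exact: measurable_powR.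
have mE : measurable_fun setT (fun x : R => expR (- x)) by exact: measurableT_comp.
have mg : measurable_fun setT g by exact: measurable_funM.
have g0 x : 0 <= g x by rewrite mulr_ge0 ?powR_ge0 ?expR_ge0.
have mD : measurable D by exact: measurable_itv.
have fin : (\int[mu]_(x in D) (g x)%:E < +oo)%E.
  pose k (x : R) := (x `^ (a - 1)) * \1_(`]0, 1] : set R) x + exponential_pdf 1 x.
  have m1 : measurable_fun setT (fun x : R => (x `^ (a - 1)) * \1_(`]0, 1] : set R) x).
    by apply: measurable_funM => //; exact: measurable_indic.
  have e0 x : 0 <= exponential_pdf (1 : R) x by exact: exponential_pdf_ge0.
  have p0 (x : R) : 0 <= x `^ (a - 1) * \1_(`]0, 1] : set R) x by rewrite mulr_ge0 ?powR_ge0.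
  have mexp : measurable_fun setT (exponential_pdf (1 : R)) by exact: measurable_exponential_pdf.
  have mk : measurable_fun setT k by exact: measurable_funD.
  apply: (@le_lt_trans _ _ (\int[mu]_x (k x)%:E)%E).
    rewrite integral_mkcond; apply: ge0_le_integral => //.
    - by move=> x _; apply: erestrict_ge0 => y _; rewrite lee_fin.
    - apply/measurable_restrict => //; apply: measurable_funTS; exact/measurable_EFinP.
    - exact/measurable_EFinP.
    move=> x _; rewrite /patch; case: ifPn => xD; last by rewrite lee_fin addr_ge0.
    have {}xD : 0 < x by move: xD; rewrite inE /D/= in_itv/= andbT.
    rewrite lee_fin /k /g (exponential_pdfE _ (ltW xD)) mul1r mulN1r indicE.
    case: (boolP (x \in _)) => [_|]; rewrite ?mulr1 ?mulr0 ?add0r.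
      apply: ler_wpDr; first exact: expR_ge0.
      apply: ler_piMr; first exact: powR_ge0.
      by rewrite -expR0 ler_expR oppr_le0 ltW.
    move=> /negP; rewrite inE/= in_itv/= xD/= => /negP; rewrite -ltNge => x1.
    rewrite ler_piMl ?expR_ge0// (_ : a - 1 = - (1 - a)); last by ring.
    rewrite powRN invf_le1 ?powR_gt0//.
    have a1' : 0 <= 1 - a by rewrite subr_ge0 ltW.
    by have := ler_powR (ltW x1) a1'; rewrite powRr0.
  rewrite /k; under eq_integral do rewrite EFinD.
  rewrite ge0_integralD//; last 4 first.
  - by move=> x _; rewrite lee_fin.
  - exact/measurable_EFinP.
  - by move=> x _; rewrite lee_fin.
  - exact/measurable_EFinP.
  rewrite integral_exponential_pdf// lte_add_pinfty ?ltry//.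
  apply: le_lt_trans (ltry a^-1); apply: le_trans (integral_powR_unit a0).
  rewrite [leRHS]integral_mkcond le_eqVlt; apply/orP; left; apply/eqP.
  apply: eq_integral => x _; rewrite /patch indicE; case: ifP => _; first by rewrite mulr1.
  by rewrite mulr0.
have k0 : 0 < (2 : R) `^ (a - 1) * expR (- 2) by rewrite mulr_gt0 ?powR_gt0 ?expR_gt0.
rewrite /Gamma /Rintegral fine_gt0// fin andbT.
apply: (@lt_le_trans _ _ (\int[mu]_(x in `[1%R, 2%R]) ((2 : R) `^ (a - 1) * expR (- 2))%:E)%E).
  rewrite integral_cst//= lebesgue_measure_itv/= lte_fin ltr1n -EFinD -EFinM lte_fin.
  by rewrite mulr_gt0//; lra.
apply: (@le_trans _ _ (\int[mu]_(x in `[1%R, 2%R]) (g x)%:E)%E).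
  apply: ge0_le_integral => //.
  - by apply/measurable_EFinP; exact: measurable_funTS.
  move=> x; rewrite /= in_itv/= => /andP[x1 x2]; rewrite lee_fin ler_pM ?powR_ge0 ?expR_ge0//.
    have x0 : 0 < x by exact: lt_le_trans x1.
    rewrite (_ : a - 1 = - (1 - a)); last by ring.
    rewrite !powRN lef_pV2 ?posrE ?powR_gt0//.
    by apply: ge0_ler_powR; rewrite ?nnegrE ?subr_ge0// ltW.
  by rewrite ler_expR lerN2.
apply: ge0_subset_integral => //.
- by apply/measurable_EFinP; exact: measurable_funTS.
- by move=> x _; rewrite lee_fin.
- by move=> x; rewrite /D/= !in_itv/= andbT => /andP[x1 _]; exact: lt_le_trans x1.
Qed.

End Gamma_positive.

(** * Wiener integrals *)

Lemma cvg_eqfun (R : realType) (f g : nat -> R) (l : R) :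
  f @ \oo --> l -> f =1 g -> g @ \oo --> l.
Proof. by move=> fl /funext <-. Qed.

Lemma cos_lipschitz (R : realType) (x y : R) : `|cos x - cos y| <= `|x - y|.
Proof.
wlog xy : x y / x <= y.
  by move=> h; have [/h//|/ltW/h] := leP x y; rewrite distrC [leRHS]distrC.
have [|c _ e] := @MVT_segment R (@cos R) (fun x => - sin x) x y xy.
  by apply: continuous_subspaceT => z; exact: continuous_cos.
by rewrite distrC e [leRHS]distrC normrM normrN ler_piMl// sin_max.
Qed.

Section gaussian_limit.
Context d (Omega : measurableType d) (R : realType) (P : probability Omega R).
Implicit Types (X : Omega -> R).

Lemma sqr_integrable_cst (c : R) : sqr_integrable P (fun=> c).
Proof.
split; first exact: measurable_cst.
by apply: (@bounded_integrable_prob _ _ _ P `|c ^+ 2|); first exact: measurable_cst.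
Qed.

(** The cosine is 1-Lipschitz, and |xi G| <= e/2 + (xi G)^2 / (e/2) bounds the mean of |xi G| by the
    mean square of G. *)
Lemma cf_limit (S : nat -> Omega -> R) X (xi theta : R) : sqr_integrable P X ->
  (forall k, sqr_integrable P (S k)) ->
  (fun k => let G := fun w => X w - S k w in dot P G G) @ \oo --> (0 : R) ->
  (fun k => \int[P]_w cos (xi * S k w + theta)) @ \oo --> \int[P]_w cos (xi * X w + theta).
Proof.
move=> sX sS S0.
have mcos : measurable_fun setT (@cos R).
  by apply: continuous_measurable_fun; exact: continuous_cos.
have icos Y : sqr_integrable P Y ->
    P.-integrable setT (EFin \o (fun w => cos (xi * Y w + theta))).
  move=> [mY _]; apply: (@bounded_integrable_prob _ _ _ P 1); last by move=> w; exact: cos_max.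
  apply: (measurableT_comp mcos); apply: measurable_funD => //; exact: measurable_funM.
apply/cvgrPdist_le => e e0.
(* The added 1 keeps [c] positive when xi = 0. *)
pose c := xi ^+ 2 / (e / 2) + 1.
have c0 : 0 < c by rewrite ltr_wpDl// divr_ge0 ?sqr_ge0// divr_ge0// ltW.
move/cvgrPdist_le : S0 => /(_ (e / 2 / c)) /(_ _)[]; first by rewrite !divr_gt0.
move=> K _ KP; exists K => // k Kk; have := KP k Kk.
rewrite /= sub0r normrN ger0_norm ?dot_ge0//.
set G := (fun w => X w - S k w); rewrite ler_pdivlMr// => Gc.
have sG : sqr_integrable P G.
  by apply: eq_sqr_integrable (sqr_integrableD (-1) sX (sS k)) => w; rewrite mulN1r.
have [_ iG] := sG.
rewrite -RintegralB//; [|exact: icos..].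
apply: le_trans (le_normr_Rintegral measurableT _) _.
  exact: (integrableB measurableT (icos _ sX) (icos _ (sS k))).
have ie : P.-integrable setT (EFin \o (fun=> e / 2)).
  by apply: (@bounded_integrable_prob _ _ _ P `|e / 2|); first exact: measurable_cst.
apply: (@le_trans _ _ (\int[P]_w (e / 2 + xi ^+ 2 / (e / 2) * G w ^+ 2))).
  apply: le_Rintegral => //.
  - by have := integrable_norm (integrableB measurableT (icos _ sX) (icos _ (sS k))).
  - exact: (integrableD measurableT ie (integrableZl measurableT _ iG)).
  move=> w _; apply: le_trans (cos_lipschitz _ _) _.
  rewrite (_ : _ - _ = xi * G w); last by rewrite /G; ring.
  have a0 : 0 < e / 2 by rewrite divr_gt0.
  have -> : xi ^+ 2 / (e / 2) * G w ^+ 2 = `|xi * G w| ^+ 2 / (e / 2).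
    by rewrite real_normK ?num_real// exprMn mulrAC.
  rewrite -(ler_pM2r a0) mulrDl divfK ?gt_eqF//.
  have := sqr_ge0 (e / 2 - `|xi * G w|); have := sqr_ge0 (e / 2 + `|xi * G w|).
  by nra.
rewrite RintegralD//; last exact: (integrableZl measurableT _ iG).
rewrite Rintegral_cst// [X in fine X]probability_setT/= mulr1 RintegralZl//.
have -> : \int[P]_w G w ^+ 2 = dot P G G by apply: eq_Rintegral => w _; rewrite expr2.
have := dot_ge0 P G; rewrite /c in Gc; lra.
Qed.

End gaussian_limit.

Section wiener.
Context d (Omega : measurableType d) (R : realType) (P : probability Omega R).
Variables (T H : R) (W : R -> {RV P >-> R}).
Hypothesis T_gt0 : 0 < T.
Hypothesis H_range : 2^-1 < H < 1.
Hypothesis W_fbm : fractional_brownian_motion T H W.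
Notation mu := (@lebesgue_measure R).
Notation mu2 := (lebesgue2 R).
Notation wavg := (window_avg H).
Notation fen := (finite_energy H T).
Hypothesis fen1 : forall q, 0 <= q <= T -> fen \1_`[0, q].

(** The factor of the covariance times the normalisation of the windows: the ratio between the
    variance of a Wiener integral and the energy of its integrand. *)
Let C : R := H * (2 * H - 1) * ((2 - 2 * H) * (3 - 2 * H)).

Let C0 : 0 < C.
Proof. by case/andP: H_range => ? ?; rewrite /C !mulr_gt0//; lra. Qed.

Let energy a := dot mu2 (wavg a) (wavg a).

Let sW q : 0 <= q <= T -> sqr_integrable P (W q).
Proof.
move=> qT; have mW : measurable_fun setT (W q) by [].
split => //; apply: gaussian_rv_integrable_sqr => //.
have := fbm_gaussian W_fbm (s := [:: (1, q)]).
have -> : step_integral W [:: (1, q)] = W q.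
  by apply/funext => w; rewrite /step_integral big_seq1 mul1r.
by apply => p; rewrite inE => /eqP ->.
Qed.

Let EW q : 0 <= q <= T -> \int[P]_w W q w = 0.
Proof. by move=> /(fbm_centered W_fbm); rewrite unlock /Rintegral => ->. Qed.

Let dotW p q : 0 <= p <= T -> 0 <= q <= T ->
  dot P (W p) (W q) = C * dot mu2 (wavg \1_`[0, p]) (wavg \1_`[0, q]).
Proof.
move=> pT qT.
have := fbm_covariance W_fbm qT pT.
pose o : R -> R := fun=> 1.
have one (A : set R) : (o \_ A) = \1_A :> (R -> R).
  by apply/funext => u; rewrite /patch indicE; case: ifP.
have := @kernel_restrict_window_avg R H T H_range `[0, p] `[0, q] o o.
rewrite !one => /(_ (fen1 pT) (fen1 qT)) E.
have {}E : \int[mu]_(v in `[0, q]) \int[mu]_(u in `[0, p]) (`|u - v| `^ (2 * H - 2)) =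
    (2 - 2 * H) * (3 - 2 * H) * dot mu2 (wavg \1_`[0, p]) (wavg \1_`[0, q]).
  by rewrite -E; apply: eq_Rintegral => v _; apply: eq_Rintegral => u _; rewrite /= !mul1r.
rewrite E => cov.
have := congr1 fine cov; rewrite unlock (fbm_centered W_fbm pT) (fbm_centered W_fbm qT).
rewrite unlock /C /= !mulrA => <-; apply: (congr1 fine); apply: eq_integral => w _ /=.
by transitivity ((W q w - 0) * (W p w - 0))%:E; [rewrite !subr0 mulrC|].
Qed.

Lemma step_integral_isometry s : step_on T s ->
  [/\ sqr_integrable P (step_integral W s), \int[P]_w step_integral W s w = 0 &
      dot P (step_integral W s) (step_integral W s) = C * energy (step_fun s)].
Proof.
move=> sT.
pose ok q := 0 <= q <= T.
(* Times outside [0, T], where nothing is known of [W], are sent to 0, so that [dot_transfer] finds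
   the isometry at all indices; [step_on] makes the change invisible. *)
pose X q : Omega -> R := if ok q then (W q : Omega -> R) else (fun=> 0).
pose Y q : R * R -> R := if ok q then wavg \1_`[0, q] else (fun=> 0).
have sX q : sqr_integrable P (X q).
  by rewrite /X; case: ifP => [/sW//|_]; exact: sqr_integrable0.
have sY q : sqr_integrable mu2 (Y q).
  rewrite /Y; case: ifP => [/fen1 fq|_]; first exact: (sqr_integrable_window_avg H_range fq).
  exact: sqr_integrable0.
have XY p q : dot P (X p) (X q) = C * dot mu2 (Y p) (Y q).
  rewrite /X /Y; case: (boolP (ok p)) => pT; case: (boolP (ok q)) => qT; first exact: dotW.
  - by rewrite !dot0r mulr0.
  - by rewrite dotC [in RHS]dotC !dot0r mulr0.
  - by rewrite !dot0r mulr0.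
have SX : step_integral W s = (fun w => \sum_(p <- s) p.1 * X p.2 w).
  apply/funext => w; apply: eq_big_seq => p ps; by rewrite /X /ok sT.
have SY : wavg (step_fun s) = (fun t => \sum_(p <- s) p.1 * Y p.2 t).
  apply/funext => t; have [_ ->] := finite_energy_step T_gt0 fen1 sT.
  by apply: eq_big_seq => p ps; rewrite /Y /ok sT.
split.
- rewrite SX; exact: (sqr_integrable_sum _ (fun p : R * R => p.1) (fun p => sX p.2)).
- have -> : \int[P]_w step_integral W s w = dot P (fun=> 1) (step_integral W s).
    by apply: eq_Rintegral => w _; rewrite mul1r.
  rewrite SX (@dot_sumr _ _ _ _ _ _ (fun p : R * R => p.1) (fun p => X p.2))//; last first.
    exact: sqr_integrable_cst.
  rewrite big1_seq// => p /= ps; rewrite /X /ok sT// /dot.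
  by under eq_Rintegral do rewrite mul1r; rewrite EW ?mulr0// sT.
rewrite /energy SX SY.
by apply: (@dot_transfer _ _ _ _ _ P mu2 _ (fun p : R * R => X p.2)
  (fun p => Y p.2) C s (fun p => p.1)).
Qed.

Let step_integralD (c : R) s r w :
  step_integral W (s ++ [seq (c * p.1, p.2) | p <- r]) w =
  step_integral W s w + c * step_integral W r w.
Proof.
rewrite /step_integral big_cat big_map/= mulr_sumr; congr (_ + _).
by apply: eq_bigr => p _; rewrite mulrA.
Qed.

Let step_funD (c : R) (s r : step_code R) u :
  step_fun (s ++ [seq (c * p.1, p.2) | p <- r]) u = step_fun s u + c * step_fun r u.
Proof.
rewrite /step_fun big_cat big_map/= mulr_sumr; congr (_ + _).
by apply: eq_bigr => p _; rewrite mulrA.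
Qed.

(* The pair (X, psi) is approximated by the same step codes on both sides of the isometry, which
   makes it stable under linear combinations. *)
Definition wiener_limit (X : Omega -> R) (psi : R -> R) :=
  [/\ sqr_integrable P X, fen psi & exists s : nat -> step_code R,
    [/\ forall k, step_on T (s k),
        (fun k => let G := fun w => X w - step_integral W (s k) w in dot P G G) @ \oo --> (0 : R) &
        (fun k => energy (fun u => psi u - step_fun (s k) u)) @ \oo --> (0 : R)]].

Lemma fen_step s : step_on T s -> fen (step_fun s).
Proof. by move=> /(finite_energy_step T_gt0 fen1)[]. Qed.

(** The isometry of step codes passes to the limit on both sides, by continuity of the norm. *)
Lemma wiener_limit_energy X psi : wiener_limit X psi ->
  dot P X X = C * energy psi.
Proof.
move=> [sX fpsi [s [sT sX0 spsi0]]].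
have sS k : sqr_integrable P (step_integral W (s k)) by have [] := step_integral_isometry (sT k).
have h1 := cvg_dot sX sS sX0.
have [_ _ psii _] := fpsi.
have ss k : sqr_integrable mu2 (wavg (step_fun (s k))).
  exact: (sqr_integrable_window_avg H_range (fen_step (sT k))).
have h2 : (fun k => dot mu2 (wavg (step_fun (s k))) (wavg (step_fun (s k)))) @ \oo --> energy psi.
  apply: cvg_dot => //; first exact: (sqr_integrable_window_avg H_range fpsi).
  rewrite [X in X @ _](_ : _ = (fun k => energy (fun u => psi u - step_fun (s k) u)))//.
  apply/funext => k; have [_ _ si _] := fen_step (sT k).
  rewrite /energy; have -> : (fun u => psi u - step_fun (s k) u) =
    (fun u => psi u + (-1) * step_fun (s k) u) by apply/funext => u; rewrite mulN1r.
  have -> // : wavg (fun u => psi u + (-1) * step_fun (s k) u) =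
    (fun t => wavg psi t - wavg (step_fun (s k)) t).
  by apply/funext => t; rewrite window_avgD// mulN1r.
have h3 : (fun k => dot P (step_integral W (s k)) (step_integral W (s k))) @ \oo --> C * energy psi.
  under eq_fun => k do have [_ _ ->] := step_integral_isometry (sT k).
  exact: cvgMl_tmp.
exact: (cvg_unique _ h1 h3).
Qed.

(** Step integrals are centred Gaussian, so their transforms depend only on their norms; transforms
    and norms both converge. *)
Lemma wiener_limit_cf X psi (xi theta : R) : wiener_limit X psi ->
  \int[P]_w cos (xi * X w + theta) = cos theta * expR (- (xi ^+ 2 * dot P X X / 2)).
Proof.
move=> [sX fpsi [s [sT sX0 _]]].
have sS k : sqr_integrable P (step_integral W (s k)) by have [] := step_integral_isometry (sT k).
have h1 := @cf_limit _ _ _ P _ _ xi theta sX sS sX0.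
have h2 : (fun k => \int[P]_w cos (xi * step_integral W (s k) w + theta)) @ \oo -->
    cos theta * expR (- (xi ^+ 2 * dot P X X / 2)).
  rewrite [X in X @ _](_ : _ = (fun k => cos theta * expR (- (xi ^+ 2 *
    dot P (step_integral W (s k)) (step_integral W (s k)) / 2)))).
    apply: cvgMl_tmp; apply: continuous_cvg; first exact: continuous_expR.
    by apply: cvgN; apply: cvgMr_tmp; apply: cvgMl_tmp; exact: cvg_dot sX sS sX0.
  apply/funext => k; have [[mS _] S0 _] := step_integral_isometry (sT k).
  rewrite (@gaussian_rv_cf _ _ _ P)//; last exact: fbm_gaussian W_fbm _ (sT k).
exact: (cvg_unique _ h1 h2).
Qed.

Lemma wiener_limitD (c : R) X Y phi psi : wiener_limit X phi -> wiener_limit Y psi ->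
  wiener_limit (fun w => X w + c * Y w) (fun u => phi u + c * psi u).
Proof.
move=> [sX fphi [s [sT sX0 sphi0]]] [sY fpsi [r [rT rY0 rpsi0]]].
split; [exact: sqr_integrableD|exact: finite_energyD|].
pose q k : step_code R := s k ++ [seq (c * p.1, p.2) | p <- r k].
have qT k : step_on T (q k).
  move=> p; rewrite mem_cat => /orP[/sT//|/mapP[p' p'r ->]/=]; exact: rT p'r.
have sI s' : step_on T s' -> sqr_integrable P (step_integral W s').
  by move=> s'T; have [] := step_integral_isometry s'T.
have sB Z s' : sqr_integrable P Z -> step_on T s' ->
    sqr_integrable P (fun w => Z w - step_integral W s' w).
  move=> sZ s'T; apply: eq_sqr_integrable (sqr_integrableD (-1) sZ (sI _ s'T)) => w.
  by rewrite mulN1r.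
have fB a s' : fen a -> step_on T s' -> fen (fun u => a u - step_fun s' u).
  move=> fa s'T; have := finite_energyD (-1) fa (fen_step s'T).
  by congr fen; apply/funext => u; rewrite mulN1r.
exists q; split; first exact: qT.
- apply: cvg_eqfun (@cvg0_dotDD _ _ _ P c _ _ (fun k => sB _ _ sX (sT k))
    (fun k => sB _ _ sY (rT k)) sX0 rY0) _ => k /=; congr (dot _ _ _); apply/funext => w;
  by rewrite /q step_integralD; ring.
have fs k := fB _ _ fphi (sT k); have fr k := fB _ _ fpsi (rT k).
apply: cvg_eqfun (@cvg0_dotDD _ _ _ mu2 c _ _
  (fun k => sqr_integrable_window_avg H_range (fs k))
  (fun k => sqr_integrable_window_avg H_range (fr k)) sphi0 rpsi0) _ => k /=; rewrite /energy.
have [_ _ i1 _] := fs k; have [_ _ i2 _] := fr k.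
have -> : (fun u => phi u + c * psi u - step_fun (q k) u) =
    (fun u => (phi u - step_fun (s k) u) + c * (psi u - step_fun (r k) u)).
  by apply/funext => u; rewrite /q step_funD; ring.
by congr (dot _ _ _); apply/funext => t; rewrite window_avgD.
Qed.

Lemma wiener_limit0 : wiener_limit (fun=> 0) (fun=> 0).
Proof.
have nilT : step_on T ([::] : step_code R) by [].
have sI w : step_integral W [::] w = 0 by rewrite /step_integral big_nil.
have sf : step_fun [::] = (fun=> 0) :> (R -> R).
  by apply/funext => u; rewrite /step_fun big_nil.
have f0 := fen_step nilT; rewrite sf in f0.
have w0 : wavg (fun=> 0) = (fun=> 0).
  apply/funext => t; rewrite /window_avg; under eq_Rintegral do rewrite mul0r.
  by rewrite Rintegral_cst// mul0r.
split; [exact: sqr_integrable0|exact: f0|exists (fun=> [::]); split; first by []].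
- rewrite [X in X @ _](_ : _ = cst 0); first exact: cvg_cst.
  apply/funext => k /=; rewrite -[RHS](dot0r P (fun=> 0)).
  by congr (dot _ _ _); apply/funext => w; rewrite sI subr0.
- rewrite [X in X @ _](_ : _ = cst 0); first exact: cvg_cst.
  apply/funext => k /=; rewrite -[RHS](dot0r mu2 (fun=> 0)) /energy sf.
  have -> : (fun u : R => 0 - 0 : R) = (fun=> 0) by apply/funext => u; rewrite subr0.
  by rewrite w0.
Qed.

Lemma wiener_limit_sum (n : nat) (b : nat -> R) (X : nat -> Omega -> R) (psi : nat -> R -> R) :
  (forall k, (k < n)%N -> wiener_limit (X k) (psi k)) ->
  wiener_limit (fun w => \sum_(0 <= k < n) b k * X k w)
    (fun u => \sum_(0 <= k < n) b k * psi k u).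
Proof.
elim: n => [_|n ih wl].
  have := wiener_limit0; congr wiener_limit; apply/funext => w; by rewrite big_geq.
have := wiener_limitD (b n) (ih (fun k kn => wl k (ltnW kn))) (wl n (ltnSn n)).
by congr wiener_limit; apply/funext => w; rewrite big_nat_recr.
Qed.

Lemma wiener_integral_limit (phi : R -> R) (X : {RV P >-> R}) :
  is_wiener_integral T H W phi X -> wiener_limit X (phi \_ `[0, T]).
Proof.
move=> [phiH [s [sT phis0 Xs0]]].
have fphi := function_in_H_finite_energy H_range T_gt0 phiH.
have sI k : sqr_integrable P (step_integral W (s k)).
  by have [] := step_integral_isometry (sT k).
have mX : measurable_fun setT (X : Omega -> R) by [].
pose D k w := X w - step_integral W (s k) w.
have mD k : measurable_fun setT (D k) by have [mS _] := sI k; exact: measurable_funB.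
(* Convergence of the extended expectations to 0 makes one of them finite, and X is a step integral
   plus the corresponding error. *)
have sX : sqr_integrable P X.
  have [K _ KP] : \forall k \near \oo, 'E_P[fun w => (D k w ^+ 2)%R]%E \is a fin_num.
    by have /fine_cvgP[] := Xs0.
  have sD : sqr_integrable P (D K).
    split => //; apply/integrableP; split; first by apply/measurable_EFinP; exact: measurable_funX.
    under eq_integral do rewrite /= ger0_norm ?sqr_ge0//.
    by have := KP K (leqnn K); rewrite unlock ge0_fin_numE// integral_ge0// => w _;
      rewrite lee_fin sqr_ge0.
  apply: eq_sqr_integrable (sqr_integrableD 1 sD (sI K)) => w; rewrite /D; ring.
split; [exact: sX|exact: fphi|exists s; split; first exact: sT].
  have /fine_cvgP[_ D0] := Xs0; apply: cvg_eqfun D0 _ => k; rewrite /= unlock /dot /Rintegral; congr fine.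
have E k : energy (fun u => (phi \_ `[0, T]) u - step_fun (s k) u) =
    C^-1 * inner_H T H (fun u => phi u - step_fun (s k) u) (fun u => phi u - step_fun (s k) u).
  have [ms ss is_ es] := fen_step (sT k).
  have rE : (fun u => phi u - step_fun (s k) u) \_ `[0, T] =
      (fun u => (phi \_ `[0, T]) u - step_fun (s k) u).
    apply/funext => u; rewrite /patch; case: ifPn => // nu; rewrite ss ?subr0//.
    by apply: contra nu => u0T; rewrite inE/= in_itv.
  have fd : fen ((fun u => phi u - step_fun (s k) u) \_ `[0, T]).
    rewrite rE; have := finite_energyD (-1) fphi (fen_step (sT k)).
    by congr fen; apply/funext => u; rewrite mulN1r.
  by rewrite (inner_H_window_avg H_range fd) rE -/C mulrA mulVf ?gt_eqF// mul1r.
have h : (fun k => C^-1 * inner_H T H (fun u => phi u - step_fun (s k) u)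
    (fun u => phi u - step_fun (s k) u)) @ \oo --> C^-1 * 0 by exact: cvgMl_tmp.
by rewrite mulr0 in h; apply: cvg_eqfun h _ => k; rewrite E.
Qed.

End wiener.

(** * Regression of a Wiener integral on the preceding ones *)

Section regression.
Context d (Omega : measurableType d) (R : realType) (P : probability Omega R).
Variables (T H : R) (W : R -> {RV P >-> R}).
Hypothesis T_gt0 : 0 < T.
Hypothesis H_range : 2^-1 < H < 1.
Hypothesis W_fbm : fractional_brownian_motion T H W.
Notation mu2 := (lebesgue2 R).
Notation wavg := (window_avg H).
Hypothesis fen1 : forall q, 0 <= q <= T -> finite_energy H T \1_`[0, q].
Notation wlim := (wiener_limit T H W).

(* [G] is a multiple of the residual of the projection of [U m] on the previous [U k]: being
   uncorrelated, it splits off the characteristic function. *)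
Lemma wiener_regression (m : nat) (U : nat -> Omega -> R) (V : nat -> R -> R) (c : R) :
  c != 0 -> (forall k, (k <= m)%N -> wlim (U k) (V k)) ->
  (forall b, b m = 1 -> let psi := fun u => \sum_(0 <= k < m.+1) b k * V k u in
     finite_energy H T psi -> 0 < dot mu2 (wavg psi) (wavg psi)) ->
  exists (a : nat -> R) (s : R), 0 < s /\
    forall (xi : nat -> R) (eta theta : R),
    let G := fun w => c * (U m w - \sum_(0 <= k < m) a k * U k w) in
    \int[P]_w cos (\sum_(0 <= k < m) xi k * U k w + eta * G w + theta) =
    expR (- ((eta * s) ^+ 2 / 2)) *
    \int[P]_w cos (\sum_(0 <= k < m) xi k * U k w + theta).
Proof.
move=> c0 wU posV.
(* The projection lemma wants a whole sequence of square-integrable functions; beyond [m] it is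
   padded with 0. *)
pose e k : Omega -> R := if (k <= m)%N then U k else (fun=> 0).
have se k : sqr_integrable P (e k).
  by rewrite /e; case: ifP => [/wU[]//|_]; exact: sqr_integrable0.
have eE k : (k <= m)%N -> e k = U k by rewrite /e => ->.
have [a aP] := orthogonal_projection m se (se m).
pose G0 w := U m w - \sum_(0 <= k < m) a k * U k w.
have G0E : (fun w => e m w - \sum_(0 <= k < m) a k * e k w) = G0.
  apply/funext => w; rewrite /G0 eE//; congr (_ - _).
  by apply: eq_big_nat => k /andP[_ km]; rewrite eE// ltnW.
have orth k : (k < m)%N -> dot P G0 (U k) = 0.
  by move=> km; rewrite -(eE k (ltnW km)) -G0E aP.
(* The residual is itself a combination of the [U k] with coefficient 1 at [m], hence a Wiener
   integral whose energy [posV] makes positive. *)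
pose b k := if k == m then 1 else - a k.
have := wiener_limit_sum T_gt0 H_range W_fbm fen1 b (n := m.+1) (fun k km => wU k km).
have -> : (fun w => \sum_(0 <= k < m.+1) b k * U k w) = G0.
  apply/funext => w; rewrite big_nat_recr//= {2}/b eqxx mul1r addrC; congr (_ + _).
  rewrite -sumrN; apply: eq_big_nat => k /andP[_ km].
  by rewrite /b ltn_eqF// mulNr.
move=> wG; have [sG fG _] := wG.
have bm : b m = 1 by rewrite /b eqxx.
have := posV b bm fG => G0pos.
have D0 : 0 < dot P G0 G0.
  rewrite (wiener_limit_energy T_gt0 H_range W_fbm fen1 wG) mulr_gt0//.
  by case/andP: H_range => ? ?; rewrite !mulr_gt0//; lra.
pose s := `|c| * Num.sqrt (dot P G0 G0).
have s2 : s ^+ 2 = c ^+ 2 * dot P G0 G0.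
  by rewrite exprMn sqr_sqrtr ?ltW// real_normK ?num_real.
exists a, s; split; first by rewrite mulr_gt0 ?normr_gt0// sqrtr_gt0.
move=> xi eta theta /=.
pose L w := \sum_(0 <= k < m) xi k * U k w.
have wL := wiener_limit_sum T_gt0 H_range W_fbm fen1 xi (n := m) (fun k km => wU k (ltnW km)).
have [sL _ _] := wL.
have LG : dot P L G0 = 0.
  rewrite dotC.
  have -> : L = (fun w => \sum_(0 <= k < m) xi k * e k w).
    by apply/funext => w; apply: eq_big_nat => k /andP[_ km]; rewrite eE// ltnW.
  rewrite dot_sumr// big1_seq// => k /=; rewrite mem_index_iota => /andP[_ km].
  by rewrite eE ?orth ?mulr0// ltnW.
have wX := wiener_limitD T_gt0 H_range W_fbm fen1 (eta * c) wL wG.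
have cX := wiener_limit_cf T_gt0 H_range W_fbm fen1 1 theta wX.
have cL := wiener_limit_cf T_gt0 H_range W_fbm fen1 1 theta wL.
transitivity (\int[P]_w cos (1 * (L w + eta * c * G0 w) + theta)).
  by apply: eq_Rintegral => w _; rewrite mul1r mulrA.
(* Orthogonality removes the cross term from the variance, so the exponential splits into the factor
   of [G] and that of the past. *)
rewrite cX dotDD// [dot P _ G0]LG.
transitivity (expR (- ((eta * s) ^+ 2 / 2)) * \int[P]_w cos (1 * L w + theta)); last first.
  by congr (_ * _); apply: eq_Rintegral => w _; rewrite mul1r.
rewrite cL [RHS]mulrCA -expRD; congr (_ * expR _).
by rewrite [(eta * s) ^+ 2]exprMn s2; field.
Qed.

End regression.

(** * Euler--Maruyama approximations *)

Section ae_measurable.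
Context d (Omega : measurableType d) (R : realType) (P : probability Omega R).
Variables (m : nat) (U : nat -> Omega -> R).
Notation CU := (cylinders m U).
Notation OC := (g_sigma_algebraType CU).

Lemma measurable_coordinate k : (k < m)%N -> measurable_fun setT (U k : OC -> R).
Proof.
move=> km _ B mB; rewrite setTI; apply: sub_sigma_algebra.
exists (fun j => if j == k then B else setT); split.
  by move=> j; case: ifP.
apply/seteqP; split => w /=.
  by move=> Bw j jm; case: eqP => // ->.
by move=> /(_ k km); rewrite eqxx.
Qed.

(* Almost-everywhere equality is unavoidable: the recursion only holds almost surely,
   and the cylinder sigma-algebra is not complete. *)
Definition ae_sigma (X : Omega -> R) := exists Y : OC -> R,
  measurable_fun setT Y /\ {ae P, forall w, X w = Y w}.

Lemma ae_sigmaD X Y c : ae_sigma X -> ae_sigma Y -> ae_sigma (fun w => X w + c * Y w).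
Proof.
move=> [X' [mX XX']] [Y' [mY YY']]; exists (fun w => X' w + c * Y' w); split.
  by apply: measurable_funD => //; exact: measurable_funM.
by apply: filterS2 XX' YY' => w -> ->.
Qed.

Lemma ae_sigma_comp f X : measurable_fun setT f -> ae_sigma X -> ae_sigma (fun w => f (X w)).
Proof.
move=> mf [X' [mX XX']]; exists (fun w => f (X' w)); split; first exact: measurableT_comp.
by apply: filterS XX' => w ->.
Qed.

Lemma ae_sigma_cst c : ae_sigma (fun=> c).
Proof. by exists (fun=> c); split; [exact: measurable_cst|exact: aeW]. Qed.

Lemma ae_sigma_sum n (c : nat -> R) (X : nat -> Omega -> R) :
  (forall j, (j < n)%N -> ae_sigma (X j)) ->
  ae_sigma (fun w => \sum_(0 <= j < n) c j * X j w).
Proof.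
elim: n => [_|n ih aX].
  by under eq_fun do rewrite big_geq//; exact: ae_sigma_cst.
under eq_fun do rewrite big_nat_recr//=.
apply: ae_sigmaD; last exact: aX.
by apply: ih => j jn; apply: aX; exact: ltnW.
Qed.

Lemma eq_ae_sigma X Y : {ae P, forall w, X w = Y w} -> ae_sigma Y -> ae_sigma X.
Proof.
move=> XY [Y' [mY YY']]; exists Y'; split => //.
by apply: filterS2 XY YY' => w -> ->.
Qed.

End ae_measurable.

Lemma ae_eq_preimage d (Omega : measurableType d) (R : realType) (P : probability Omega R)
    (X Y : Omega -> R) (A : set R) : measurable_fun setT X -> measurable_fun setT Y ->
  {ae P, forall w, X w = Y w} -> measurable A -> P (X @^-1` A) = P (Y @^-1` A).
Proof.
move=> mX mY XY mA.
have mXA : measurable (X @^-1` A) by rewrite -[X in measurable X]setTI; exact: mX.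
have mYA : measurable (Y @^-1` A) by rewrite -[X in measurable X]setTI; exact: mY.
transitivity (\int[P]_w (\1_(X @^-1` A) w)%:E)%E; first by rewrite integral_indic// setIT.
transitivity (\int[P]_w (\1_(Y @^-1` A) w)%:E)%E; last by rewrite integral_indic// setIT.
apply: ae_eq_integral => //; [exact/measurable_EFinP|exact/measurable_EFinP|].
by apply: filterS XY => w XYw _; rewrite /= !indicE (_ : (w \in X @^-1` A) = (w \in Y @^-1` A))//;
  apply/idP/idP; rewrite !inE /= XYw.
Qed.

Theorem theorem2p4
    (R : realType) (d : measure_display) (Omega : measurableType d)
    (P : probability Omega R)
    (T H alpha sigma x0 : R) (f : R -> R) (N : nat)
    (F : R -> set (set Omega)) (W : R -> {RV P >-> R})
    (I : nat -> {RV P >-> R}) (x : nat -> {RV P >-> R})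
    (h : R) (t : nat -> R)
    (T_gt0 : 0 < T)
    (H_range : 2^-1 < H < 1)
    (alpha_range : 1 - H < alpha < 1)
    (sigma_neq0 : sigma != 0)
    (f_smooth : Cb_smooth f)
    (P_complete : measure_is_complete P)
    (F_usual : usual_filtration P T F)
    (W_fbm : fractional_brownian_motion T H W)
    (N_ge1 : (1 <= N)%N)
    (hE : h = T / N%:R)
    (tE : forall n, t n = n%:R * h)
    (I_wiener : forall n, (1 <= n <= N)%N ->
      is_wiener_integral T H W (fractional_kernel alpha (t n)) (I n))
    (x_init : forall w, x 0%N w = x0)
    (x_step : forall n, (1 <= n <= N)%N -> {ae P, forall w,
      x n w = x0
        + (Gamma alpha)^-1 *
          (\sum_(1 <= j < n.+1)
             f (x j.-1 w) *
             \int[lebesgue_measure]_(s in `[t j.-1, t j])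
               ((t n - s) `^ (alpha - 1)))
        + sigma / Gamma alpha * I n w}) :
  forall n, (1 <= n <= N)%N ->
    exists p : R -> R, smooth p /\ has_density (x n) p.
Proof.
case=> [//|m] /andP[_ mN].
have N0 : (0 : R) < N%:R by rewrite ltr0n.
have h0 : 0 < h by rewrite hE divr_gt0.
have t_le j k : (j <= k)%N -> t j <= t k by move=> jk; rewrite !tE ler_pM2r// ler_nat.
have tT k : (k <= N)%N -> t k <= T.
  by move=> /t_le; rewrite [t N]tE hE mulrCA divff ?gt_eqF// mulr1.
have tN : t N = T by rewrite tE hE mulrCA divff ?gt_eqF// mulr1.
have t_ge0 k : 0 <= t k by rewrite tE mulr_ge0// ltW.
have [a_gt a1] := andP alpha_range.
have a0 : 0 < alpha by case/andP: H_range => ? ?; lra.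
have fenI k : (1 <= k <= N)%N -> finite_energy H T (fractional_kernel alpha (t k) \_ `[0, T]).
  by move=> /I_wiener[fH _]; exact: function_in_H_finite_energy.
(* The last integral has its kernel at t_N = T, the one that dominates all these indicators. *)
have fen1 q : 0 <= q <= T -> finite_energy H T \1_`[0, q].
  by move=> qT; apply: (finite_energy_indic H_range T_gt0 a1 qT); have := fenI N;
    rewrite N_ge1 leqnn tN; apply.
(* With this shift the past of x_(m+1) is U_0, ..., U_(m-1), and U_m is the integral entering at its
   own step. *)
pose U k : Omega -> R := I k.+1.
pose phi k := fractional_kernel alpha (t k.+1).
pose V k := phi k \_ `[0, T].
have wU k : (k <= m)%N -> wiener_limit T H W (U k) (V k).
  move=> km; apply: (wiener_integral_limit T_gt0 H_range W_fbm fen1); apply: I_wiener.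
  by rewrite /= (leq_trans _ mN).
have VE k : (k <= m)%N -> V k = phi k.
  move=> km; apply: (patch_support (T := T)) => u nu.
  rewrite /phi /fractional_kernel indicE (_ : u \in _ = false) ?mul0r//.
  apply/negbTE; apply: contra nu; rewrite inE/= in_itv/= => /andP[-> ut].
  by rewrite (le_trans ut)// tT// (leq_trans _ mN).
pose c := sigma / Gamma alpha.
have G0 : 0 < Gamma alpha by apply: Gamma_gt0; rewrite a0.
have c0 : c != 0 by rewrite mulf_neq0// invr_eq0 gt_eqF.
have tm : t m.+1 = t m + h by rewrite !tE -addn1 natrD mulrDl mul1r.
have phi_ge0 k u : 0 <= phi k u by rewrite /phi /fractional_kernel mulr_ge0 ?powR_ge0.
have phi_eq0 k u : (k < m)%N -> t m < u -> phi k u = 0.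
  move=> km mu; rewrite /phi /fractional_kernel indicE (_ : u \in _ = false) ?mul0r//.
  apply/negbTE/negP; rewrite inE/= in_itv/= => /andP[_]; rewrite leNgt.
  by rewrite (le_lt_trans (t_le _ _ km)).
have [|a [s [s0 cf]]] := wiener_regression T_gt0 H_range W_fbm fen1 c0 wU.
  move=> b bm psi fpsi.
  have psiE u : t m < u -> psi u = phi m u.
    move=> mu; rewrite /psi big_nat_recr//= bm mul1r VE// big1_seq ?add0r// => k /=.
    by rewrite mem_index_iota => /andP[_ km]; rewrite VE ?phi_eq0 ?mulr0// ltnW.
  (* For u in the interval required there, the distance to t_(m+1) lies between h/4 and h/2. As
     alpha < 1, the kernel is at least h^(alpha-1), and the endpoint, where the power of 0 is 0, is
     avoided. *)
  apply: (@dot_window_avg_gt0 _ _ T H_range psi (t m) h (h `^ (alpha - 1))) => //.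
  - exact: powR_gt0.
  - by move=> u mu; rewrite psiE.
  move=> u /andP[u1 u2]; rewrite psiE; last by rewrite (lt_le_trans _ u1)// ltrDl divr_gt0.
  have u0 : 0 <= u by have := t_ge0 m; lra.
  have ut : u <= t m.+1 by rewrite tm; lra.
  rewrite /phi /fractional_kernel indicE (_ : u \in _ = true); last first.
    by apply/mem_set; rewrite /= in_itv/= u0.
  rewrite mul1r (_ : alpha - 1 = - (1 - alpha)); last by ring.
  rewrite !powRN lef_pV2 ?posrE ?powR_gt0//; last by rewrite tm; lra.
  by apply: ge0_ler_powR; rewrite ?nnegrE ?tm ?subr_ge0; lra.
pose G w := c * (U m w - \sum_(0 <= k < m) a k * U k w).
have mU k : measurable_fun setT (U k) by rewrite /U.
have mG : measurable_fun setT G.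
  apply: measurable_funM => //; apply: measurable_funB => //.
  by apply: measurable_sum => k; exact: measurable_funM.
have mf : measurable_fun setT f.
  apply: continuous_measurable_fun => y; apply: differentiable_continuous.
  by apply/derivable1_diffP; exact: (f_smooth.1 0%N y).
pose omega n j := \int[lebesgue_measure]_(s in `[t j, t j.+1]) ((t n - s) `^ (alpha - 1)).
have drift n : (n <= N)%N -> (forall j, (j < n)%N -> ae_sigma P m U (x j)) ->
    ae_sigma P m U (fun w => x0 + (Gamma alpha)^-1 *
      \sum_(0 <= j < n) omega n j * f (x j w)).
  move=> nN xj; apply: ae_sigmaD; first exact: ae_sigma_cst.
  by apply: ae_sigma_sum => j /xj; exact: ae_sigma_comp.
have step n : (1 <= n <= N)%N -> {ae P, forall w, x n w =
    x0 + (Gamma alpha)^-1 * \sum_(0 <= j < n) omega n j * f (x j w) + c * I n w}.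
  move=> /x_step; apply: filterS => w ->; congr (_ + _ * _ + _).
  by rewrite big_add1/=; apply: eq_bigr => j _; rewrite mulrC.
(* The value x_n involves I_1, ..., I_n, that is U_0, ..., U_(n-1), all in the past as long as n <=
   m. *)
have xsig n : (n <= m)%N -> ae_sigma P m U (x n).
  elim/ltn_ind: n => -[_ _|n ih nm].
    by apply: eq_ae_sigma (ae_sigma_cst P m U x0); exact: aeW.
  have nN : (n.+1 <= N)%N by rewrite (leq_trans nm)// ltnW.
  apply: eq_ae_sigma (step n.+1 nN) _; apply: ae_sigmaD.
    by apply: drift => // j jn; apply: ih => //; rewrite (leq_trans (ltnW jn)).
  exists (U n); split; [exact: measurable_coordinate|exact: aeW].
(* The projection of U_m joins the drift; what then remains of x_(m+1) is [G]. *)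
have : ae_sigma P m U (fun w => (x0 + (Gamma alpha)^-1 *
    \sum_(0 <= j < m.+1) omega m.+1 j * f (x j w)) + c * \sum_(0 <= k < m) a k * U k w).
  apply: ae_sigmaD; first by apply: drift => // j; rewrite ltnS; exact: xsig.
  apply: ae_sigma_sum => k km; exists (U k).
  by split; [exact: measurable_coordinate|exact: aeW].
move=> [Z [mZ ZE]].
have sZ A : measurable A -> <<s cylinders m U >> (Z @^-1` A).
  by move=> mA; rewrite -[X in _ X]setTI; exact: mZ.
(* Events of the past are measurable in the ambient space by the first half of
   [Rintegral_sigma_cos]. *)
have mZ' : measurable_fun setT (Z : Omega -> R).
  move=> _ A mA; rewrite setTI.
  by have [] := Rintegral_sigma_cos mU mG cf 0 0 (sZ A mA).
have ZG A B : measurable A -> measurable B -> P (Z @^-1` A `&` G @^-1` B) =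
    (P (Z @^-1` A) * normal_prob 0 1 ((fun z => s * z)%R @^-1` B))%E.
  by move=> mA mB; apply: (sigma_indep_normal mU mG cf (sZ A mA) mB).
exists (density_add P Z s).
have sp : smooth (density_add P Z s) by exact: smooth_density_add.
split => //; split.
- apply: continuous_measurable_fun => y; apply: differentiable_continuous.
  by apply/derivable1_diffP; exact: (sp 0%N y).
- by move=> y; apply: Rintegral_ge0 => w _; exact: normal_pdf_ge0.
move=> A mA; rewrite -(law_add_normal mZ' mG s0 ZG mA).
apply: (@ae_eq_preimage _ _ _ P (x m.+1) (fun w => Z w + G w)) => //.
  exact: measurable_funD.
have mN' : (1 <= m.+1 <= N)%N by rewrite mN.
apply: filterS2 (step m.+1 mN') ZE => w -> <-.
by rewrite /G /U; ring.
Qed.
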